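(* Let $G$ be a connected almost abelian Lie group equipped with a left-invariant Riemannian metric $g$. Then, for every $p\geq 0$, every left-invariant symmetric Killing $p$-tensor on $G$ is a polynomial (with real coefficients, with respect to the symmetric product) in the metric $g$ and the right-invariant and left-invariant Killing vector fields of $(G,g)$.
   Context: A Lie group is almost abelian if its Lie algebra contains an abelian ideal of codimension 1. For a vector space $V$, $\mathrm{Sym}^p(V)\subset V^{\otimes p}$ is spanned by the symmetric products $v_1\cdot\ldots\cdot v_p:=\sum_{\sigma\in\mathfrak S_p}v_{\sigma(1)}\otimes\ldots\otimes v_{\sigma(p)}$; $\mathrm{Sym}^0(V)=\mathbb R$. The symmetric product makes $\mathrm{Sym}^\bullet(V)$ the commutative symmetric algebra of $V$, and it is applied pointwise to symmetric tensor fields. On a Riemannian manifold $(M,g)$ with Levi-Civita connection $\nabla$, a symmetric $p$-tensor is a section of $\mathrm{Sym}^p(TM)$; the Killing operator is $\mathrm d(K)=\sum_i e_i\cdot\nabla_{e_i}K\in\Gamma(\mathrm{Sym}^{p+1}TM)$ for a local orthonormal frame $\{e_i\}$, and $K$ is Killing if $\mathrm d(K)=0$. For $p=1$ these are the Killing vector fields. Using the metric to identify $TM$ with $T^*M$, the metric $g$ is viewed as the symmetric 2-tensor $\tfrac12\sum_i e_i\cdot e_i$, which is Killing. A tensor field $S$ on $G$ is left-invariant if $(\mathcal L_a)_*S=S$ for all $a\in G$, where $\mathcal L_a(u)=au$; a right-invariant vector field is one of the form $(\xi_x)_u=(\mathcal R_u)_*x$, $x\in\mathfrak g$, where $\mathcal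 R_u(v)=vu$ (these are always Killing for a left-invariant metric). *)

(* Defs.v *)
From HB Require Import structures.
From mathcomp Require Import all_boot all_order all_algebra perm.
From mathcomp Require Import all_classical all_reals all_analysis.
Import numFieldNormedType.Exports.

Set Implicit Arguments.
Unset Strict Implicit.
Unset Printing Implicit Defensive.

Import Order.TTheory GRing.Theory Num.Theory.
Local Open Scope classical_set_scope.
Local Open Scope ring_scope.

(* C^oo on an open subset U of a finite-dimensional space: every iterated
   directional derivative is Frechet differentiable on U. *)
Definition smooth_on (R : realType) (V W : normedModType R) (U : set V)
    (f : V -> W) : Prop :=
  forall (vs : seq V) (x : V), U x ->
    differentiable (foldr (fun v h => 'D_v h) f vs) x.

(* An n-dimensional smooth manifold, with one chosen chart around each point.
   The charts [chart p] form an atlas.  [chart p] and [chart_inv p] are total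
   functions; only their values on [chart_dom p] and on its image matter. *)
HB.mixin Record isManifold (R : realType) (n : nat) M of Topological M := {
  chart_dom : M -> set M;
  chart : M -> M -> 'rV[R]_n;
  chart_inv : M -> 'rV[R]_n -> M;
  chart_dom_center : forall p, chart_dom p p;
  chart_dom_open : forall p, open (chart_dom p);
  chart_im_open : forall p, open (chart p @` chart_dom p);
  chartK : forall p q, chart_dom p q -> chart_inv p (chart p q) = q;
  chart_continuous : forall p q, chart_dom p q -> {for q, continuous (chart p)};
  chart_inv_continuous : forall p x, (chart p @` chart_dom p) x ->
    {for x, continuous (chart_inv p)};
  chart_compat : forall p q,
    smooth_on (chart p @` (chart_dom p `&` chart_dom q))
      (chart q \o chart_inv p);
  manifold_hausdorff : hausdorff_space M;
  manifold_second_countable : @second_countable M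
}.

#[short(type="manifoldType")]
HB.structure Definition Manifold (R : realType) (n : nat) :=
  {M of Topological M & isManifold R n M}.

Arguments chart_dom {R n s} p _ : rename.
Arguments chart {R n s} p _ : rename.
Arguments chart_inv {R n s} p _ : rename.

HB.mixin Record isLieGroup (R : realType) (n : nat) G
    of Group G & Manifold R n G := {
  lie_mul_continuous : continuous (fun z : G * G => (z.1 * z.2)%g);
  lie_mul_smooth : forall u v w : G,
    smooth_on
      [set z : 'rV[R]_n * 'rV[R]_n |
        (chart u @` chart_dom u) z.1 /\ (chart v @` chart_dom v) z.2 /\
        chart_dom w (chart_inv u z.1 * chart_inv v z.2)%g]
      (fun z => chart w (chart_inv u z.1 * chart_inv v z.2)%g);
  lie_inv_continuous : continuous (fun u : G => (u^-1)%g);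
  lie_inv_smooth : forall u w : G,
    smooth_on
      [set x : 'rV[R]_n | (chart u @` chart_dom u) x /\
        chart_dom w ((chart_inv u x)^-1)%g]
      (fun x => chart w ((chart_inv u x)^-1)%g)
}.

#[short(type="lieGroupType")]
HB.structure Definition LieGroup (R : realType) (n : nat) :=
  {G of Group G & Manifold R n G & isLieGroup R n G}.

Section TensorAlgebra.
Variables (R : realType).

(* A tensor over R^n is given by its components: the degree-p part of
   T : tens n consists of the values of T on the words i_1 ... i_p of length p
   (the coefficients of the e_{i_1} (x) ... (x) e_{i_p}). *)
Definition tens (n : nat) := seq 'I_n -> R.

Variable n : nat.
Implicit Types (S T : tens n) (w : seq 'I_n).

Definition homogeneous (p : nat) T := forall w, size w != p -> T w = 0.

Definition tscal (c : R) : tens n := fun w => if w is [::] then c else 0.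

Definition tvec (v : 'rV[R]_n) : tens n :=
  fun w => if w is [:: i] then v 0 i else 0.

Definition vec_part T : 'rV[R]_n := \row_i T [:: i].

Definition tmul S T : tens n :=
  fun w => \sum_(k < (size w).+1) S (take k w) * T (drop k w).

(* v_1 . ... . v_p = sum_s v_{s 1} (x) ... (x) v_{s p} *)
Definition vprod (p : nat) (v : 'I_p -> 'rV[R]_n) : tens n :=
  \sum_(s : 'S_p) \big[tmul/tscal 1]_(k < p) tvec (v (s k)).

Definition Sym (p : nat) T : Prop :=
  exists (m : nat) (c : 'I_m -> R) (v : 'I_m -> 'I_p -> 'rV[R]_n),
    T = \sum_(i < m) c i *: vprod (v i).

Definition word_perm w (s : 'S_(size w)) : seq 'I_n :=
  [seq tnth (in_tuple w) (s k) | k <- enum 'I_(size w)].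

(* The symmetric product of S in Sym^p and T in Sym^q is the symmetrization of
   S (x) T over the (p+q)! permutations, divided by p! q!; this is the bilinear
   product with (v_1 . ... . v_p) . (w_1 . ... . w_q) = v_1 . ... . w_q. *)
Definition sprod S T : tens n :=
  fun w => \sum_(k < (size w).+1) ((k`! * (size w - k)`!)%:R)^-1 *
    \sum_(s : 'S_(size w)) S (take k (word_perm s)) * T (drop k (word_perm s)).

(* functorial action of the linear map v |-> v *m A on tensors *)
Definition tpush (m : nat) (A : 'M[R]_(n, m)) T : tens m :=
  fun u => \sum_(t : (size u).-tuple 'I_n)
    T t * \prod_(k < size u) A (tnth t k) (tnth (in_tuple u) k).

Definition gform (g : 'M[R]_n) (x y : 'rV[R]_n) : R := (x *m g *m y^T) 0 0.

Definition orthonormal (g : 'M[R]_n) (e : 'I_n -> 'rV[R]_n) : Prop :=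
  forall i j, gform g (e i) (e j) = (i == j)%:R.

End TensorAlgebra.

Arguments tscal {R n}.

(* The tangent space at u is R^n, through the chart [chart u] chosen at u. *)
Definition tangent_map (R : realType) (n m : nat) (M : manifoldType R n)
    (N : manifoldType R m) (f : M -> N) (u : M) : 'M[R]_(n, m) :=
  'J (chart (f u) \o f \o chart_inv u) (chart u u).

Section Fields.
Variables (R : realType) (n : nat) (M : manifoldType R n).

Definition vfield := M -> 'rV[R]_n.
Definition tfield := M -> tens R n.

Implicit Types (X Y : vfield) (K L : tfield) (f : M -> R) (g : M -> 'M[R]_n).

Definition tvfield X : tfield := fun u => tvec (X u).

Definition smooth_fun f : Prop :=
  forall u, smooth_on (chart u @` chart_dom u) (f \o chart_inv u).

(* T_yM -> R^n, from the chart chosen at y to the chart chosen at u *)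
Definition coord_change (u y : M) : 'M[R]_n :=
  'J (chart u \o chart_inv y) (chart y y).

(* the coordinate expression of a field in the chart [chart u] *)
Definition local_vfield u X (x : 'rV[R]_n) : 'rV[R]_n :=
  let y := chart_inv u x in X y *m coord_change u y.

Definition local_tfield u K (x : 'rV[R]_n) : tens R n :=
  let y := chart_inv u x in tpush (coord_change u y) (K y).

Definition local_metric u g (x : 'rV[R]_n) : 'M[R]_n :=
  let y := chart_inv u x in
  let J := 'J (chart y \o chart_inv u) x in J *m g y *m J^T.

Definition smooth_vfield X : Prop :=
  forall u, smooth_on (chart u @` chart_dom u) (local_vfield u X).

Definition smooth_tfield K : Prop :=
  forall u w, smooth_on (chart u @` chart_dom u)
    (fun x => local_tfield u K x w : R^o).

Definition sym_tensor_field (p : nat) K : Prop :=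
  smooth_tfield K /\ forall u, Sym p (K u).

Definition differential f (u : M) (v : 'rV[R]_n) : R :=
  'D_v (f \o chart_inv u) (chart u u).

Definition bracket X Y : vfield := fun u =>
  'D_(X u) (local_vfield u Y) (chart u u) -
  'D_(Y u) (local_vfield u X) (chart u u).

Definition riemannian_metric g : Prop :=
  [/\ forall u, smooth_on (chart u @` chart_dom u) (local_metric u g),
      forall u, (g u)^T = g u &
      forall u x, x != 0 -> 0 < gform (g u) x x].

(* nabla u v K is the value at u of the covariant derivative of K along v *)
Definition connection := forall u : M, 'rV[R]_n -> tfield -> tens R n.

(* The Levi-Civita connection of g: the torsion-free metric connection on
   vector fields, extended to all tensor fields by the Leibniz rule. *)
Record levi_civita g (nabla : connection) : Prop := LeviCivita {
  lc_linear : forall K, smooth_tfield K -> forall u c v v',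
    nabla u (c *: v + v') K = c *: nabla u v K + nabla u v' K;
  lc_additive : forall K L, smooth_tfield K -> smooth_tfield L ->
    forall u v, nabla u v (fun y => K y + L y) = nabla u v K + nabla u v L;
  lc_smooth : forall X K, smooth_vfield X -> smooth_tfield K ->
    smooth_tfield (fun u => nabla u (X u) K);
  lc_degree : forall p K, smooth_tfield K -> (forall y, homogeneous p (K y)) ->
    forall u v, homogeneous p (nabla u v K);
  lc_function : forall f, smooth_fun f -> forall u v,
    nabla u v (fun y => tscal (f y)) = tscal (differential f u v);
  lc_leibniz : forall K L, smooth_tfield K -> smooth_tfield L ->
    forall u v, nabla u v (fun y => tmul (K y) (L y)) =
      tmul (nabla u v K) (L u) + tmul (K u) (nabla u v L);
  lc_torsion_free : forall X Y, smooth_vfield X -> smooth_vfield Y ->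
    forall u, nabla u (X u) (tvfield Y) - nabla u (Y u) (tvfield X) =
      tvec (bracket X Y u);
  lc_metric : forall X Y, smooth_vfield X -> smooth_vfield Y -> forall u v,
    differential (fun y => gform (g y) (X y) (Y y)) u v =
      gform (g u) (vec_part (nabla u v (tvfield X))) (Y u) +
      gform (g u) (X u) (vec_part (nabla u v (tvfield Y)))
}.

(* sum_i e_i . nabla_{e_i} K at u; it does not depend on the orthonormal
   basis e of the tangent space at u *)
Definition killing_operator (nabla : connection) (u : M)
    (e : 'I_n -> 'rV[R]_n) K : tens R n :=
  \sum_i sprod (tvec (e i)) (nabla u (e i) K).

Definition killing g (nabla : connection) K : Prop :=
  forall u e, orthonormal (g u) e -> killing_operator nabla u e K = 0.

Definition killing_vfield g (nabla : connection) X : Prop :=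
  smooth_vfield X /\ killing g nabla (tvfield X).

(* K is g, seen as the symmetric 2-tensor 1/2 sum_i e_i . e_i *)
Definition is_metric_tensor g K : Prop :=
  forall u e, orthonormal (g u) e ->
    K u = 2^-1 *: \sum_i sprod (tvec (e i)) (tvec (e i)).

(* the real subalgebra generated by P for the symmetric product, that is, the
   polynomials with real coefficients in the elements of P *)
Inductive polynomial_in (P : tfield -> Prop) : tfield -> Prop :=
| poly_gen K : P K -> polynomial_in P K
| poly_const c : polynomial_in P (fun=> tscal c)
| poly_add K L : polynomial_in P K -> polynomial_in P L ->
    polynomial_in P (fun u => K u + L u)
| poly_mul K L : polynomial_in P K -> polynomial_in P L ->
    polynomial_in P (fun u => sprod (K u) (L u)).

End Fields.

Section LieGroupFields.
Variables (R : realType) (n : nat) (G : lieGroupType R n).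

Definition left_trans (a u : G) : G := (a * u)%g.
Definition right_trans (a v : G) : G := (v * a)%g.

Definition left_invariant (K : tfield G) : Prop :=
  forall a u, K (left_trans a u) = tpush (tangent_map (left_trans a) u) (K u).

Definition left_invariant_metric (g : G -> 'M[R]_n) : Prop :=
  forall a u x y,
    let A := tangent_map (left_trans a) u in
    gform (g (left_trans a u)) (x *m A) (y *m A) = gform (g u) x y.

(* The vector at u on the right-hand side of the next two definitions lives in
   the tangent space at u * 1, resp. 1 * u, which is the one at u. *)
Definition left_inv_field (x : 'rV[R]_n) : vfield G :=
  fun u => x *m tangent_map (left_trans u) (1%g : G).

Definition right_inv_field (x : 'rV[R]_n) : vfield G :=
  fun u => x *m tangent_map (right_trans u) (1%g : G).

(* the Lie algebra is the tangent space at 1 *)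
Definition lie_bracket (x y : 'rV[R]_n) : 'rV[R]_n :=
  bracket (left_inv_field x) (left_inv_field y) 1%g.

Definition invariant_killing_vfield (g : G -> 'M[R]_n)
    (nabla : connection G) (X : vfield G) : Prop :=
  killing_vfield g nabla X /\
  ((exists x, X = right_inv_field x) \/ left_invariant (tvfield X)).

Definition generator (g : G -> 'M[R]_n) (nabla : connection G)
    (K : tfield G) : Prop :=
  is_metric_tensor g K \/
  exists2 X, invariant_killing_vfield g nabla X & K = tvfield X.

End LieGroupFields.

Definition almost_abelian (R : realType) (n : nat) (G : lieGroupType R n) :=
  exists h : {vspace 'rV[R]_n},
    [/\ (\dim h).+1 = n,
        forall x y, x \in h -> y \in h -> lie_bracket G x y = 0 &
        forall x y, y \in h -> lie_bracket G x y \in h].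

(* Main.v *)
(* Let h be an abelian ideal of codimension 1, X_1 .. X_m an orthonormal basis of
   h and X a unit vector orthogonal to h.  Left-invariant symmetric tensors are
   the polynomials P in X, X_1 .. X_m, and the Koszul formula turns the Killing
   operator into the derivation
     P |-> X * (l . dP/dX_i) - q * dP/dX,   l_i = [X, X_i],  q = sum_i X_i l_i,
   so that D := sum_i l_i d/dX_i is the action of ad X on R[X_1 .. X_m].

   A polynomial f in X_1 .. X_m with D f = 0 is ad-invariant, hence Ad-invariant
   as G is connected; then left and right translation of f agree, and f is a
   polynomial in right-invariant vector fields.

   If q = 0, the equation says that D kills every coefficient of P with respect
   to X, and the left-invariant field X is itself Killing.  If q <> 0, the
   leading coefficient c of P in X is killed by D and its degree 2k is even;
   subtracting c * H^k, where H = X^2 + sum_i X_i^2 is twice the metric, one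
   finds that P is a polynomial in H with coefficients killed by D. *)

Require Import Defs.
From HB Require Import structures.
From mathcomp Require Import all_boot all_order all_algebra perm.
From mathcomp Require Import all_classical all_reals all_analysis.
From mathcomp Require Import ring lra zify.
From mathcomp Require mpoly.
Import -(notations) mpoly.
Import numFieldNormedType.Exports.

Set Implicit Arguments.
Unset Strict Implicit.
Unset Printing Implicit Defensive.

Import Order.TTheory GRing.Theory Num.Theory.
Local Open Scope classical_set_scope.
Local Open Scope ring_scope.

(** * Symmetric tensors *)

(** The symmetric product is a weighted sum over permutations and the connection is known only
    through its axioms, so both are turned into recursions on the first tensor factor. Contraction
    with a basis vector satisfies the Leibniz rule for [sprod], as a partial derivative does for a
    product. Hence [jet], which lists the iterated derivatives of a polynomial at 0, is an algebra
    map.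

    The Levi-Civita coefficients are never solved for. Torsion-freeness writes <nabla_{e_i} e_a,
    e_j> as <nabla_{e_a} e_i, e_j> plus a structure constant; the first term is skew in i, j and
    vanishes against X_i X_j.

    Passing from ad to Ad uses neither flows nor the exponential map. Left- and right-invariant
    fields commute because the mixed derivatives of (p, q) |-> p u q agree. This identifies the
    derivative of Ad with the bracket, and makes u |-> Ad(u) T locally constant for an ad-invariant
    T.

    The obstacle is that each tangent space is read in its own chart, chosen with no regularity in
    the point. A field must be rewritten in a fixed chart before it is differentiated; Ad(u) escapes
    this, being an endomorphism of the tangent space at 1. *)

Lemma sum_lift_perm_l (V : nmodType) n (i : 'I_n.+1) (F : 'S_n.+1 -> V) :
  \sum_s F s = \sum_j \sum_(s : 'S_n) F (lift_perm i j s).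
Proof.
rewrite (partition_big (fun s : 'S_n.+1 => s i) predT) //=.
apply: eq_bigr => j _.
rewrite (reindex (lift_perm i j)); last first.
  (* [ulsf] deletes the point [i] and its image from [s]. As [s (lift i k)] differs from [s i],
     [unlift] succeeds and the default [k] is never returned. *)
  pose ulsf k (s : 'S_n.+1) := odflt k (unlift (s i) (s (lift i k))).
  have ulsfK (s : 'S_n.+1) k : lift (s i) (ulsf k s) = s (lift i k).
    rewrite /ulsf; have:= neq_lift i k.
    by rewrite -(can_eq (permK s)) => /unlift_some[] ? ? ->.
  have inj_ulsf (s : 'S_n.+1) : injective (ulsf^~ s).
    move=> k1 k2 eqk; apply: (@lift_inj _ i); apply: (@perm_inj _ s).
    by rewrite -!ulsfK /= eqk.
  exists (fun s => perm (inj_ulsf s)) => [s _ | s].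
    by apply/permP=> k'; rewrite permE /ulsf lift_perm_lift lift_perm_id liftK.
  move/(s i =P _) => si; apply/permP=> k.
  case: (unliftP i k) => [k'|] ->; rewrite ?lift_perm_id ?si //.
  by rewrite lift_perm_lift permE -si ulsfK.
by apply: eq_bigl => s; rewrite lift_perm_id eqxx.
Qed.

Lemma sum_lift_perm_r (V : nmodType) n (j : 'I_n.+1) (F : 'S_n.+1 -> V) :
  \sum_s F s = \sum_i \sum_(s : 'S_n) F (lift_perm i j s).
Proof.
rewrite (reindex_inj (@invg_inj {perm 'I_n.+1})) (sum_lift_perm_l j).
apply: eq_bigr => i _; rewrite (reindex_inj (@invg_inj {perm 'I_n})).
by apply: eq_bigr => s _; rewrite -lift_permV invgK.
Qed.

Lemma sum_ord_ltn_const (V : zmodType) (x : V) (N k : nat) : (k < N.+1)%N ->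
  \sum_(j < N | (j < k)%N) x = x *+ k.
Proof. by move=> kN; rewrite (big_ord_narrow (kN : (k <= N)%N)) sumr_const card_ord. Qed.

Lemma sum_ord_geq_const (V : zmodType) (x : V) (N k : nat) : (k < N.+1)%N ->
  \sum_(j < N | ~~ (j < k)%N) x = x *+ (N - k).
Proof.
move=> kN; apply: (addrI (x *+ k)).
rewrite -{1}(sum_ord_ltn_const x kN) -(bigID (fun j : 'I_N => (j < k)%N) predT) /=.
by rewrite sumr_const card_ord -mulrnDr subnKC.
Qed.

(** * Words with one letter inserted *)

Section InsertSeq.
Variables (T : eqType) (x : T).
Implicit Types (v : seq T) (j k : nat).

Lemma take_insert_ge v j k : (j <= size v)%N -> (k <= j)%N ->
  take k (take j v ++ x :: drop j v) = take k v.
Proof. by move=> jv kj; rewrite takel_cat ?size_takel // take_takel. Qed.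

Lemma drop_insert_lt v j k : (j <= size v)%N -> (j <= k)%N ->
  drop k.+1 (take j v ++ x :: drop j v) = drop k v.
Proof.
move=> jv jk; rewrite drop_cat size_takel // ltnNge (leqW jk) subSn //=.
by rewrite drop_drop subnK.
Qed.

Lemma perm_insert v j : perm_eq (take j v ++ x :: drop j v) (x :: v).
Proof. by rewrite -cat1s perm_catCA perm_cons cat_take_drop. Qed.

Lemma perm_take_insert v j k : (j <= size v)%N -> (j <= k)%N ->
  perm_eq (take k.+1 (take j v ++ x :: drop j v)) (x :: take k v).
Proof.
move=> jv jk; rewrite -(perm_cat2r (drop k v)) cat_cons cat_take_drop.
by rewrite -(drop_insert_lt jv jk) cat_take_drop perm_insert.
Qed.

Lemma perm_drop_insert v j k : (j <= size v)%N -> (k <= j)%N ->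
  perm_eq (drop k (take j v ++ x :: drop j v)) (x :: drop k v).
Proof.
move=> jv kj; rewrite -(perm_cat2l (take k v)) -{1}(take_insert_ge jv kj).
by rewrite cat_take_drop (perm_trans (perm_insert v j)) // perm_sym perm_insert.
Qed.

End InsertSeq.

Section SymmetricTensors.
Variables (R : realType) (n : nat).
Implicit Types (S T : tens R n) (w : seq 'I_n).

Definition tcontr (i : 'I_n) T : tens R n := fun w => T (i :: w).

Definition symmetric_tens T := forall w w', perm_eq w w' -> T w = T w'.

Lemma tcontr_sym i T : symmetric_tens T -> symmetric_tens (tcontr i T).
Proof. by move=> sT w w' ww'; apply: sT; rewrite perm_cons. Qed.

Lemma size_word_perm w s : size (@word_perm n w s) = size w.
Proof. by rewrite size_map size_enum_ord. Qed.

Lemma nth_word_perm w s x0 (k : 'I_(size w)) :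
  nth x0 (@word_perm n w s) k = nth x0 w (s k).
Proof.
rewrite (nth_map k) ?size_enum_ord // (tnth_nth x0) /=.
by congr (nth _ _ (s _)); apply: val_inj; rewrite /= nth_enum_ord.
Qed.

Lemma word_perm_cons i w (j : 'I_(size w).+1) (s : 'S_(size w)) :
  @word_perm n (i :: w) (lift_perm j ord0 s) =
  take j (word_perm s) ++ i :: drop j (word_perm s).
Proof.
have szv := size_word_perm s; set v := word_perm s in szv *.
have jv : (j <= size v)%N by rewrite szv -ltnS.
apply: (@eq_from_nth _ i); rewrite size_word_perm.
  by rewrite size_cat /= size_takel // size_drop addnS subnKC // szv.
move=> k ltk; rewrite (nth_word_perm _ _ (Ordinal ltk)).
rewrite nth_cat size_takel //.
case: (unliftP j (Ordinal ltk)) => [k'|] ek; rewrite ek; last first.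
  have -> : k = j by have := congr1 val ek.
  by rewrite lift_perm_id ltnn subnn.
rewrite lift_perm_lift /=.
have kE : k = bump j k' by have := congr1 val ek.
rewrite add0n kE /bump.
case: (leqP j k') => jk; last first.
  by rewrite add0n jk nth_take // /v nth_word_perm.
rewrite add1n ltnNge (leqW jk) subSn //= nth_drop subnKC // /v.
by rewrite nth_word_perm.
Qed.

Lemma sprod_nil S T : sprod S T [::] = S [::] * T [::].
Proof.
rewrite /sprod big_ord1 /= fact0 mul1n invr1 mul1r.
have e (s : 'S_0) : @word_perm n [::] s = [::].
  by apply: size0nil; rewrite size_word_perm.
rewrite (eq_bigr (fun=> S [::] * T [::])) => [|s _]; last by rewrite e.
by rewrite sumr_const card_Sn fact0.
Qed.

Lemma sprod_cons S T i w : symmetric_tens S -> symmetric_tens T ->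
  sprod S T (i :: w) = sprod (tcontr i S) T w + sprod S (tcontr i T) w.
Proof.
move=> sS sT; rewrite /sprod /=; set N := size w.
pose A k (s : 'S_N) := tcontr i S (take k (word_perm s)) * T (drop k (word_perm s)).
pose B k (s : 'S_N) := S (take k (word_perm s)) * tcontr i T (drop k (word_perm s)).
(* For a cut at [k], there are [k] positions that put [i] in the left piece and [N.+1 - k] that put
   it in the right one. These multiplicities lower one factorial of the weight each. At [k = 0] the
   truncated [k.-1] is harmless, since its multiplicity is 0. *)
have E (k : 'I_N.+2) : \sum_(s : 'S_N.+1)
   S (take k (@word_perm n (i :: w) s)) * T (drop k (@word_perm n (i :: w) s)) =
   \sum_(s : 'S_N) (A k.-1 s *+ k + B k s *+ (N.+1 - k)).
  rewrite (sum_lift_perm_r ord0) exchange_big; apply: eq_bigr => s _ /=.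
  rewrite (bigID (fun j : 'I_N.+1 => (j < k)%N)) /=; congr (_ + _).
  - rewrite (eq_bigr (fun=> A k.-1 s)).
      by rewrite sum_ord_ltn_const.
    move=> j jk; rewrite word_perm_cons; set v := word_perm s.
    have jv : (j <= size v)%N by rewrite size_word_perm -ltnS.
    have kk : k = k.-1.+1 :> nat by rewrite prednK // (leq_ltn_trans _ jk).
    have jk1 : (j <= k.-1)%N by rewrite -ltnS -kk.
    rewrite /A /tcontr -/v kk /=; congr (_ * _); last by rewrite drop_insert_lt.
    exact/sS/perm_take_insert.
  - rewrite (eq_bigr (fun=> B k s)).
      by rewrite sum_ord_geq_const.
    move=> j; rewrite -leqNgt => kj; rewrite word_perm_cons; set v := word_perm s.
    have jv : (j <= size v)%N by rewrite size_word_perm -ltnS.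
    rewrite /B /tcontr -/v take_insert_ge //; congr (_ * _).
    exact/sT/perm_drop_insert.
under eq_bigr do rewrite E big_split /= mulrDr.
rewrite big_split /=; congr (_ + _).
  rewrite big_ord_recl /= big1 ?mulr0 ?add0r //.
  apply: eq_bigr => k _; rewrite -[bump 0 k]/(k.+1) /= subSS -/N add0n sumrMnl.
  rewrite -[X in _ * X]mulr_natl mulrA; congr (_ * _).
  by rewrite factS -mulnA natrM invfM mulrAC mulVf ?mul1r ?pnatr_eq0.
rewrite big_ord_recr /= subnn [X in _ * X]big1 ?mulr0 ?addr0 //.
apply: eq_bigr => k _; rewrite -/N sumrMnl -[X in _ * X]mulr_natl mulrA; congr (_ * _).
have kN : (k <= N)%N by rewrite -ltnS.
by rewrite subSn // factS mulnCA natrM invfM mulrAC mulVf ?mul1r ?pnatr_eq0.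
Qed.

End SymmetricTensors.

Lemma foldl_perm (T : eqType) (U : Type) (f : U -> T -> U) (u : U) (s1 s2 : seq T) :
  (forall u x y, f (f u x) y = f (f u y) x) -> perm_eq s1 s2 ->
  foldl f u s1 = foldl f u s2.
Proof.
move=> fC.
have f_rem s x : x \in s -> forall u, foldl f u s = foldl f u (x :: rem x s).
  elim: s => // y s IH; rewrite in_cons /=.
  by case: eqVneq => [->|_ /= xs] // v; rewrite IH //= fC.
elim: s1 s2 u => [|x s1 IH] s2 u; first by rewrite perm_sym => /perm_small_eq ->.
move=> s12; have xs2 : x \in s2 by rewrite -(perm_mem s12) mem_head.
rewrite (f_rem _ _ xs2) /=; apply: IH.
by rewrite -(perm_cons x) (permPl s12) perm_to_rem.
Qed.

(** * Tensor operations by recursion on the word *)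

Section TensorRecursion.
Variables (R : realType) (n : nat).

Lemma sum_tuple_cons (V : nmodType) N (F : N.+1.-tuple 'I_n -> V) :
  \sum_t F t = \sum_i \sum_(t : N.-tuple 'I_n) F [tuple of i :: t].
Proof.
rewrite pair_big /= (reindex (fun q : 'I_n * N.-tuple 'I_n => [tuple of q.1 :: q.2])) //=.
exists (fun t : N.+1.-tuple 'I_n => (thead t, [tuple of behead t])) => [[i t] _|t _] /=.
  by rewrite theadE; congr (_, _); apply: val_inj.
by rewrite -tuple_eta.
Qed.

Lemma tpush_nil k (M : 'M[R]_(n, k)) (T : tens R n) : tpush M T [::] = T [::].
Proof.
rewrite /tpush (big_pred1 [tuple]) ?big_ord0 ?mulr1 // => t.
by apply/esym/eqP; rewrite [t]tuple0.
Qed.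

Lemma tpush_cons k (M : 'M[R]_(n, k)) (T : tens R n) u w :
  tpush M T (u :: w) = \sum_i M i u * tpush M (tcontr i T) w.
Proof.
rewrite /tpush /= sum_tuple_cons; apply: eq_bigr => i _.
rewrite mulr_sumr; apply: eq_bigr => t _.
rewrite big_ord_recl mulrCA; congr (_ * (_ * _)).
by apply: eq_bigr => j _; rewrite !(tnth_nth i, tnth_nth u).
Qed.

(* The derivation extending [v |-> v *m C], that is, the differential of [tpush] at 1. *)
Fixpoint tder (C : 'M[R]_n) (T : tens R n) w : R :=
  if w is i :: w' then \sum_j C j i * T (j :: w') + tder C (tcontr i T) w' else 0.

Lemma tmul_vec_cons (v : 'rV[R]_n) T i w : tmul (tvec v) T (i :: w) = v 0 i * T w.
Proof.
rewrite /tmul /= !big_ord_recl /= take0 drop0 mul0r add0r.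
rewrite big1 ?addr0 // => k _; rewrite /=.
by case: w k => [|j w] // [[|k] ltk] //=; rewrite mul0r.
Qed.

Lemma tmul_vec_nil (v : 'rV[R]_n) T : tmul (tvec v) T [::] = 0.
Proof. by rewrite /tmul big_ord1 /= mul0r. Qed.

Lemma vprod0 (v : 'I_0 -> 'rV[R]_n) : vprod v = tscal 1.
Proof.
apply/funext => w; rewrite /vprod fct_sumE /=.
rewrite (eq_bigr (fun=> tscal 1 w)) => [|s _]; last by rewrite big_ord0.
by rewrite sumr_const card_Sn fact0 mulr1n.
Qed.

Lemma vprod_nil p (v : 'I_p.+1 -> 'rV[R]_n) : vprod v [::] = 0.
Proof.
by rewrite /vprod fct_sumE big1 // => s _; rewrite big_ord_recl tmul_vec_nil.
Qed.

Lemma vprod_cons p (v : 'I_p.+1 -> 'rV[R]_n) i w :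
  vprod v (i :: w) = \sum_j v j 0 i * vprod (fun k => v (lift j k)) w.
Proof.
rewrite /vprod fct_sumE (sum_lift_perm_l ord0); apply: eq_bigr => j _.
rewrite fct_sumE mulr_sumr; apply: eq_bigr => s _.
rewrite big_ord_recl tmul_vec_cons lift_perm_id.
by under eq_bigr do rewrite lift_perm_lift.
Qed.

End TensorRecursion.

(** * Symmetric tensors as polynomials *)

Section Jets.
Variables (R : realType) (m : nat).

Notation A := (mpoly m R).
Notation B := {poly A}.
Implicit Types (P Q : B) (a b : 'I_m.+1).

(* The variables are indexed by ['I_m.+1]: [ord_max] is the polynomial variable ['X],
   the other ones are those of the coefficient ring. *)
Definition pcst (c : R) : B := (mpolyC m c)%:P.

Definition pvar a : B :=
  if unlift ord_max a is Some i then (mpolyX R (mnm1 i))%:P else 'X.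

Definition pderiv a : B -> B :=
  if unlift ord_max a is Some i then map_poly (mderiv i) else deriv.

Definition peval0 P : R := mcoeff mnm0 P`_0.

Lemma pcst_zmod : additive pcst.
Proof. by move=> c d; rewrite /pcst !raddfB. Qed.
HB.instance Definition _ := GRing.isZmodMorphism.Build R B pcst pcst_zmod.

Lemma pcst_monoid : monoid_morphism pcst.
Proof. by split=> [|c d]; rewrite /pcst ?rmorph1 ?rmorphM. Qed.
HB.instance Definition _ := GRing.isMonoidMorphism.Build R B pcst pcst_monoid.

Lemma peval0_zmod : additive peval0.
Proof. by move=> P Q; rewrite /peval0 coefB raddfB. Qed.
HB.instance Definition _ := GRing.isZmodMorphism.Build B R peval0 peval0_zmod.

Lemma peval0_monoid : monoid_morphism peval0.
Proof.
split=> [|P Q]; first by rewrite /peval0 coef1 rmorph1.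
by rewrite /peval0 coefM big_ord1 subnn rmorphM.
Qed.
HB.instance Definition _ := GRing.isMonoidMorphism.Build B R peval0 peval0_monoid.

Lemma pderiv_zmod a : additive (pderiv a).
Proof.
move=> P Q; rewrite /pderiv; case: unlift => [i|]; last exact: derivB.
by rewrite raddfB.
Qed.
HB.instance Definition _ a := GRing.isZmodMorphism.Build B B (pderiv a) (pderiv_zmod a).

Lemma pderivM a P Q : pderiv a (P * Q) = pderiv a P * Q + P * pderiv a Q.
Proof.
rewrite /pderiv; case: unlift => [i|]; last exact: derivM.
apply/polyP => k; rewrite coefD !coefM coef_map coefM raddf_sum /= -big_split /=.
by apply: eq_bigr => j _; rewrite mderivM !coef_map.
Qed.

Lemma pderiv_cst a c : pderiv a (pcst c) = 0.
Proof.
rewrite /pderiv /pcst; case: unlift => [i|]; last exact: derivC.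
by rewrite map_polyC /= mderivC.
Qed.

Lemma pderiv_var a b : pderiv a (pvar b) = (a == b)%:R.
Proof.
rewrite /pderiv /pvar; case: unliftP => [i ->|->]; case: unliftP => [j ->|->].
- rewrite map_polyC /= mderivX (inj_eq (@lift_inj _ _)) mnm1E eq_sym.
  case: eqVneq => [->|_] /=; last by rewrite scale0r.
  rewrite scale1r.
  have -> : mnm_sub (mnm1 j) (mnm1 j) = mnm0; last by rewrite mpolyX0.
  by apply/mnmP => k; rewrite mnmBE mnm0E subnn.
- apply/polyP => k; rewrite coef_map coefX [lift _ _ == _]eq_sym (negbTE (neq_lift _ _)) coef0 /=.
  by case: (k == 1); rewrite ?mderiv0 // -mpolyC1 mderivC.
- by rewrite derivC (negbTE (neq_lift _ _)).
- by rewrite derivX eqxx.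
Qed.

Lemma pderiv_comm a b P : pderiv a (pderiv b P) = pderiv b (pderiv a P).
Proof.
rewrite /pderiv; case: unlift => [i|]; case: unlift => [j|] //.
- by apply/polyP => k; rewrite !coef_map /= mderiv_comm.
- by apply/polyP => k; rewrite !(coef_map, coef_deriv) /= raddfMn.
- by apply/polyP => k; rewrite !(coef_map, coef_deriv) /= raddfMn.
Qed.

Lemma peval0_var a : peval0 (pvar a) = 0.
Proof.
rewrite /peval0 /pvar; case: unlift => [i|]; last by rewrite coefX raddf0.
rewrite coefC /= mcoeffX.
by have /negbTE -> : mnm1 i != mnm0 by rewrite -mdeg_eq0 mdeg1.
Qed.

Definition plin (c : 'I_m.+1 -> R) : B := \sum_a pcst (c a) * pvar a.

Lemma peval0_lin c : peval0 (plin c) = 0.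
Proof.
by rewrite raddf_sum big1 //= => b _; rewrite rmorphM /= peval0_var mulr0.
Qed.

(** The four closure conditions mirror the constructors of [polynomial_in], so that a statement
    about all polynomials translates into one about tensor fields. *)
Lemma gen_ind (S : B -> Prop) :
  (forall c, S (pcst c)) -> (forall a, S (pvar a)) ->
  (forall P Q, S P -> S Q -> S (P + Q)) ->
  (forall P Q, S P -> S Q -> S (P * Q)) ->
  forall P, S P.
Proof.
move=> Sc Sv SD SM.
have S1 : S 1 by rewrite -(rmorph1 pcst).
have SX P k : S P -> S (P ^+ k).
  by move=> SP; elim: k => [|k IH]; rewrite ?expr0 // exprS; apply: (SM).
have SA (q : A) : S q%:P.
  elim/mpolyind: q => [|c e q _ _ Sq]; first by have := Sc 0; rewrite /pcst mpolyC0.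
  rewrite polyCD; apply: (SD) => //.
  rewrite -mul_mpolyC polyCM; apply: (SM); first exact: Sc.
  rewrite mpolyXE_id rmorph_prod; elim/big_ind: _ => [//|P Q SP SQ|i _]; first exact: SM.
  rewrite rmorphXn /=; apply: (SX).
  by have := Sv (lift ord_max i); rewrite /pvar liftK.
have S'X : S 'X by have := Sv ord_max; rewrite /pvar unlift_none.
elim/poly_ind => [|P c SP]; first by have := Sc 0; rewrite rmorph0.
by apply: (SD) => //; apply: (SM).
Qed.

Lemma coef_pderiv_max P k : (pderiv ord_max P)`_k = P`_k.+1 *+ k.+1.
Proof. by rewrite /pderiv unlift_none coef_deriv. Qed.

Lemma coef_pderiv_lift (i : 'I_m) P k : (pderiv (lift ord_max i) P)`_k = mderiv i P`_k.
Proof. by rewrite /pderiv liftK coef_map. Qed.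

(** Differentiating in a variable that occurs in a monomial lowers its degree and multiplies its
    coefficient by a positive integer, which loses nothing in characteristic 0. Induction on the
    total degree ends at the constant term. *)
Lemma taylor0 P :
  (forall w, peval0 (foldl (fun Q a => pderiv a Q) P w) = 0) -> P = 0.
Proof.
move=> P0; apply/polyP => k; apply/mpolyP => e; rewrite coef0 mcoeff0.
have [N] := ubnP (k + mdeg e); elim: N => // N IH in k e P P0 * => leN.
have {}P0 : (forall w, peval0 (foldl (fun Q a => pderiv a Q) P w) = 0) /\
    forall a w, peval0 (foldl (fun Q a => pderiv a Q) (pderiv a P) w) = 0.
  by split=> // a w; apply: (P0 (a :: w)).
case: k leN => [|k] leN; last first.
  have := IH k e _ (P0.2 ord_max); rewrite coef_pderiv_max mcoeffMn.
  by move/(_ ltac:(lia))/eqP; rewrite mulrn_eq0 => /eqP.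
have [->|/eqP ne0] := eqVneq e mnm0; first by have := P0.1 [::].
have [i ei] : exists i, (0 < e i)%N.
  apply/existsP; apply: contra_notT ne0; rewrite negb_exists => /forallP e0.
  by apply/mnmP => i; rewrite mnm0E; apply/eqP; rewrite -leqn0 leqNgt.
have le1 : lem (mnm1 i) e by rewrite lep1mP -lt0n.
have Ee := submK le1.
have := IH 0 (mnm_sub e (mnm1 i)) _ (P0.2 (lift ord_max i)).
rewrite coef_pderiv_lift mcoeff_mderiv Ee.
have : mdeg e = (mdeg (mnm_sub e (mnm1 i)) + 1)%N by rewrite -{1}Ee mdegD mdeg1.
by move=> dE /(_ ltac:(lia))/eqP; rewrite mulrn_eq0 => /eqP.
Qed.

Section Frame.
Variable (n : nat).
Implicit Types (E : 'M[R]_(m.+1, n)).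

(** By the chain rule, this is the derivative in the [i]-th coordinate of R^n once the linear forms
    given by the rows of [E] are substituted for the variables. *)
Definition dirderiv E (i : 'I_n) P : B := \sum_a pcst (E a i) * pderiv a P.

(* The linear form [row a E] is substituted for the variable [a] and the components
   are the iterated partial derivatives at 0, so that products of variables become
   symmetric products of rows of [E]. *)
Definition jet E P : tens R n := fun w => peval0 (foldl (fun Q i => dirderiv E i Q) P w).

Lemma dirderiv_zmod E i : additive (dirderiv E i).
Proof.
move=> P Q; rewrite /dirderiv -sumrB; apply: eq_bigr => a _.
by rewrite raddfB mulrBr.
Qed.
HB.instance Definition _ E i :=
  GRing.isZmodMorphism.Build B B (dirderiv E i) (dirderiv_zmod E i).

Lemma dirderivM E i P Q :
  dirderiv E i (P * Q) = dirderiv E i P * Q + P * dirderiv E i Q.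
Proof.
rewrite /dirderiv mulr_suml mulr_sumr -big_split /=; apply: eq_bigr => a _.
by rewrite pderivM mulrDr mulrA mulrCA.
Qed.

Lemma dirderiv_cst E i c : dirderiv E i (pcst c) = 0.
Proof. by rewrite /dirderiv big1 // => a _; rewrite pderiv_cst mulr0. Qed.

Lemma dirderiv_var E i a : dirderiv E i (pvar a) = pcst (E a i).
Proof.
rewrite /dirderiv (bigD1 a) //= pderiv_var eqxx mulr1 big1 ?addr0 // => b ba.
by rewrite pderiv_var (negbTE ba) mulr0.
Qed.

Lemma pderiv_dirderiv E i a P : pderiv a (dirderiv E i P) = dirderiv E i (pderiv a P).
Proof.
rewrite /dirderiv raddf_sum; apply: eq_bigr => b _ /=.
by rewrite pderivM pderiv_cst mul0r add0r pderiv_comm.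
Qed.

Lemma dirderiv_comm E i j P : dirderiv E i (dirderiv E j P) = dirderiv E j (dirderiv E i P).
Proof.
have -> : dirderiv E j (dirderiv E i P) =
  \sum_a dirderiv E j (pcst (E a i) * pderiv a P) by exact: raddf_sum.
by apply: eq_bigr => a _; rewrite dirderivM dirderiv_cst /= mul0r add0r pderiv_dirderiv.
Qed.

Lemma jet_cons E P i w : jet E P (i :: w) = jet E (dirderiv E i P) w.
Proof. by []. Qed.

Lemma tcontr_jet E i P : tcontr i (jet E P) = jet E (dirderiv E i P).
Proof. by []. Qed.

Lemma jet_zmod E : additive (jet E).
Proof.
move=> P Q; apply/funext => w; rewrite fctE /=.
elim: w P Q => [|i w IH] P Q; first by rewrite /jet /= raddfB.
by rewrite !jet_cons raddfB IH.
Qed.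
HB.instance Definition _ E := GRing.isZmodMorphism.Build B (tens R n) (jet E) (jet_zmod E).

Lemma jet_sym E P : symmetric_tens (jet E P).
Proof.
move=> w w' ww'; congr peval0; apply: foldl_perm ww' => Q i j.
exact: dirderiv_comm.
Qed.

(** Both sides obey the same recursion on the word: the Leibniz rule [dirderivM] on the left and
    [sprod_cons] on the right. The factorials in [sprod] are exactly what makes this hold without
    extra constants. *)
Lemma jetM E P Q : jet E (P * Q) = sprod (jet E P) (jet E Q).
Proof.
apply/funext => w; elim: w P Q => [|i w IH] P Q.
  by rewrite sprod_nil /jet /= rmorphM.
rewrite sprod_cons; [|exact: jet_sym..].
by rewrite jet_cons dirderivM raddfD fctE /= !IH !tcontr_jet.
Qed.

Lemma jet_cst E c : jet E (pcst c) = tscal c.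
Proof.
apply/funext => -[|i w].
  by rewrite /jet /= /peval0 coefC /= mpolyCK.
by rewrite jet_cons dirderiv_cst raddf0.
Qed.

Lemma jet_var E a : jet E (pvar a) = tvec (row a E).
Proof.
apply/funext => -[|i w]; last first.
  rewrite jet_cons dirderiv_var jet_cst.
  by case: w => [|j w] //=; rewrite mxE.
exact: peval0_var.
Qed.

Lemma jetZ E c P : jet E (pcst c * P) = c *: jet E P.
Proof.
apply/funext => w; elim: w P => [|i w IH] P.
  rewrite /jet /= rmorphM /=; congr (_ * _).
  by rewrite /peval0 coefC /= mpolyCK.
by rewrite jet_cons dirderivM dirderiv_cst mul0r add0r IH.
Qed.

Definition pder (Y : 'I_m.+1 -> B) P : B := \sum_a Y a * pderiv a P.

Lemma pder_zmod Y : additive (pder Y).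
Proof.
move=> P Q; rewrite /pder -sumrB; apply: eq_bigr => a _.
by rewrite raddfB mulrBr.
Qed.
HB.instance Definition _ Y := GRing.isZmodMorphism.Build B B (pder Y) (pder_zmod Y).

(** The hypothesis says that [C'] is the matrix of [C] in the frame of the rows of [E]. Moving
    [dirderiv E i] past the derivation leaves a commutator, and this is the term of [tder] that acts
    on the first letter. *)
Lemma tder_jet E (C : 'M[R]_n) (C' : 'M[R]_m.+1) P : E *m C = C' *m E ->
  tder C (jet E P) = jet E (pder (fun a => plin (C' a)) P).
Proof.
move=> EC; apply/funext => w; elim: w P => [|i w IH] P.
  rewrite /= /jet /= raddf_sum /= big1 // => a _; rewrite rmorphM /=.
  by rewrite peval0_lin mul0r.
rewrite /= tcontr_jet IH jet_cons.
transitivity (jet E (\sum_j pcst (C j i) * dirderiv E j P +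
                     pder (fun a => plin (C' a)) (dirderiv E i P)) w).
  rewrite raddfD fctE; congr (_ + _).
  by rewrite raddf_sum fct_sumE /=; apply: eq_bigr => j _; rewrite jetZ.
congr (jet _ _ _).
have -> : dirderiv E i (pder (fun a => plin (C' a)) P) =
   \sum_a (dirderiv E i (plin (C' a)) * pderiv a P + plin (C' a) * dirderiv E i (pderiv a P)).
  by rewrite raddf_sum; apply: eq_bigr => a _; exact: dirderivM.
rewrite big_split /=; congr (_ + _); last first.
  by apply: eq_bigr => a _; rewrite pderiv_dirderiv.
rewrite /dirderiv; under eq_bigr do rewrite mulr_sumr.
rewrite exchange_big /=; apply: eq_bigr => a _.
rewrite -/(dirderiv E i (plin (C' a))).
have -> : dirderiv E i (plin (C' a)) = pcst ((E *m C) a i).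
  rewrite EC mxE rmorph_sum /= raddf_sum; apply: eq_bigr => b _ /=.
  by rewrite dirderivM dirderiv_cst mul0r add0r dirderiv_var rmorphM.
rewrite mxE rmorph_sum /= mulr_suml; apply: eq_bigr => j _.
by rewrite rmorphM mulrA [pcst (C j i) * _]mulrC.
Qed.

Lemma dirderiv_prod E i p (F : 'I_p.+1 -> B) :
  dirderiv E i (\prod_k F k) = \sum_j dirderiv E i (F j) * \prod_k F (lift j k).
Proof.
elim: p F => [|p IH] F.
  by rewrite !big_ord_recl !big_ord0 !mulr1 addr0.
rewrite big_ord_recl dirderivM IH [RHS]big_ord_recl; congr (_ + _).
rewrite mulr_sumr; apply: eq_bigr => j _.
rewrite mulrCA [in RHS]big_ord_recl; congr (_ * (_ * _)).
  by congr (F _); apply: val_inj.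
apply: eq_bigr => k _; congr (F _); apply: val_inj.
by rewrite /= /bump !leq0n !add1n !addnS ltnS.
Qed.

(** The product rule [dirderiv_prod] selects the factor hit by the first letter, just as
    [vprod_cons] selects the vector in the first slot. *)
Lemma jet_vprod E p (v : 'I_p -> 'rV[R]_n) (y : 'I_p -> 'I_m.+1 -> R) :
  (forall k, (\row_a y k a) *m E = v k) ->
  jet E (\prod_k plin (y k)) = vprod v.
Proof.
move=> yE; apply/funext => w; elim: w p v y yE => [|i w IH] [|p] v y yE.
- by rewrite big_ord0 -(rmorph1 pcst) jet_cst vprod0.
- by rewrite vprod_nil /jet /= big_ord_recl rmorphM /= peval0_lin mul0r.
- by rewrite big_ord0 -(rmorph1 pcst) jet_cst vprod0.
rewrite jet_cons dirderiv_prod vprod_cons raddf_sum fct_sumE /=.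
apply: eq_bigr => j _.
have -> : dirderiv E i (plin (y j)) = pcst (v j 0 i).
  rewrite -yE mxE rmorph_sum raddf_sum; apply: eq_bigr => b _ /=.
  by rewrite dirderivM dirderiv_cst mul0r add0r dirderiv_var rmorphM mxE.
by rewrite jetZ; congr (_ * _); apply: IH => k; exact: yE.
Qed.

End Frame.

Lemma tpush_jet n k (E : 'M[R]_(m.+1, n)) (M : 'M[R]_(n, k)) P : tpush M (jet E P) = jet (E *m M) P.
Proof.
apply/funext => w; elim: w P => [|u w IH] P; first by rewrite tpush_nil.
rewrite tpush_cons jet_cons.
transitivity (jet (E *m M) (\sum_i pcst (M i u) * dirderiv E i P) w).
  rewrite raddf_sum fct_sumE /=; apply: eq_bigr => i _.
  by rewrite tcontr_jet IH jetZ.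
congr (jet _ _ _); rewrite /dirderiv.
under eq_bigr do rewrite mulr_sumr.
rewrite exchange_big /=; apply: eq_bigr => a _.
rewrite mxE rmorph_sum /= mulr_suml; apply: eq_bigr => i _.
by rewrite rmorphM mulrA [pcst (M i u) * _]mulrC.
Qed.

(** Pushing forward by [E'] replaces the frame by the identity, where the components are plain
    partial derivatives at 0 and [taylor0] applies. *)
Lemma jet_inj n (E : 'M[R]_(m.+1, n)) (E' : 'M[R]_(n, m.+1)) P :
  E *m E' = 1%:M -> jet E P = 0 -> P = 0.
Proof.
move=> EE' P0; apply: taylor0 => w.
have <- : jet (E *m E') P w = 0.
  by rewrite -tpush_jet P0 /tpush big1 // => t _; rewrite mul0r.
rewrite EE' {P0}.
congr peval0; elim: w P => //= a w IH P; rewrite IH; congr foldl.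
rewrite /dirderiv (bigD1 a) //= mxE eqxx rmorph1 mul1r big1 ?addr0 // => b ba.
by rewrite mxE (negbTE ba) rmorph0 mul0r.
Qed.

Lemma Sym_jet n (E : 'M[R]_(m.+1, n)) (E' : 'M[R]_(n, m.+1)) p (T : tens R n) :
  E' *m E = 1%:M -> Defs.Sym p T -> exists P, T = jet E P.
Proof.
move=> E'E [N [c [v ->]]].
exists (\sum_(i < N) pcst (c i) * \prod_k plin ((v i k *m E') 0)).
rewrite raddf_sum; apply: eq_bigr => i _ /=; rewrite jetZ; congr (_ *: _).
apply/esym/jet_vprod => k.
have -> : \row_a (v i k *m E') 0 a = v i k *m E' by apply/rowP => a; rewrite mxE.
by rewrite -mulmxA E'E mulmx1.
Qed.

End Jets.

(** * The kernel of the Killing derivation *)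

Section DerivationKernel.
Variables (A : idomainType) (d : {additive A -> A}) (q r : A).
Hypothesis dM : forall x y, d (x * y) = d x * y + x * d y.
Hypothesis dr : d r = q *+ 2.
Hypothesis char0 : forall (x : A) k, x *+ k.+1 = 0 -> x = 0.
Implicit Types (P Q : {poly A}).

(** Here [A] stands for R[X_1 .. X_m], [d] for D and [r] for the sum of the X_i^2. The relation [dr]
    makes [H] a constant of this derivation: ['X] times d(r) = 2q cancels q times the derivative of
    ['X^2]. *)
Definition killing_der P : {poly A} := 'X * map_poly d P - q%:P * P^`().

Local Notation H := ('X^2 + r%:P).

Lemma killing_derB P Q : killing_der (P - Q) = killing_der P - killing_der Q.
Proof. by rewrite /killing_der raddfB derivB; ring. Qed.

Lemma killing_derM P Q : killing_der (P * Q) = killing_der P * Q + P * killing_der Q.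
Proof.
have -> : killing_der (P * Q) =
    'X * (map_poly d P * Q + P * map_poly d Q) - q%:P * (P * Q)^`().
  rewrite /killing_der; congr (_ * _ - _).
  apply/polyP => k; rewrite coefD !coefM coef_map coefM raddf_sum /= -big_split /=.
  by apply: eq_bigr => j _; rewrite dM !coef_map.
by rewrite derivM /killing_der; ring.
Qed.

Lemma killing_der_metric : killing_der H = 0.
Proof.
rewrite /killing_der derivD derivXn derivC addr0.
have d1 : d 1 = 0 by have := dM 1 1; rewrite !mul1r mulr1 -{1}[d 1]addr0 => /addrI.
have -> : map_poly d H = (q *+ 2)%:P.
  apply/polyP => k; rewrite coef_map coefD coefXn !coefC /= raddfD /=.
  by case: k => [|[|[|k]]] //=; rewrite ?raddf0 ?d1 ?add0r ?addr0 ?dr.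
by rewrite polyCMn /= expr1; ring.
Qed.

Lemma coef_killing_der P k : killing_der P = 0 -> d P`_k = q * P`_k.+2 *+ k.+2.
Proof.
move=> /(congr1 (fun Q : {poly A} => Q`_k.+1)).
rewrite coef0 coefB coefXM /= coef_map coefCM coef_deriv -mulrnAr.
by move/eqP; rewrite subr_eq0 => /eqP.
Qed.

(** The constant coefficient of the equation reads [q * P_1 = 0], and [coef_killing_der] at a
    vanishing [P_k] forces [q * P_(k+2)] to vanish too; [A] is a domain. *)
Lemma killing_der_odd P k : q != 0 -> killing_der P = 0 -> odd k -> P`_k = 0.
Proof.
move=> q0 P0; have [N] := ubnP k; elim: N k => // N IH [|[|k]] // leN ok.
  move/(congr1 (fun Q : {poly A} => Q`_0)): P0.
  rewrite coef0 coefB coefXM /= coefCM coef_deriv sub0r => /eqP.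
  by rewrite oppr_eq0 mulf_eq0 (negbTE q0) => /eqP.
have := coef_killing_der k P0; rewrite (IH k) ?raddf0; first last.
- by move: ok; rewrite /= negbK.
- lia.
by move/esym/char0/eqP; rewrite mulf_eq0 (negbTE q0) => /eqP.
Qed.

Lemma killing_der_kernel P : q != 0 -> killing_der P = 0 ->
  exists2 C : {poly A}, (forall i, d C`_i = 0) & P = C \Po H.
Proof.
move=> q0; have [N] := ubnP (size P); elim: N P => // N IH P.
have [->|nz] := eqVneq P 0.
  by move=> _ _; exists 0; [move=> i; rewrite coef0 raddf0 | rewrite comp_poly0].
rewrite ltnS => szP P0; set k := (size P).-1.
have kE : size P = k.+1 by rewrite prednK // size_poly_gt0.
have lc0 : P`_k != 0 by rewrite -lead_coefE lead_coef_eq0.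
have ek : ~~ odd k by apply: contra lc0 => /(killing_der_odd q0 P0) ->.
(* The recursion between the coefficients of index [k] and [k.+2], read at the top degree, where the
   latter is 0. *)
have dlc : d P`_k = 0.
  rewrite (coef_killing_der k P0) nth_default ?mulr0 ?mul0rn //.
  by rewrite kE leqnSn.
(* Since [H] is monic of degree 2, [L] has the degree and the leading coefficient of [P]. It lies in
   the kernel because both of its factors do, so [P - L] is a kernel element of smaller degree. *)
pose L : {poly A} := (P`_k)%:P * H ^+ k./2.
have sH : size H = 3%N.
  by rewrite size_polyDl ?size_polyXn // (leq_ltn_trans (size_polyC_leq1 _)).
have mH : H \is monic.
  by rewrite monicE lead_coefDl ?lead_coefXn ?size_polyXn // (leq_ltn_trans (size_polyC_leq1 _)).
have kk : k = (k./2 * 2)%N by rewrite muln2 -[LHS]odd_double_half (negbTE ek).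
have sHe : size (H ^+ k./2) = (k./2 * 2).+1.
  have := size_exp H k./2; rewrite sH /= mul2n -muln2 => <-.
  by rewrite prednK // size_poly_gt0 monic_neq0 // monic_exp.
have sL : size L = k.+1.
  by rewrite size_Cmul // sHe -kk.
have PLlt : (size (P - L)%R < size P)%N.
  rewrite kE ltnS; apply/leq_sizeP => j; rewrite leq_eqVlt coefB => /predU1P[<-|kj].
    rewrite coefCM [X in _ * _`_X](_ : _ = (size (H ^+ k./2)).-1); last by rewrite sHe.
    have -> : (H ^+ k./2)`_(size (H ^+ k./2)).-1 = 1 by apply/monicP/monic_exp.
    by rewrite mulr1 subrr.
  by rewrite !nth_default ?subr0 // (sL, kE).
have dX Q e : killing_der Q = 0 -> killing_der (Q ^+ e) = 0.
  move=> Q0; elim: e => [|e IHe].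
    rewrite expr0; have := killing_derM 1 1.
    by rewrite !mul1r mulr1 -{1}[killing_der 1]addr0 => /addrI.
  by rewrite exprS killing_derM Q0 IHe mul0r mulr0 addr0.
have L0 : killing_der L = 0.
  rewrite /L killing_derM (dX _ _ killing_der_metric) mulr0 addr0.
  by rewrite /killing_der map_polyC /= dlc derivC !mulr0 subr0 mul0r.
have [|C C0 PC] := IH (P - L) (leq_trans PLlt szP).
  by rewrite killing_derB P0 L0 subr0.
exists (C + (P`_k)%:P * 'X^(k./2)).
  move=> i; rewrite coefD coefCM coefXn raddfD /= C0 add0r.
  by case: (i == _); rewrite ?mulr1 ?mulr0 ?raddf0.
by rewrite comp_polyD comp_polyM comp_polyC comp_Xn_poly -PC subrK.
Qed.

End DerivationKernel.

Lemma widen_ord_lift_max m (i : 'I_m) : widen_ord (leqnSn m) i = lift ord_max i.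
Proof. by apply: ord_inj; rewrite lift_max. Qed.

(** * The Killing derivation over R[X_1 .. X_m] *)

Section KillingPolynomials.
Variables (R : realType) (m : nat) (l : 'I_m -> mpoly m R).

Notation A := (mpoly m R).

Definition hder (f : A) : A := \sum_i l i * mderiv i f.

Lemma hder_zmod : additive hder.
Proof.
move=> f g; rewrite /hder -sumrB; apply: eq_bigr => i _.
by rewrite raddfB mulrBr.
Qed.
HB.instance Definition _ := GRing.isZmodMorphism.Build A A hder hder_zmod.

Lemma hderM (f g : A) : hder (f * g) = hder f * g + f * hder g.
Proof.
rewrite /hder mulr_suml mulr_sumr -big_split /=; apply: eq_bigr => i _.
by rewrite mderivM mulrDr; congr (_ + _); [exact: mulrA | exact: mulrCA].
Qed.

Let X i : A := mpolyX R (mnm1 i).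

Lemma hder_var i : hder (X i) = l i.
Proof.
have dX j : mderiv j (X i) = (i == j)%:R.
  rewrite mderivX mnm1E; case: eqVneq => [->|_] /=; last by rewrite scale0r.
  rewrite scale1r; have -> : mnm_sub (mnm1 j) (mnm1 j) = mnm0; last by rewrite mpolyX0.
  by apply/mnmP => k; rewrite mnmBE mnm0E subnn.
rewrite /hder (bigD1 i) //= dX eqxx mulr1 big1 ?addr0 // => j ji.
by rewrite dX eq_sym (negbTE ji) mulr0.
Qed.

Definition hquad : A := \sum_i X i * l i.
Definition hnorm : A := \sum_i X i ^+ 2.

Lemma hder_norm : hder hnorm = hquad *+ 2.
Proof.
rewrite raddf_sum /hquad -sumrMnl; apply: eq_bigr => i _ /=.
by rewrite expr2 hderM hder_var [l i * _]mulrC mulr2n.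
Qed.

(** The images of the variables under the derivation of the overview. The [l i] stay arbitrary until
    the structure constants supply them. *)
Definition killing_field_der (a : 'I_m.+1) : {poly A} :=
  if unlift ord_max a is Some i then 'X * (l i)%:P else - hquad%:P.

Lemma pder_killing P : pder killing_field_der P = killing_der hder hquad P.
Proof.
rewrite /pder big_ord_recr /= {2}/killing_field_der {2}/pderiv unlift_none mulNr.
congr (_ - _).
apply/polyP => k; rewrite coefXM coef_sum; case: k => [|k].
  rewrite big1 // => i _; rewrite /killing_field_der.
  rewrite widen_ord_lift_max.
  by rewrite liftK -mulrA coefXM.
rewrite coef_map /= /hder; apply: eq_bigr => i _; rewrite /killing_field_der.
rewrite widen_ord_lift_max.
by rewrite liftK -mulrA coefXM /= coefCM coef_pderiv_lift.
Qed.

Lemma mpoly_char0 (f : A) k : f *+ k.+1 = 0 -> f = 0.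
Proof.
move=> fk; apply/mpolyP => e; apply/eqP; rewrite mcoeff0.
by have := congr1 (mcoeff e) fk; rewrite mcoeffMn mcoeff0 => /eqP; rewrite mulrn_eq0.
Qed.

Lemma killing_kernel_nonskew P : hquad != 0 -> pder killing_field_der P = 0 ->
  exists2 C : {poly A}, (forall i, hder C`_i = 0) & P = C \Po ('X^2 + hnorm%:P).
Proof.
move=> q0; rewrite pder_killing => P0.
exact: (killing_der_kernel hderM hder_norm mpoly_char0 q0 P0).
Qed.

Lemma killing_kernel_skew P i : hquad = 0 -> pder killing_field_der P = 0 ->
  hder P`_i = 0.
Proof.
move=> q0; rewrite pder_killing /killing_der q0 polyC0 mul0r subr0.
by move/(congr1 (fun Q : {poly A} => Q`_i.+1)); rewrite coefXM coef_map coef0.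
Qed.

End KillingPolynomials.

(** * Derivatives *)

Section Calculus.
Variables (R : realType).
Implicit Types (U V W : normedModType R).

Lemma derive_comp U V W (f : U -> V) (g : V -> W) x v :
  differentiable f x -> differentiable g (f x) ->
  'D_v (g \o f) x = 'D_('D_v f x) g (f x).
Proof.
move=> df dg; have dgf : differentiable (g \o f) x by exact: differentiable_comp.
by rewrite !deriveE // diff_comp.
Qed.

Lemma near_eq_differentiable V W (f g : V -> W) x :
  {near x, f =1 g} -> differentiable f x -> differentiable g x.
Proof.
move=> fg df; have dfc := diff_continuous df.
suff expand : g \o shift x = cst (g x) + 'd f x +o_ 0 id.
  have dgE : 'd g x = 'd f x :> (V -> W) by exact: diff_unique.
  by apply/diff_locallyP; rewrite dgE.
apply/eqaddoP => _/posnumP[e].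
have /eqaddoP/(_ _ (gt0 e)) := diff_locally df.
have fg0 : \forall h \near (0 : V), f (h + x) = g (h + x).
  by move: fg; rewrite (near_shift 0) subr0.
by apply: filterS2 fg0 => h /= fgh; rewrite /= !fctE /= fgh (nbhs_singleton fg).
Qed.

(** A directional derivative sees only the restriction to a line, so the two functions may live on
    different spaces. This is how a derivative in one chart becomes a partial derivative on a
    product of charts, with no differentiability assumed. *)
Lemma derive_eq_line V V' W (f : V -> W) (g : V' -> W) x v x' v' :
  (forall h : R, f (h *: v + x) = g (h *: v' + x')) -> 'D_v f x = 'D_v' g x'.
Proof.
move=> fg; have fgx : f x = g x' by have := fg 0; rewrite !scale0r !add0r.
have E : (fun h : R => h^-1 *: (f (h *: v + x) - f x)) =
         (fun h => h^-1 *: (g (h *: v' + x') - g x')).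
  by apply/funext => h; rewrite fg fgx.
by rewrite /derive E.
Qed.

Lemma is_derive_eq_line V V' W (f : V -> W) (g : V' -> W) x v x' v' l :
  (forall h : R, f (h *: v + x) = g (h *: v' + x')) ->
  is_derive x' v' g l -> is_derive x v f l.
Proof.
move=> fg [dg <-]; have fgx : f x = g x' by have := fg 0; rewrite !scale0r !add0r.
have E : (fun h : R => h^-1 *: (f (h *: v + x) - f x)) =
         (fun h => h^-1 *: (g (h *: v' + x') - g x')).
  by apply/funext => h; rewrite fg fgx.
by apply: DeriveDef; rewrite /derivable /derive /= E.
Qed.

Lemma derive_affine U V W (f : V -> W) (L : U -> V) (c : V) v x :
  (forall a u u', L (a *: u + u') = a *: L u + L u') ->
  'D_v (fun z => f (L z + c)) x = 'D_(L v) f (L x + c).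
Proof.
by move=> Llin; apply: derive_eq_line => h; rewrite Llin addrA.
Qed.

(** Smoothness cut off at order [k]. The product rule leaves the iterated derivatives of a single
    function, so closure properties are proved by induction on the order, for all functions at
    once. *)
Definition smooth_upto (k : nat) V W (U : set V) (f : V -> W) : Prop :=
  forall vs x, (size vs <= k)%N -> U x ->
    differentiable (foldr (fun v h => 'D_v h) f vs) x.

Lemma smooth_on_upto V W (U : set V) (f : V -> W) :
  smooth_on U f <-> forall k, smooth_upto k U f.
Proof.
split=> [fs k vs x _ Ux|fs vs x Ux]; first exact: fs.
exact: (fs (size vs)).
Qed.

Lemma smooth_upto0 V W (U : set V) (f : V -> W) :
  smooth_upto 0 U f <-> forall x, U x -> differentiable f x.
Proof.
split=> [fs x Ux|fs vs x]; first exact: (fs [::]).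
by rewrite leqn0 => /nilP ->; exact: fs.
Qed.

Lemma smooth_uptoS k V W (U : set V) (f : V -> W) :
  smooth_upto k.+1 U f <->
  (forall x, U x -> differentiable f x) /\ forall v, smooth_upto k U ('D_v f).
Proof.
split=> [fs|[df fs] vs x].
  split=> [x Ux|v vs x szvs Ux]; first exact: (fs [::]).
  by rewrite -(foldr_rcons (fun v h => 'D_v h)); apply: fs; rewrite ?size_rcons.
(* [foldr] applies the last direction of the list first, so the list is taken apart from its end. *)
case/lastP: vs => [|vs v] szvs Ux; first exact: df.
by rewrite foldr_rcons; apply: fs => //; rewrite size_rcons in szvs.
Qed.

Lemma smooth_upto_eq k V W (U : set V) (f g : V -> W) : open U ->
  (forall x, U x -> f x = g x) -> smooth_upto k U f -> smooth_upto k U g.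
Proof.
move=> oU; elim: k f g => [|k IH] f g fg.
  rewrite !smooth_upto0 => fs x Ux; apply: near_eq_differentiable (fs x Ux).
  by apply: filterS fg (open_nbhs_nbhs (conj oU Ux)).
rewrite !smooth_uptoS => -[df fs]; split=> [x Ux|v].
  apply: near_eq_differentiable (df x Ux).
  by apply: filterS fg (open_nbhs_nbhs (conj oU Ux)).
apply: IH (fs v) => x Ux; apply: near_eq_derive.
by apply: filterS fg (open_nbhs_nbhs (conj oU Ux)).
Qed.

Lemma smooth_on_eq V W (U : set V) (f g : V -> W) : open U ->
  (forall x, U x -> f x = g x) -> smooth_on U f -> smooth_on U g.
Proof.
by rewrite !smooth_on_upto => oU fg fs k; exact: smooth_upto_eq (fs k).
Qed.

Lemma smooth_on_diff V W (U : set V) (f : V -> W) x :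
  smooth_on U f -> U x -> differentiable f x.
Proof. by move=> fs; exact: (fs [::]). Qed.

Lemma smooth_on_derive V W (U : set V) (f : V -> W) v :
  smooth_on U f -> smooth_on U ('D_v f).
Proof.
by move=> fs vs x Ux; rewrite -(foldr_rcons (fun v h => 'D_v h)); exact: fs.
Qed.

Lemma smooth_on_sub V W (U U' : set V) (f : V -> W) : U' `<=` U ->
  smooth_on U f -> smooth_on U' f.
Proof. by move=> UU fs vs x /UU Ux; exact: fs. Qed.

Lemma smooth_on_cst V W (U : set V) (c : W) : smooth_on U (fun=> c : W).
Proof.
apply/smooth_on_upto => k; elim: k c => [|k IH] c.
  by rewrite smooth_upto0 => x _; exact: differentiable_cst.
rewrite smooth_uptoS; split=> [x _|v]; first exact: differentiable_cst.
have -> : 'D_v (fun=> c) = (fun=> 0) :> (V -> W) by apply/funext => x; exact: derive_cst.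
exact: IH.
Qed.

Lemma smooth_uptoD k V W (U : set V) (f g : V -> W) : open U ->
  smooth_upto k U f -> smooth_upto k U g -> smooth_upto k U (f \+ g).
Proof.
move=> oU; elim: k f g => [|k IH] f g.
  by rewrite !smooth_upto0 => fs gs x Ux; apply: differentiableD; [exact: fs|exact: gs].
rewrite !smooth_uptoS => -[df fs] [dg gs]; split=> [x Ux|v].
  by apply: differentiableD; [exact: df|exact: dg].
apply: (@smooth_upto_eq _ _ _ _ ('D_v f \+ 'D_v g)) => //; last exact: IH.
by move=> x Ux; rewrite /= deriveD //; apply: diff_derivable; [exact: df|exact: dg].
Qed.

Lemma smooth_on_add V W (U : set V) (f g : V -> W) : open U ->
  smooth_on U f -> smooth_on U g -> smooth_on U (f \+ g).
Proof. by rewrite !smooth_on_upto => oU fs gs k; exact: smooth_uptoD. Qed.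

Lemma smooth_on_sum V W (U : set V) (I : Type) (r : seq I) (f : I -> V -> W) :
  open U -> (forall i, smooth_on U (f i)) ->
  smooth_on U (fun x => \sum_(i <- r) f i x).
Proof.
move=> oU fs; elim: r => [|i r IH].
  by under [X in smooth_on _ X]eq_fun do rewrite big_nil; exact: smooth_on_cst.
under [X in smooth_on _ X]eq_fun do rewrite big_cons.
exact: smooth_on_add.
Qed.

Lemma smooth_uptoM k V (U : set V) (f g : V -> R^o) : open U ->
  smooth_upto k U f -> smooth_upto k U g -> smooth_upto k U (f \* g : V -> R^o).
Proof.
move=> oU; elim: k f g => [|k IH] f g.
  by rewrite !smooth_upto0 => fs gs x Ux; apply: differentiableM; [exact: fs|exact: gs].
(* The product rule multiplies a derivative of one factor by the other factor itself, so the order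
   [k] regularity of [f] and [g] is needed as well. *)
move=> fs gs; have fk := fs; have gk := gs.
move: fs gs; rewrite !smooth_uptoS => -[df fs] [dg gs]; split=> [x Ux|v].
  by apply: differentiableM; [exact: df|exact: dg].
apply: (@smooth_upto_eq _ _ _ _
    ((f \* 'D_v g : V -> R^o) \+ (g \* 'D_v f : V -> R^o))) => //.
  move=> x Ux; apply/esym/deriveM; apply: diff_derivable; [exact: df|exact: dg].
apply: smooth_uptoD => //; apply: IH => // vs x szvs Ux.
  by apply: fk => //; exact: leqW.
by apply: gk => //; exact: leqW.
Qed.

Lemma smooth_on_mul V (U : set V) (f g : V -> R^o) : open U ->
  smooth_on U f -> smooth_on U g -> smooth_on U (f \* g : V -> R^o).
Proof. by rewrite !smooth_on_upto => oU fs gs k; exact: smooth_uptoM. Qed.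

Lemma linear_fun_diff V W (L : V -> W) x :
  (forall a u u', L (a *: u + u') = a *: L u + L u') -> continuous L ->
  differentiable L x.
Proof.
move=> Llin Lc; pose lL := GRing.isLinear.Build R V W *:%R L Llin.
pose L' : {linear V -> W} := HB.pack L lL.
exact: (@linear_differentiable _ _ _ L').
Qed.

(** The derivative of [f] after an affine map is again a derivative of [f] after the same affine
    map, so the induction on the order closes. The application is to slices of a function on a
    product. *)
Lemma smooth_on_affine V' V W (U : set V) (f : V -> W) (L : V' -> V) (c : V) :
  (forall a u u', L (a *: u + u') = a *: L u + L u') -> continuous L ->
  smooth_on U f -> smooth_on [set z | U (L z + c)] (fun z => f (L z + c)).
Proof.
move=> Llin Lc; rewrite !smooth_on_upto => fs k; move: (fs k).
have dL x : differentiable (fun z => L z + c) x.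
  by apply: differentiableD; [exact: linear_fun_diff | exact: differentiable_cst].
elim: k f {fs} => [|k IH] f.
  rewrite !smooth_upto0 => fs x Ux.
  by apply: (@differentiable_comp _ _ _ _ (fun z => L z + c) f) => //; exact: fs.
rewrite !smooth_uptoS => -[df fs]; split=> [x Ux|v].
  by apply: (@differentiable_comp _ _ _ _ (fun z => L z + c) f) => //; exact: df.
have -> : 'D_v (fun z => f (L z + c)) = (fun z => 'D_(L v) f (L z + c)).
  by apply/funext => x; exact: derive_affine.
exact: (IH ('D_(L v) f)).
Qed.

Lemma derive_coord m n V (f : V -> 'M[R]_(m, n)) i j x v : differentiable f x ->
  'D_v (fun z => f z i j : R^o) x = 'D_v f x i j.
Proof. by move=> df; rewrite [in RHS]derive_mx ?mxE //; exact: diff_derivable. Qed.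

Lemma smooth_on_coord m n V (U : set V) (f : V -> 'M[R]_(m, n)) i j : open U ->
  smooth_on U f -> smooth_on U (fun z => f z i j : R^o).
Proof.
move=> oU; rewrite !smooth_on_upto => fs k; move: (fs k) => {fs}.
have dc (g : V -> 'M[R]_(m, n)) x : differentiable g x ->
    differentiable (fun z => g z i j : R^o) x.
  move=> dg; apply: (@differentiable_comp _ _ _ _ g (fun N => N i j : R^o)) => //.
  exact: differentiable_coord.
elim: k f => [|k IH] f.
  by rewrite !smooth_upto0 => fs x Ux; apply: dc; exact: fs.
rewrite !smooth_uptoS => -[df fs]; split=> [x Ux|v]; first by apply: dc; exact: df.
apply: (@smooth_upto_eq _ _ _ _ (fun z => 'D_v f z i j : R^o)) => //; last exact: IH.
by move=> x Ux; rewrite derive_coord //; exact: df.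
Qed.

Lemma diff_approx V W (f : V -> W) x e : differentiable f x -> 0 < e ->
  \forall h \near (0 : V), `|f (h + x) - f x - 'd f x h| <= e * `|h|.
Proof.
move=> df e0; have /eqaddoP/(_ _ e0) := diff_locally df.
by apply: filterS => h /=; rewrite !fctE /= opprD addrA.
Qed.

Lemma is_derive_shift_dir V W (f : V -> W) (x c v : V) (l : W) :
  is_derive (x + c) v f l -> is_derive x v (fun z => f (z + c)) l.
Proof. by apply: is_derive_eq_line => h; rewrite addrA. Qed.

Lemma is_derive_line V W (f : V -> W) (x v : V) (t : R) (l : W) :
  is_derive (t *: v + x) v f l -> is_derive t 1 (fun t => f (t *: v + x)) l.
Proof.
by apply: is_derive_eq_line => h; rewrite addrA -scalerDl [h *: 1]mulr1.
Qed.

Lemma mean_value_dir V (f : V -> R) (df : V -> R) (x v : V) (h : R) : 0 < h ->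
  (forall t : R, 0 <= t <= h -> is_derive (t *: v + x) v f (df (t *: v + x))) ->
  exists2 t : R, 0 <= t <= h & f (h *: v + x) - f x = h * df (t *: v + x).
Proof.
move=> h0 fdf; pose g (t : R) : R := f (t *: v + x).
have gdf (t : R) : 0 <= t <= h -> is_derive t 1 g (df (t *: v + x)).
  by move=> t01; apply: is_derive_line; exact: fdf.
have [c c01] : exists2 c : R, c \in `]0, h[ & g h - g 0 = df (c *: v + x) * (h - 0).
  apply: (@MVT _ g (fun t => df (t *: v + x))) => // [c|].
    by rewrite in_itv /= => /andP[c0 c1]; apply: gdf; rewrite !ltW.
  apply: derivable_within_continuous => c; rewrite in_itv /= => c01.
  by have [] := gdf c c01.
rewrite /g scale0r add0r subr0 mulrC => gE.
by exists c => //; move: c01; rewrite in_itv /= => /andP[c0 c1]; rewrite !ltW.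
Qed.

(** The mean value theorem along [a], applied to the increment of [F] by [h *: b], gives [h] times
    an increment of [F1]. Differentiability of [F1] at the single point [x] then evaluates that
    increment up to a small multiple of [h]. *)
Lemma second_difference V (F F1 : V -> R) (x a b : V) (e : R) : 0 < e ->
  (\forall p \near x, is_derive p a F (F1 p)) -> differentiable F1 x ->
  \forall h \near 0^'+, `|(F (h *: a + x + h *: b) - F (h *: a + x) -
     (F (x + h *: b) - F x)) - h * (h * 'D_b F1 x)| <= h * (e * h).
Proof.
move=> e0 FF1 dF1.
(* All points involved are within [h * N] of [x], and the [1] keeps [N] positive. Two expansions of
   [F1], each with relative error [e / (2 * N)], add up to [e * h]. *)
pose N := `|a| + `|b| + 1; have N0 : 0 < N by rewrite ltr_wpDl // addr_ge0.
have e'0 : 0 < e / (2 * N) by rewrite divr_gt0 // mulr_gt0.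
have [d /= d0 dF] : exists2 d : R, 0 < d & forall h : V, `|h| < d ->
    is_derive (h + x) a F (F1 (h + x)) /\
    `|F1 (h + x) - F1 x - 'd F1 x h| <= e / (2 * N) * `|h|.
  have /nbhs_ballP[d /= d0 dH] : \forall h \near (0 : V),
    is_derive (h + x) a F (F1 (h + x)) /\
    `|F1 (h + x) - F1 x - 'd F1 x h| <= e / (2 * N) * `|h|.
    apply: filterI; last exact: diff_approx.
    by move: FF1; rewrite (near_shift 0) subr0.
  by exists d => // h hd; apply: dH; rewrite -ball_normE /ball_ /= sub0r normrN.
have near_h : \forall h \near (0 : R)^'+, 0 < h /\ h * N < d.
  near=> h; split=> //.
  rewrite -ltr_pdivlMr //; near: h; apply: nbhs_right_lt; exact: divr_gt0.
apply: filterS near_h => h [h0 hN].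
have nb (t s : R) : 0 <= t <= h -> 0 <= s <= h -> `|t *: a + s *: b| <= h * N.
  move=> /andP[t0 t1] /andP[s0 s1].
  apply: (le_trans (ler_normD _ _)); rewrite !normrZ !ger0_norm // /N !mulrDr mulr1.
  by rewrite -[leLHS]addr0 !lerD ?ler_wpM2r // ltW.
have h0h : 0 <= h <= h by rewrite lexx ltW.
have h00 : 0 <= (0 : R) <= h by rewrite lexx ltW.
pose G (p : V) : R := F (p + h *: b) - F p.
pose dG (p : V) : R := F1 (p + h *: b) - F1 p.
have [|t t01] := @mean_value_dir _ G dG x a h h0.
  move=> t t01; apply: is_deriveB.
    apply: is_derive_shift_dir; rewrite addrAC.
    by apply: (dF _ _).1; exact: le_lt_trans (nb _ _ _ _) hN.
  apply: (dF _ _).1; rewrite -[t *: a]addr0 -(scale0r b).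
  exact: le_lt_trans (nb _ _ _ _) hN.
rewrite /G /dG => ->; rewrite -mulrBr normrM (ger0_norm (ltW h0)) ler_pM2l //.
have k1 := nb t h t01 h0h; have k2 := nb t 0 t01 h00.
rewrite scale0r addr0 in k2.
have b1 := (dF _ (le_lt_trans k1 hN)).2; have b2 := (dF _ (le_lt_trans k2 hN)).2.
have DE : h * 'D_b F1 x = 'd F1 x (t *: a + h *: b) - 'd F1 x (t *: a).
  by rewrite -linearB /= addrC addKr linearZ /= -deriveE.
rewrite DE [t *: a + x + _]addrAC.
set u1 := F1 _ in b1 *; set u2 := F1 _ in b2 *.
set v1 := 'd F1 x _ in b1 *; set v2 := 'd F1 x _ in b2 *.
have -> : u1 - u2 - (v1 - v2) = (u1 - F1 x - v1) - (u2 - F1 x - v2) by ring.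
apply: (le_trans (ler_normB _ _)).
apply: (le_trans (lerD b1 b2)).
have -> : e * h = e / (2 * N) * (h * N) + e / (2 * N) * (h * N).
  by field; rewrite gt_eqF.
by rewrite lerD // ler_wpM2l // ltW.
Unshelve. all: by end_near. Qed.

(* Young's form of Schwarz's theorem: both mixed derivatives are limits of the
   same symmetric second difference, so no continuity of them is needed. *)
Lemma mixed_derivatives V (F F1 F2 : V -> R) (x a b : V) :
  (\forall p \near x, is_derive p a F (F1 p)) -> differentiable F1 x ->
  (\forall p \near x, is_derive p b F (F2 p)) -> differentiable F2 x ->
  'D_b F1 x = 'D_a F2 x.
Proof.
move=> FF1 dF1 FF2 dF2; apply/eqP; rewrite -subr_eq0 -normr_le0.
apply/ler_addgt0Pl => e e0; rewrite addr0.
have e20 : 0 < e / 2 by rewrite divr_gt0.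
have [h [h0 [s1 s2]]] : exists h : R, 0 < h /\ (`|(F (h *: a + x + h *: b) - F (h *: a + x) -
     (F (x + h *: b) - F x)) - h * (h * 'D_b F1 x)| <= h * (e / 2 * h) /\
   `|(F (h *: b + x + h *: a) - F (h *: b + x) -
     (F (x + h *: a) - F x)) - h * (h * 'D_a F2 x)| <= h * (e / 2 * h)).
  near (0 : R)^'+ => h; exists h; split => //; split; near: h.
    exact: second_difference.
  exact: second_difference.
rewrite ![x + _]addrC [h *: b + x + _]addrC addrA [h *: a + x + _]addrAC in s1 s2.
set D1 := 'D_b F1 x in s1 *; set D2 := 'D_a F2 x in s2 *.
have hh0 : 0 < h * h by exact: mulr_gt0.
rewrite -(ler_pM2l hh0) -{1}(gtr0_norm hh0) -normrM.
set A := F (h *: a + h *: b + x) in s1 s2; set B := F (h *: a + x) in s1 s2.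
set C := F (h *: b + x) in s1 s2; set E := F x in s1 s2.
have -> : h * h * (D1 - D2) = (A - C - (B - E) - h * (h * D2)) -
    (A - B - (C - E) - h * (h * D1)) by ring.
apply: (le_trans (ler_normB _ _)); apply: (le_trans (lerD s2 s1)).
by rewrite le_eqVlt; apply/orP; left; apply/eqP; field.
Unshelve. all: by end_near. Qed.

Lemma zero_derivative_ball V (f : V -> R) (x y : V) (r : R) :
  (forall z, ball x r z -> differentiable f z /\ forall v, 'D_v f z = 0) ->
  ball x r y -> f y = f x.
Proof.
move=> f0 xy.
have xr (t : R) : 0 <= t <= 1 -> ball x r (t *: (y - x) + x).
  move=> /andP[t0 t1]; rewrite -ball_normE /ball_ /= opprD addrCA subrr addr0 normrN.
  rewrite normrZ ger0_norm // (le_lt_trans (ler_piMl _ t1)) //.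
  by move: xy; rewrite -ball_normE /ball_ /= distrC.
have [t t01|t t01] := @mean_value_dir _ f (fun=> 0) x (y - x) 1 ltr01.
  have [df d0] := f0 _ (xr t t01); rewrite -(d0 (y - x)).
  by apply: DeriveDef => //; exact: diff_derivable.
by rewrite scale1r subrK mulr0 => /eqP; rewrite subr_eq0 => /eqP.
Qed.

End Calculus.

(** * Partial derivatives and Jacobians *)

Section Pairs.
Variables (R : realType).
Implicit Types (U V W : normedModType R).

Lemma derive_pair_l U V W (f : U * V -> W) (x v : U) (y : V) :
  'D_v (fun z => f (z, y)) x = 'D_(v, 0) f (x, y).
Proof.
apply: derive_eq_line => h; congr (f _).
by congr (_, _); rewrite /= scaler0 add0r.
Qed.

Lemma derive_pair_r U V W (f : U * V -> W) (x : U) (y v : V) :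
  'D_v (fun z => f (x, z)) y = 'D_(0, v) f (x, y).
Proof.
apply: derive_eq_line => h; congr (f _).
by congr (_, _); rewrite /= scaler0 add0r.
Qed.

Lemma smooth_on_pair_l U V W (D : set (U * V)) (f : U * V -> W) (y : V) :
  smooth_on D f -> smooth_on [set z | D (z, y)] (fun z => f (z, y)).
Proof.
move=> fs; have E z : (z, 0) + (0, y) = (z, y) :> U * V.
  by congr (_, _); rewrite /= ?addr0 ?add0r.
have := smooth_on_affine (L := fun z : U => (z, 0) : U * V) (c := (0, y)) _ _ fs.
have -> : (fun z : U => f ((z, 0) + (0, y))) = (fun z => f (z, y)).
  by apply/funext => z; rewrite E.
have -> : [set z : U | D ((z, 0) + (0, y))] = [set z | D (z, y)].
  by apply/funext => z /=; rewrite E.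
apply=> [a u u'|z]; first by congr (_, _); rewrite /= scaler0 addr0.
by apply: cvg_pair; [exact: cvg_id | exact: cvg_cst].
Qed.

Lemma smooth_on_pair_r U V W (D : set (U * V)) (f : U * V -> W) (x : U) :
  smooth_on D f -> smooth_on [set z | D (x, z)] (fun z => f (x, z)).
Proof.
move=> fs; have E z : (0, z) + (x, 0) = (x, z) :> U * V.
  by congr (_, _); rewrite /= ?addr0 ?add0r.
have := smooth_on_affine (L := fun z : V => (0, z) : U * V) (c := (x, 0)) _ _ fs.
have -> : (fun z : V => f ((0, z) + (x, 0))) = (fun z => f (x, z)).
  by apply/funext => z; rewrite E.
have -> : [set z : V | D ((0, z) + (x, 0))] = [set z | D (x, z)].
  by apply/funext => z /=; rewrite E.
apply=> [a u u'|z]; first by congr (_, _); rewrite /= scaler0 addr0.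
by apply: cvg_pair; [exact: cvg_cst | exact: cvg_id].
Qed.

Lemma differentiable_id V (x : V) : differentiable id x.
Proof. exact: ex_diff. Qed.

Lemma mx_row_ext m n (A B : 'M[R]_(m, n)) : (forall v : 'rV_m, v *m A = v *m B) -> A = B.
Proof. by move=> AB; apply/row_matrixP => i; rewrite !rowE. Qed.

Lemma mul_jacobian m n (f : 'rV[R]_m -> 'rV[R]_n) p v : differentiable f p ->
  v *m 'J f p = 'D_v f p.
Proof. by move=> df; rewrite deriveEjacobian. Qed.

Lemma jacobian_comp m n k (f : 'rV[R]_m -> 'rV[R]_n) (g : 'rV[R]_n -> 'rV[R]_k) p :
  differentiable f p -> differentiable g (f p) ->
  'J (g \o f) p = 'J f p *m 'J g (f p).
Proof.
move=> df dg; apply: mx_row_ext => v.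
rewrite mulmxA (mul_jacobian v df) (mul_jacobian _ dg).
by rewrite (mul_jacobian v (differentiable_comp df dg)) (derive_comp v df dg).
Qed.

Lemma near_eq_jacobian m n (f g : 'rV[R]_m -> 'rV[R]_n) p : {near p, f =1 g} ->
  differentiable f p -> 'J f p = 'J g p.
Proof.
move=> fg df; have dg := near_eq_differentiable fg df; apply: mx_row_ext => v.
transitivity ('D_v f p); first exact: mul_jacobian.
transitivity ('D_v g p); first exact: (near_eq_derive v fg).
exact/esym/mul_jacobian.
Qed.

Lemma jacobian_id m (p : 'rV[R]_m) : 'J id p = 1%:M.
Proof. by apply: mx_row_ext => v; rewrite mul_jacobian // derive_id mulmx1. Qed.

End Pairs.

(** * Manifolds and Lie groups *)

Section Manifolds.
Variables (R : realType) (n : nat) (M : manifoldType R n).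
Implicit Types (p q u w y : M).

Lemma chart_im p q : chart_dom p q -> (chart p @` chart_dom p) (chart p q).
Proof. by move=> pq; exists q. Qed.

Lemma chart_im_center p : (chart p @` chart_dom p) (chart p p).
Proof. exact/chart_im/chart_dom_center. Qed.

Lemma chart_invK p z : (chart p @` chart_dom p) z -> chart p (chart_inv p z) = z.
Proof. by move=> [q pq <-]; rewrite chartK. Qed.

Lemma chart_inv_dom p z : (chart p @` chart_dom p) z -> chart_dom p (chart_inv p z).
Proof. by move=> [q pq <-]; rewrite chartK. Qed.

Lemma chart_inv_center p : chart_inv p (chart p p) = p.
Proof. exact/chartK/chart_dom_center. Qed.

Lemma near_chart_dom p q : chart_dom p q -> \forall y \near q, chart_dom p y.
Proof. by move=> pq; apply: open_nbhs_nbhs; split => //; exact: chart_dom_open. Qed.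

Lemma near_chart_im p z : (chart p @` chart_dom p) z ->
  \forall z' \near z, (chart p @` chart_dom p) z'.
Proof. by move=> pz; apply: open_nbhs_nbhs; split => //; exact: chart_im_open. Qed.

Lemma transition_diff u w y : chart_dom u y -> chart_dom w y ->
  differentiable (chart w \o chart_inv u) (chart u y).
Proof. by move=> uy wy; apply: (smooth_on_diff (chart_compat u w)); exists y. Qed.

Section IntoManifold.
Variables (V : normedModType R) (F : V -> M) (z : V).
Hypothesis Fc : {for z, continuous F}.

Lemma near_transition u w : chart_dom u (F z) ->
  {near z, (chart w \o chart_inv u) \o (chart u \o F) =1 chart w \o F}.
Proof.
by move=> uF; near=> z'; rewrite /= chartK //; near: z'; apply: Fc; exact: near_chart_dom.
Unshelve. all: by end_near. Qed.

End IntoManifold.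

Lemma jacobian_transition m (F : 'rV[R]_m -> M) z u w : {for z, continuous F} ->
  chart_dom u (F z) -> chart_dom w (F z) -> differentiable (chart u \o F) z ->
  'J (chart w \o F) z = 'J (chart u \o F) z *m 'J (chart w \o chart_inv u) (chart u (F z)).
Proof.
move=> Fc uF wF df; have dT := transition_diff uF wF.
transitivity ('J ((chart w \o chart_inv u) \o (chart u \o F)) z).
  apply/esym/near_eq_jacobian; first exact: near_transition.
  exact: differentiable_comp df dT.
exact: jacobian_comp df dT.
Qed.

Lemma chart_inv_cont p z : (chart p @` chart_dom p) z -> {for z, continuous (chart_inv p)}.
Proof. by move=> pz; exact: chart_inv_continuous. Qed.

Lemma coord_change_id p : coord_change p p = 1%:M.
Proof.
rewrite -(jacobian_id (chart p p)); apply/esym/near_eq_jacobian; last exact: differentiable_id.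
near=> z; rewrite /= chart_invK //; near: z; exact/near_chart_im/chart_im_center.
Unshelve. all: by end_near. Qed.

Lemma coord_change_unit w y : chart_dom w y -> coord_change w y \in unitmx.
Proof.
move=> wy; have yy := chart_dom_center y.
have zz := chart_im wy.
suff : 'J (chart y \o chart_inv w) (chart w y) *m coord_change w y = 1%:M.
  by move/mulmx1_unit => [].
have := @jacobian_transition n (chart_inv w) (chart w y) y w.
rewrite !chartK // => /(_ (chart_inv_cont zz) yy wy (transition_diff wy yy)) <-.
rewrite -(jacobian_id (chart w y)); apply/esym/near_eq_jacobian; last exact: differentiable_id.
by near=> z; rewrite /= chart_invK //; near: z; exact: near_chart_im.
Unshelve. all: by end_near. Qed.

End Manifolds.

Section TangentMaps.
Variables (R : realType) (n : nat).
Implicit Types (M N P : manifoldType R n).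

(** Continuity is a separate requirement: charts are total functions with arbitrary values off their
    domains, so a differentiable coordinate expression does not by itself keep [f] inside the target
    chart. *)
Definition mdiff M N (f : M -> N) (u : M) : Prop :=
  {for u, continuous f} /\
  differentiable (chart (f u) \o f \o chart_inv u) (chart u u).

Lemma tangent_map_comp M N P (f : M -> N) (g : N -> P) u :
  mdiff f u -> mdiff g (f u) ->
  tangent_map (g \o f) u = tangent_map f u *m tangent_map g (f u).
Proof.
move=> [fc df] [gc dg]; rewrite /tangent_map.
have Fc : {for chart u u, continuous (f \o chart_inv u)}.
  apply: continuous_comp; first exact/chart_inv_cont/chart_im_center.
  by rewrite chart_inv_center.
have fE : (chart (f u) \o f \o chart_inv u) (chart u u) = chart (f u) (f u).
  by rewrite /= chart_inv_center.
rewrite -fE in dg.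
transitivity ('J ((chart (g (f u)) \o g \o chart_inv (f u)) \o
  (chart (f u) \o f \o chart_inv u)) (chart u u)); last by rewrite (jacobian_comp df dg) fE.
apply/esym/near_eq_jacobian; last exact: differentiable_comp df dg.
near=> z; rewrite /= chartK //; near: z; apply: Fc.
by rewrite /= chart_inv_center; exact/near_chart_dom/chart_dom_center.
Unshelve. all: by end_near. Qed.

Lemma tangent_map_id M (u : M) : tangent_map id u = 1%:M.
Proof. exact: coord_change_id. Qed.

End TangentMaps.

Lemma mulmx_conj_comp (R : realType) n (La Lb Ra Rb S T A B : 'M[R]_n) :
  A *m Ra = La -> B *m Rb = Lb -> La *m T = Rb *m S ->
  B *m A *m (Ra *m T) = Lb *m S.
Proof.
by move=> AR BR LT; rewrite -(mulmxA B) (mulmxA A) AR LT mulmxA BR.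
Qed.

(** * Translations, invariant fields and the adjoint representation *)

Section LieGroups.
Variables (R : realType) (n : nat) (G : lieGroupType R n).
Implicit Types (u v w a b : G) (x y : 'rV[R]_n).

Notation e := (1%g : G).
Notation c1 := (chart e e).

Definition mulc u v w (z : 'rV[R]_n * 'rV[R]_n) : 'rV[R]_n :=
  chart w (chart_inv u z.1 * chart_inv v z.2)%g.

Definition mul_dom u v w : set ('rV[R]_n * 'rV[R]_n) :=
  [set z | (chart u @` chart_dom u) z.1 /\ (chart v @` chart_dom v) z.2 /\
           chart_dom w (chart_inv u z.1 * chart_inv v z.2)%g].

Lemma mulc_smooth u v w : smooth_on (mul_dom u v w) (mulc u v w).
Proof. exact: lie_mul_smooth. Qed.

Lemma mul_cvg (T : topologicalType) (f h : T -> G) (z : T) :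
  {for z, continuous f} -> {for z, continuous h} ->
  {for z, continuous (fun t => f t * h t)%g}.
Proof.
move=> fc hc; apply: (@continuous_comp _ _ _ (fun t => (f t, h t)) (fun q : G * G => (q.1 * q.2)%g)).
  exact: cvg_pair.
exact: lie_mul_continuous.
Qed.

Lemma near_mul_dom u v w z : mul_dom u v w z -> \forall z' \near z, mul_dom u v w z'.
Proof.
move=> [z1 [z2 zw]].
have c1z : {for z, continuous (fun t : 'rV[R]_n * 'rV[R]_n => chart_inv u t.1)}.
  by apply: continuous_comp; [exact: cvg_fst | exact: chart_inv_cont].
have c2z : {for z, continuous (fun t : 'rV[R]_n * 'rV[R]_n => chart_inv v t.2)}.
  by apply: continuous_comp; [exact: cvg_snd | exact: chart_inv_cont].
apply: filterI; first by apply: cvg_fst; exact: near_chart_im.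
apply: filterI; first by apply: cvg_snd; exact: near_chart_im.
exact: (mul_cvg c1z c2z (near_chart_dom zw)).
Qed.

Lemma left_trans_cont a u : {for u, continuous (Defs.left_trans a)}.
Proof. by apply: mul_cvg; [exact: cvg_cst | exact: cvg_id]. Qed.

Lemma right_trans_cont a u : {for u, continuous (Defs.right_trans a)}.
Proof. by apply: mul_cvg; [exact: cvg_id | exact: cvg_cst]. Qed.

Lemma mulc_left u v w z : (fun z' => mulc u v w (z, z')) =
  chart w \o Defs.left_trans (chart_inv u z) \o chart_inv v.
Proof. by []. Qed.

Lemma mulc_right u v w z : (fun z' => mulc u v w (z', z)) =
  chart w \o Defs.right_trans (chart_inv v z) \o chart_inv u.
Proof. by []. Qed.

(** Left translation by [a] is the slice of the multiplication through the centre of the chart at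
    [a], so the smoothness axiom in two variables applies. *)
Lemma left_trans_diff w a v z : (chart v @` chart_dom v) z ->
  chart_dom w (a * chart_inv v z)%g ->
  differentiable (chart w \o Defs.left_trans a \o chart_inv v) z.
Proof.
move=> vz wz; rewrite -{1}(chart_inv_center a) -mulc_left.
apply: (smooth_on_diff (@smooth_on_pair_r _ _ _ _ _ _ (chart a a) (@mulc_smooth a v w))).
by split; [exact: chart_im_center | split=> //=; rewrite chart_inv_center].
Qed.

Lemma right_trans_diff w a v z : (chart v @` chart_dom v) z ->
  chart_dom w (chart_inv v z * a)%g ->
  differentiable (chart w \o Defs.right_trans a \o chart_inv v) z.
Proof.
move=> vz wz; rewrite -{1}(chart_inv_center a) -mulc_right.
apply: (smooth_on_diff (@smooth_on_pair_l _ _ _ _ _ _ (chart a a) (@mulc_smooth v a w))).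
by split=> //=; split; [exact: chart_im_center | rewrite /= chart_inv_center].
Qed.

Lemma mdiff_left a u : mdiff (Defs.left_trans a) u.
Proof.
split; first exact: left_trans_cont.
apply: left_trans_diff; first exact: chart_im_center.
by rewrite chart_inv_center; exact: chart_dom_center.
Qed.

Lemma mdiff_right a u : mdiff (Defs.right_trans a) u.
Proof.
split; first exact: right_trans_cont.
apply: right_trans_diff; first exact: chart_im_center.
by rewrite chart_inv_center; exact: chart_dom_center.
Qed.

Definition Lmat u : 'M[R]_n := tangent_map (Defs.left_trans u) e.
Definition Rmat u : 'M[R]_n := tangent_map (Defs.right_trans u) e.

Lemma tangent_left_comp a b u : tangent_map (Defs.left_trans (a * b)%g) u =
  tangent_map (Defs.left_trans b) u *m tangent_map (Defs.left_trans a) (b * u)%g.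
Proof.
rewrite -(tangent_map_comp (mdiff_left b u) (mdiff_left a _)); congr tangent_map.
by apply/funext => v; rewrite /Defs.left_trans /= mulgA.
Qed.

Lemma tangent_right_comp a b u : tangent_map (Defs.right_trans (a * b)%g) u =
  tangent_map (Defs.right_trans a) u *m tangent_map (Defs.right_trans b) (u * a)%g.
Proof.
rewrite -(tangent_map_comp (mdiff_right a u) (mdiff_right b _)); congr tangent_map.
by apply/funext => v; rewrite /Defs.right_trans /= mulgA.
Qed.

Lemma tangent_left_right a b u :
  tangent_map (Defs.left_trans a) u *m tangent_map (Defs.right_trans b) (a * u)%g =
  tangent_map (Defs.right_trans b) u *m tangent_map (Defs.left_trans a) (u * b)%g.
Proof.
transitivity (tangent_map (Defs.right_trans b \o Defs.left_trans a) u).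
  exact: (esym (tangent_map_comp (mdiff_left a u) (mdiff_right b (a * u)%g))).
transitivity (tangent_map (Defs.left_trans a \o Defs.right_trans b) u).
  congr (tangent_map _ u); apply/funext => v.
  by rewrite /Defs.right_trans /Defs.left_trans /= mulgA.
exact: (tangent_map_comp (mdiff_right b u) (mdiff_left a (u * b)%g)).
Qed.

Lemma left_trans1 : Defs.left_trans e = id.
Proof. by apply/funext => u; exact: mul1g. Qed.

Lemma right_trans1 : Defs.right_trans e = id.
Proof. by apply/funext => u; exact: mulg1. Qed.

Lemma Lmat1 : Lmat e = 1%:M.
Proof. by rewrite /Lmat left_trans1 tangent_map_id. Qed.

Lemma Rmat1 : Rmat e = 1%:M.
Proof. by rewrite /Rmat right_trans1 tangent_map_id. Qed.

Lemma LmatM a b : Lmat (a * b)%g = Lmat b *m tangent_map (Defs.left_trans a) b.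
Proof. by rewrite /Lmat tangent_left_comp mulg1. Qed.

Lemma RmatM a b : Rmat (a * b)%g = Rmat a *m tangent_map (Defs.right_trans b) a.
Proof. by rewrite /Rmat tangent_right_comp mul1g. Qed.

Lemma Lmat_unit u : Lmat u \in unitmx.
Proof.
have h : Lmat u *m tangent_map (Defs.left_trans (u^-1)%g) u = 1%:M.
  by rewrite -LmatM (mulVg u) Lmat1.
exact: (mulmx1_unit h).1.
Qed.

Lemma Rmat_unit u : Rmat u \in unitmx.
Proof.
have h : Rmat u *m tangent_map (Defs.right_trans (u^-1)%g) u = 1%:M.
  by rewrite -RmatM (mulgV u) Rmat1.
exact: (mulmx1_unit h).1.
Qed.

(** [Lmat u] and [Rmat u] both land in the chart at [u], which cancels in the quotient; [Ad u] is an
    endomorphism of the tangent space at 1. Matrices act on row vectors, so [AdM] reverses the order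
    of the factors. *)
Definition Ad u : 'M[R]_n := Lmat u *m invmx (Rmat u).

Lemma AdE u : Ad u = Lmat u *m invmx (Rmat u).
Proof. by []. Qed.

Lemma AdK u : Ad u *m Rmat u = Lmat u.
Proof. exact: (mulmxKV (Rmat_unit u)). Qed.

Lemma Ad1 : Ad e = 1%:M.
Proof. by rewrite /Ad Lmat1 Rmat1 mul1mx invmx1. Qed.

Lemma AdM a b : Ad (a * b)%g = Ad b *m Ad a.
Proof.
(* Left translation by [a] commutes with right translation by [b]; this is the only group law that
   the product formula needs beyond the chain rule. *)
have lr := tangent_left_right a b e; rewrite mulg1 mul1g in lr.
have h : Ad b *m Ad a *m Rmat (a * b)%g = Lmat (a * b)%g.
  rewrite RmatM LmatM; exact: mulmx_conj_comp (AdK a) (AdK b) lr.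
by rewrite AdE -h; exact: (mulmxK (Rmat_unit _)).
Qed.

Lemma left_inv_fieldE x u : left_inv_field x u = x *m Lmat u.
Proof. by []. Qed.

Lemma right_inv_fieldE x u : right_inv_field x u = x *m Rmat u.
Proof. by []. Qed.

(** The field is given in the chart at [y = chart_inv w z], which varies with [z]. Changing to the
    chart [w] removes it, and what remains is a partial derivative of the multiplication read in
    fixed charts; smoothness of the field follows from this. *)
Lemma local_left w x z : (chart w @` chart_dom w) z ->
  local_vfield w (left_inv_field x : vfield G) z = 'D_(0, x) (mulc w e w) (z, c1).
Proof.
move=> wz; set y := chart_inv w z; have wy : chart_dom w y by exact: chart_inv_dom.
rewrite -derive_pair_r mulc_left -/y /local_vfield -/y /left_inv_field -mulmxA.
have ce := chart_im_center e.
have yE : (Defs.left_trans y \o chart_inv e) c1 = y.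
  by rewrite /= chart_inv_center /Defs.left_trans mulg1.
have Fc : {for c1, continuous (Defs.left_trans y \o chart_inv e)}.
  by apply: continuous_comp; [exact: chart_inv_cont | exact: left_trans_cont].
have yd : chart_dom y (y * chart_inv e c1)%g.
  by rewrite chart_inv_center mulg1; exact: chart_dom_center.
have wd : chart_dom w (y * chart_inv e c1)%g by rewrite chart_inv_center mulg1.
have dy := left_trans_diff ce yd.
rewrite -(mul_jacobian x (left_trans_diff ce wd)); congr (_ *m _).
have Fy : chart_dom y ((Defs.left_trans y \o chart_inv e) c1) by exact: yd.
have Fw : chart_dom w ((Defs.left_trans y \o chart_inv e) c1) by exact: wd.
have -> : tangent_map (Defs.left_trans y) e = 'J (chart y \o (Defs.left_trans y \o chart_inv e)) c1.
  have ye : Defs.left_trans y e = y by exact: mulg1.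
  by rewrite /tangent_map ye.
have -> : coord_change w y = 'J (chart w \o chart_inv y)
    (chart y ((Defs.left_trans y \o chart_inv e) c1)) by rewrite yE.
exact: (esym (jacobian_transition Fc Fy Fw dy)).
Qed.

Lemma local_right w x z : (chart w @` chart_dom w) z ->
  local_vfield w (right_inv_field x : vfield G) z = 'D_(x, 0) (mulc e w w) (c1, z).
Proof.
move=> wz; set y := chart_inv w z; have wy : chart_dom w y by exact: chart_inv_dom.
rewrite -derive_pair_l mulc_right -/y /local_vfield -/y /right_inv_field -mulmxA.
have ce := chart_im_center e.
have yE : (Defs.right_trans y \o chart_inv e) c1 = y.
  by rewrite /= chart_inv_center /Defs.right_trans mul1g.
have Fc : {for c1, continuous (Defs.right_trans y \o chart_inv e)}.
  by apply: continuous_comp; [exact: chart_inv_cont | exact: right_trans_cont].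
have yd : chart_dom y (chart_inv e c1 * y)%g.
  by rewrite chart_inv_center mul1g; exact: chart_dom_center.
have wd : chart_dom w (chart_inv e c1 * y)%g by rewrite chart_inv_center mul1g.
have dy := right_trans_diff ce yd.
rewrite -(mul_jacobian x (right_trans_diff ce wd)); congr (_ *m _).
have Fy : chart_dom y ((Defs.right_trans y \o chart_inv e) c1) by exact: yd.
have Fw : chart_dom w ((Defs.right_trans y \o chart_inv e) c1) by exact: wd.
have -> : tangent_map (Defs.right_trans y) e = 'J (chart y \o (Defs.right_trans y \o chart_inv e)) c1.
  have ye : Defs.right_trans y e = y by exact: mul1g.
  by rewrite /tangent_map ye.
have -> : coord_change w y = 'J (chart w \o chart_inv y)
    (chart y ((Defs.right_trans y \o chart_inv e) c1)) by rewrite yE.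
exact: (esym (jacobian_transition Fc Fy Fw dy)).
Qed.

Lemma mul_dom_e_right w z : (chart w @` chart_dom w) z -> mul_dom w e w (z, c1).
Proof.
move=> wz; split=> //; split; first exact: chart_im_center.
by rewrite /= chart_inv_center mulg1; exact: chart_inv_dom.
Qed.

Lemma mul_dom_e_left w z : (chart w @` chart_dom w) z -> mul_dom e w w (c1, z).
Proof.
move=> wz; split; first exact: chart_im_center.
by split=> //; rewrite /= chart_inv_center mul1g; exact: chart_inv_dom.
Qed.

Lemma smooth_left x : smooth_vfield (left_inv_field x : vfield G).
Proof.
move=> w; apply: (@smooth_on_eq _ _ _ _ (fun z => 'D_(0, x) (mulc w e w) (z, c1))).
- exact: chart_im_open.
- by move=> z /local_left ->.
have := @smooth_on_pair_l _ _ _ _ _ _ c1 (smooth_on_derive (0, x) (@mulc_smooth w e w)).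
by apply: smooth_on_sub => z; exact: mul_dom_e_right.
Qed.

Lemma smooth_right x : smooth_vfield (right_inv_field x : vfield G).
Proof.
move=> w; apply: (@smooth_on_eq _ _ _ _ (fun z => 'D_(x, 0) (mulc e w w) (c1, z))).
- exact: chart_im_open.
- by move=> z /local_right ->.
have := @smooth_on_pair_r _ _ _ _ _ _ c1 (smooth_on_derive (x, 0) (@mulc_smooth e w w)).
by apply: smooth_on_sub => z; exact: mul_dom_e_left.
Qed.

End LieGroups.

Section Calculus2.
Variables (R : realType).
Implicit Types (U V W : normedModType R).

Lemma differentiable_fst U V (z : U * V) : differentiable (fun q : U * V => q.1) z.
Proof. by apply: linear_fun_diff => // q; exact: cvg_fst. Qed.

Lemma differentiable_snd U V (z : U * V) : differentiable (fun q : U * V => q.2) z.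
Proof. by apply: linear_fun_diff => // q; exact: cvg_snd. Qed.

Lemma diff_coord m n V (f : V -> 'M[R]_(m, n)) i j x : differentiable f x ->
  differentiable (fun z => f z i j : R^o) x.
Proof.
move=> df; apply: (@differentiable_comp _ _ _ _ f (fun N => N i j : R^o)) => //.
exact: differentiable_coord.
Qed.

Lemma is_derive_coord m n V (f : V -> 'M[R]_(m, n)) i j x v : differentiable f x ->
  is_derive x v (fun z => f z i j : R^o) ('D_v f x i j).
Proof.
move=> df; rewrite -derive_coord //; apply: DeriveDef => //.
exact/diff_derivable/diff_coord.
Qed.

End Calculus2.

(** * Commutation of left- and right-invariant fields *)

Section Brackets.
Variables (R : realType) (n : nat) (G : lieGroupType R n).
Implicit Types (u v w a b : G) (x y : 'rV[R]_n).

Notation e := (1%g : G).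
Notation c1 := (chart e e).

Definition ltr_chart u : 'rV[R]_n -> 'rV[R]_n := chart u \o Defs.left_trans u \o chart_inv e.
Definition rtr_chart u : 'rV[R]_n -> 'rV[R]_n := chart u \o Defs.right_trans u \o chart_inv e.

Lemma ltr_chart_center u : ltr_chart u c1 = chart u u.
Proof. by rewrite /ltr_chart /= chart_inv_center /Defs.left_trans mulg1. Qed.

Lemma rtr_chart_center u : rtr_chart u c1 = chart u u.
Proof. by rewrite /rtr_chart /= chart_inv_center /Defs.right_trans mul1g. Qed.

Lemma ltr_chart_diff u : differentiable (ltr_chart u) c1.
Proof.
apply: left_trans_diff; first exact: chart_im_center.
by rewrite chart_inv_center mulg1; exact: chart_dom_center.
Qed.

Lemma rtr_chart_diff u : differentiable (rtr_chart u) c1.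
Proof.
apply: right_trans_diff; first exact: chart_im_center.
by rewrite chart_inv_center mul1g; exact: chart_dom_center.
Qed.

Lemma derive_ltr_chart u y : 'D_y (ltr_chart u) c1 = left_inv_field y u.
Proof.
have ue : Defs.left_trans u e = u by exact: mulg1.
have JE : tangent_map (Defs.left_trans u) e = 'J (ltr_chart u) c1.
  by rewrite /tangent_map ue.
by rewrite /left_inv_field JE; exact: (esym (mul_jacobian y (ltr_chart_diff u))).
Qed.

Lemma derive_rtr_chart u y : 'D_y (rtr_chart u) c1 = right_inv_field y u.
Proof.
have ue : Defs.right_trans u e = u by exact: mul1g.
have JE : tangent_map (Defs.right_trans u) e = 'J (rtr_chart u) c1.
  by rewrite /tangent_map ue.
by rewrite /right_inv_field JE; exact: (esym (mul_jacobian y (rtr_chart_diff u))).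
Qed.

Lemma near_ltr_chart u :
  \forall q \near c1, (chart e @` chart_dom e) q /\ chart_dom u (u * chart_inv e q)%g.
Proof.
have ce := chart_im_center e.
apply: filterI; first exact: near_chart_im.
have Fc : {for c1, continuous (Defs.left_trans u \o chart_inv e)}.
  by apply: continuous_comp; [exact: chart_inv_cont | exact: left_trans_cont].
apply: Fc; rewrite /= chart_inv_center /Defs.left_trans mulg1.
exact/near_chart_dom/chart_dom_center.
Qed.

Lemma near_rtr_chart u :
  \forall q \near c1, (chart e @` chart_dom e) q /\ chart_dom u (chart_inv e q * u)%g.
Proof.
have ce := chart_im_center e.
apply: filterI; first exact: near_chart_im.
have Fc : {for c1, continuous (Defs.right_trans u \o chart_inv e)}.
  by apply: continuous_comp; [exact: chart_inv_cont | exact: right_trans_cont].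
apply: Fc; rewrite /= chart_inv_center /Defs.right_trans mul1g.
exact/near_chart_dom/chart_dom_center.
Qed.

(** In the map (p, q) |-> p u q, the right-invariant field differentiates in p and the
    left-invariant one in q. The two terms of the bracket are the two mixed second derivatives. *)
Lemma bracket_right_left x y u :
  bracket (right_inv_field x : vfield G) (left_inv_field y) u = 0.
Proof.
have zu := chart_im_center u; set z0 := chart u u in zu.
apply/eqP; rewrite subr_eq0; apply/eqP/rowP => j.
pose V := ('rV[R]_n * 'rV[R]_n)%type.
pose F (p : V) : R := chart u (chart_inv e p.1 * u * chart_inv e p.2)%g 0 j.
pose H1 (z : V) : R := 'D_(x, 0) (mulc e u u) z 0 j.
pose H2 (z : V) : R := 'D_(0, y) (mulc u e u) z 0 j.
(* [g1] and [g2] are the two bracketings p (u q) and (p u) q, each of which reduces the triple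
   product to the multiplication in charts. *)
pose g1 (p : V) : V := (p.1, ltr_chart u p.2).
pose g2 (p : V) : V := (rtr_chart u p.1, p.2).
pose x0 : V := (c1, c1).
have g1x : g1 x0 = (c1, z0) by rewrite /g1 /= ltr_chart_center.
have g2x : g2 x0 = (z0, c1) by rewrite /g2 /= rtr_chart_center.
have dg1 : differentiable g1 x0.
  apply: differentiable_pair; first exact: differentiable_fst.
  apply: (@differentiable_comp _ _ _ _ (fun q : V => q.2) (ltr_chart u)).
    exact: differentiable_snd.
  exact: ltr_chart_diff.
have dg2 : differentiable g2 x0.
  apply: differentiable_pair; last exact: differentiable_snd.
  apply: (@differentiable_comp _ _ _ _ (fun q : V => q.1) (rtr_chart u)).
    exact: differentiable_fst.
  exact: rtr_chart_diff.
have m1 : mul_dom e u u (c1, z0) by exact: mul_dom_e_left.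
have m2 : mul_dom u e u (z0, c1) by exact: mul_dom_e_right.
have dH1 : differentiable H1 (c1, z0).
  apply: diff_coord; exact: smooth_on_diff (smooth_on_derive (x, 0) (@mulc_smooth _ _ _ e u u)) m1.
have dH2 : differentiable H2 (z0, c1).
  apply: diff_coord; exact: smooth_on_diff (smooth_on_derive (0, y) (@mulc_smooth _ _ _ u e u)) m2.
have near1 : \forall p \near x0, is_derive p (x, 0) F (H1 (g1 p)).
  have N1 : \forall p \near x0, mul_dom e u u (g1 p).
    apply: (differentiable_continuous dg1); rewrite g1x; exact: near_mul_dom.
  have N2 := differentiable_continuous (differentiable_snd x0) (near_ltr_chart u).
  apply: (filterS2 _ _ N1 N2) => p p1 [_ p2].
  apply: (@is_derive_eq_line _ _ _ _ _ (fun z => mulc e u u z 0 j : R^o) _ _ (g1 p) (x, 0)).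
    move=> h; rewrite /F /mulc /g1 /= !scaler0 !add0r /ltr_chart /= chartK //.
    by rewrite /Defs.left_trans mulgA.
  by apply: is_derive_coord; exact: smooth_on_diff (@mulc_smooth _ _ _ e u u) p1.
have near2 : \forall p \near x0, is_derive p (0, y) F (H2 (g2 p)).
  have N1 : \forall p \near x0, mul_dom u e u (g2 p).
    apply: (differentiable_continuous dg2); rewrite g2x; exact: near_mul_dom.
  have N2 := differentiable_continuous (differentiable_fst x0) (near_rtr_chart u).
  apply: (filterS2 _ _ N1 N2) => p p1 [_ p2].
  apply: (@is_derive_eq_line _ _ _ _ _ (fun z => mulc u e u z 0 j : R^o) _ _ (g2 p) (0, y)).
    move=> h; rewrite /F /mulc /g2 /= !scaler0 !add0r /rtr_chart /= chartK //.
  by apply: is_derive_coord; exact: smooth_on_diff (@mulc_smooth _ _ _ u e u) p1.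
have dF1 : differentiable (H1 \o g1) x0 by apply: differentiable_comp dg1 _; rewrite g1x.
have dF2 : differentiable (H2 \o g2) x0 by apply: differentiable_comp dg2 _; rewrite g2x.
have sR : smooth_vfield (right_inv_field x : vfield G) by exact: smooth_right.
have sL : smooth_vfield (left_inv_field y : vfield G) by exact: smooth_left.
have dR := smooth_on_diff (sR u) zu; have dL := smooth_on_diff (sL u) zu.
have := mixed_derivatives near1 dF1 near2 dF2.
(* On the slice where the first variable is the identity, the p-derivative is the right-invariant
   field read in the chart at [u]; the y-derivative then follows the left-invariant direction. *)
have -> : 'D_(0, y) (H1 \o g1) x0 =
    'D_(left_inv_field y u) (local_vfield u (right_inv_field x : vfield G)) z0 0 j.
  rewrite -[LHS]derive_pair_r -derive_ltr_chart -(derive_coord _ _ _ dR).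
  rewrite -[LHS]/('D_y ((fun z => H1 (c1, z)) \o ltr_chart u) c1).
  rewrite derive_comp; first 1 last.
  - exact: ltr_chart_diff.
  - rewrite ltr_chart_center; apply: (@differentiable_comp _ _ _ _ (fun z => (c1, z) : V) H1) => //.
  rewrite ltr_chart_center; apply: near_eq_derive.
  by near=> z; rewrite local_right //; near: z; exact: near_chart_im.
have -> : 'D_(x, 0) (H2 \o g2) x0 =
    'D_(right_inv_field x u) (local_vfield u (left_inv_field y : vfield G)) z0 0 j.
  rewrite -[LHS]derive_pair_l -derive_rtr_chart -(derive_coord _ _ _ dL).
  rewrite -[LHS]/('D_x ((fun z => H2 (z, c1)) \o rtr_chart u) c1).
  rewrite derive_comp; first 1 last.
  - exact: rtr_chart_diff.
  - rewrite rtr_chart_center; apply: (@differentiable_comp _ _ _ _ (fun z => (z, c1) : V) H2) => //.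
  rewrite rtr_chart_center; apply: near_eq_derive.
  by near=> z; rewrite local_left //; near: z; exact: near_chart_im.
by move=> H; rewrite -/z0; exact: (esym H).
Unshelve. all: by end_near. Qed.

End Brackets.

(** * The adjoint action *)

Section TensorPush.
Variables (R : realType).

Lemma tpush_zero n m (A : 'M[R]_(n, m)) : tpush A (fun=> 0) = (fun=> 0).
Proof. by apply/funext => w; rewrite /tpush big1 // => t _; rewrite mul0r. Qed.

Lemma tpush_lin n m (A : 'M[R]_(n, m)) (I : finType) (c : I -> R) (T : I -> tens R n) w :
  tpush A (fun w => \sum_i c i * T i w) w = \sum_i c i * tpush A (T i) w.
Proof.
rewrite /tpush; under eq_bigr do rewrite mulr_suml.
rewrite exchange_big; apply: eq_bigr => i _; rewrite mulr_sumr.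
by apply: eq_bigr => t _; rewrite mulrA.
Qed.

Lemma tpush_comp n m k (A : 'M[R]_(n, m)) (B : 'M[R]_(m, k)) (T : tens R n) :
  tpush (A *m B) T = tpush B (tpush A T).
Proof.
apply/funext => w; elim: w T => [|i w IH] T; first by rewrite !tpush_nil.
rewrite !tpush_cons.
have E j : tcontr j (tpush A T) = (fun w => \sum_a A a j * tpush A (tcontr a T) w).
  by apply/funext => w'; rewrite /tcontr tpush_cons.
under [RHS]eq_bigr do rewrite E tpush_lin mulr_sumr.
rewrite [RHS]exchange_big /=; apply: eq_bigr => a _; rewrite IH mxE mulr_suml.
by apply: eq_bigr => j _; ring.
Qed.

Lemma tpush1 n (T : tens R n) : tpush 1%:M T = T.
Proof.
apply/funext => w; elim: w T => [|i w IH] T; first by rewrite tpush_nil.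
rewrite tpush_cons (bigD1 i) //= IH mxE eqxx mul1r big1 ?addr0 // => j ji.
by rewrite mxE (negbTE ji) mul0r.
Qed.

End TensorPush.

(** * Derivatives of matrix-valued functions *)

Section MatrixCalculus.
Variables (R : realType) (V : normedModType R).
Implicit Types (x v : V).

(** Entrywise, so that matrix products, determinants and inverses reduce to scalar calculus. *)
Definition mxdiff m n (B : V -> 'M[R]_(m, n)) x :=
  forall i j, differentiable (fun z => B z i j : R^o) x.

Definition mxder m n v (B : V -> 'M[R]_(m, n)) x : 'M[R]_(m, n) :=
  \matrix_(i, j) 'D_v (fun z => B z i j : R^o) x.

Lemma diff_sum_fun (I : Type) (r : seq I) (f : I -> V -> R^o) x :
  (forall i, differentiable (f i) x) ->
  differentiable (fun z => \sum_(i <- r) f i z : R^o) x.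
Proof.
move=> df; elim: r => [|i r IH].
  have -> : (fun z => \sum_(i <- [::]) f i z) = (fun=> 0).
    by apply/funext => z; rewrite big_nil.
  exact: differentiable_cst.
have -> : (fun z => \sum_(j <- i :: r) f j z) = f i \+ (fun z => \sum_(j <- r) f j z).
  by apply/funext => z; rewrite big_cons.
by apply: differentiableD; [exact: df | exact: IH].
Qed.

Lemma derive_sum_fun n (f : 'I_n -> V -> R^o) x v : (forall i, differentiable (f i) x) ->
  'D_v (fun z => \sum_i f i z : R^o) x = \sum_i 'D_v (f i) x.
Proof.
move=> df; rewrite -derive_sum => [|i]; last exact: diff_derivable.
by congr ('D_v _ x); apply/funext => z; rewrite fct_sumE.
Qed.

Lemma diff_mul_fun (f g : V -> R^o) x : differentiable f x -> differentiable g x ->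
  differentiable (fun z => f z * g z : R^o) x.
Proof. exact: differentiableM. Qed.

Lemma derive_mul_fun (f g : V -> R^o) x v : differentiable f x -> differentiable g x ->
  'D_v (fun z => f z * g z : R^o) x = 'D_v f x * g x + f x * 'D_v g x.
Proof.
move=> df dg; transitivity (f x *: 'D_v g x + g x *: 'D_v f x).
  by apply: deriveM; exact: diff_derivable.
by rewrite addrC; congr (_ + _); exact: mulrC.
Qed.

Lemma mxdiffM m n k (A : V -> 'M[R]_(m, n)) (B : V -> 'M[R]_(n, k)) x :
  mxdiff A x -> mxdiff B x -> mxdiff (fun z => A z *m B z) x.
Proof.
move=> dA dB i j.
have -> : (fun z => (A z *m B z) i j) = (fun z => \sum_l A z i l * B z l j).
  by apply/funext => z; rewrite mxE.
by apply: diff_sum_fun => l; exact: diff_mul_fun.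
Qed.

Lemma mxderM m n k (A : V -> 'M[R]_(m, n)) (B : V -> 'M[R]_(n, k)) x v :
  mxdiff A x -> mxdiff B x ->
  mxder v (fun z => A z *m B z) x = mxder v A x *m B x + A x *m mxder v B x.
Proof.
move=> dA dB; apply/matrixP => i j; rewrite !mxE.
have -> : (fun z => (A z *m B z) i j) = (fun z => \sum_l A z i l * B z l j).
  by apply/funext => z; rewrite mxE.
rewrite derive_sum_fun => [|l]; last exact: diff_mul_fun.
rewrite -big_split /=; apply: eq_bigr => l _; rewrite !mxE.
exact: derive_mul_fun.
Qed.

Lemma mxdiff_cst m n (B : 'M[R]_(m, n)) x : mxdiff (fun=> B) x.
Proof. by move=> i j; exact: differentiable_cst. Qed.

Lemma mxder_cst m n (B : 'M[R]_(m, n)) x v : mxder v (fun=> B) x = 0.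
Proof. by apply/matrixP => i j; rewrite !mxE; exact: derive_cst. Qed.

Lemma mxderMr m n k (A : V -> 'M[R]_(m, n)) (B : 'M[R]_(n, k)) x v : mxdiff A x ->
  mxder v (fun z => A z *m B) x = mxder v A x *m B.
Proof.
move=> dA; rewrite (mxderM v dA (mxdiff_cst B x)).
by rewrite mxder_cst mulmx0 addr0.
Qed.

Lemma mxder_derive m n (B : V -> 'M[R]_(m, n)) x v : differentiable B x ->
  mxder v B x = 'D_v B x.
Proof. by move=> dB; apply/matrixP => i j; rewrite mxE derive_coord. Qed.

Lemma near_eq_mxdiff m n (A B : V -> 'M[R]_(m, n)) x : (\near x, A x = B x) ->
  mxdiff A x -> mxdiff B x.
Proof.
move=> AB dA i j; apply: near_eq_differentiable (dA i j).
by apply: filterS AB => z ->.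
Qed.

Lemma near_eq_mxder m n (A B : V -> 'M[R]_(m, n)) x v : (\near x, A x = B x) ->
  mxder v A x = mxder v B x.
Proof.
move=> AB; apply/matrixP => i j; rewrite !mxE; apply: near_eq_derive.
by apply: filterS AB => z ->.
Qed.

Lemma diff_prod_fun n (f : 'I_n -> V -> R^o) x : (forall i, differentiable (f i) x) ->
  differentiable (fun z => \prod_i f i z : R^o) x.
Proof.
elim: n f => [|n IH] f df.
  have -> : (fun z => \prod_i f i z) = (fun=> 1).
    by apply/funext => z; rewrite big_ord0.
  exact: differentiable_cst.
have -> : (fun z => \prod_i f i z) = (fun z => f ord0 z * \prod_i f (lift ord0 i) z).
  by apply/funext => z; rewrite big_ord_recl.
by apply: diff_mul_fun; [exact: df | apply: IH => i; exact: df].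
Qed.

Lemma derive_sum_zero (I : finType) (f : I -> V -> R^o) (c : I -> R) x v :
  (forall i, differentiable (f i) x) -> (forall i, 'D_v (f i) x = 0) ->
  'D_v (fun z => \sum_i f i z * c i : R^o) x = 0.
Proof.
move=> df f0.
suff H (r : seq I) : differentiable (fun z => \sum_(i <- r) f i z * c i : R^o) x /\
    'D_v (fun z => \sum_(i <- r) f i z * c i : R^o) x = 0 by exact: (H _).2.
elim: r => [|i r [dr r0]].
  have -> : (fun z => \sum_(i <- [::]) f i z * c i) = (fun=> 0).
    by apply/funext => z; rewrite big_nil.
  by split; [exact: differentiable_cst | exact: derive_cst].
have -> : (fun z => \sum_(j <- i :: r) f j z * c j) =
    (fun z => f i z * c i : R^o) \+ (fun z => \sum_(j <- r) f j z * c j : R^o).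
  by apply/funext => z; rewrite big_cons.
have dc : differentiable (fun z => f i z * c i : R^o) x.
  by apply: diff_mul_fun; [exact: df | exact: differentiable_cst].
split; first exact: differentiableD.
rewrite [LHS](deriveD (diff_derivable dc) (diff_derivable dr)) r0 addr0.
rewrite (derive_mul_fun v (df i) (differentiable_cst _ _)) f0 derive_cst.
by rewrite mul0r mulr0 addr0.
Qed.

Lemma diff_det n (B : V -> 'M[R]_n) x : mxdiff B x ->
  differentiable (fun z => \det (B z) : R^o) x.
Proof.
move=> dB; rewrite /determinant; apply: diff_sum_fun => s.
by apply: diff_mul_fun; [exact: differentiable_cst | apply: diff_prod_fun => i; exact: dB].
Qed.

Lemma mxdiff_invmx n (B : V -> 'M[R]_n) x : mxdiff B x ->
  (\forall z \near x, B z \in unitmx) -> mxdiff (fun z => invmx (B z)) x.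
Proof.
move=> dB uB; apply: (@near_eq_mxdiff _ _ (fun z => (\det (B z))^-1 *: \adj (B z))).
  by apply: filterS uB => z uz; rewrite /invmx uz.
move=> i j; have -> : (fun z => ((\det (B z))^-1 *: \adj (B z)) i j) =
    (fun z => (\det (B z))^-1 * cofactor (B z) j i).
  by apply/funext => z; rewrite !mxE.
apply: diff_mul_fun.
  apply: (differentiableV (f := fun z => \det (B z))); first exact: diff_det.
  by have := nbhs_singleton uB; rewrite unitmxE unitfE.
apply: diff_mul_fun; first exact: differentiable_cst.
apply: diff_det => k l.
have -> : (fun z => row' j (col' i (B z)) k l) = (fun z => B z (lift j k) (lift i l)).
  by apply/funext => z; rewrite !mxE.
exact: dB.
Qed.

Lemma tpush_diff m n (B : V -> 'M[R]_(m, n)) (T : tens R m) w x : mxdiff B x ->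
  differentiable (fun z => tpush (B z) T w : R^o) x.
Proof.
move=> dB; elim: w T => [|i w IH] T.
  have -> : (fun z => tpush (B z) T [::]) = (fun=> T [::]).
    by apply/funext => z; rewrite tpush_nil.
  exact: differentiable_cst.
have -> : (fun z => tpush (B z) T (i :: w)) =
    (fun z => \sum_j B z j i * tpush (B z) (tcontr j T) w).
  by apply/funext => z; rewrite tpush_cons.
by apply: diff_sum_fun => j; apply: diff_mul_fun; [exact: dB | exact: IH].
Qed.

Lemma tpush_der n (B : V -> 'M[R]_n) (T : tens R n) w x v : mxdiff B x -> B x = 1%:M ->
  'D_v (fun z => tpush (B z) T w : R^o) x = tder (mxder v B x) T w.
Proof.
move=> dB B1; elim: w T => [|i w IH] T.
  have -> : (fun z => tpush (B z) T [::]) = (fun=> T [::]).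
    by apply/funext => z; rewrite tpush_nil.
  exact: derive_cst.
have -> : (fun z => tpush (B z) T (i :: w)) =
    (fun z => \sum_j B z j i * tpush (B z) (tcontr j T) w).
  by apply/funext => z; rewrite tpush_cons.
rewrite derive_sum_fun => [|j]; last by apply: diff_mul_fun => //; exact: tpush_diff.
under eq_bigr => j _.
  rewrite derive_mul_fun //; last exact: tpush_diff.
  rewrite IH B1 tpush1; over.
rewrite big_split /=; congr (_ + _).
  by apply: eq_bigr => j _; rewrite mxE.
rewrite (bigD1 i) //= mxE eqxx mul1r big1 ?addr0 // => j ji.
by rewrite mxE (negbTE ji) mul0r.
Qed.

End MatrixCalculus.

Lemma mxder_comp (R : realType) (U V : normedModType R) m n (f : U -> V)
    (B : V -> 'M[R]_(m, n)) x v : differentiable f x -> mxdiff B (f x) ->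
  mxder v (B \o f) x = mxder ('D_v f x) B (f x).
Proof.
move=> df dB; apply/matrixP => i j; rewrite !mxE.
exact: (derive_comp (g := fun z => B z i j) v df (dB i j)).
Qed.

Lemma mulmx_coef_diff (R : realType) n (x : 'rV[R]_n) (DL DA DR A B : 'M[R]_n) :
  DL = DA *m B + A *m DR -> x *m DL - x *m A *m DR = x *m DA *m B.
Proof. by move=> ->; rewrite mulmxDr !mulmxA addrK. Qed.

(** * The derivative of Ad and Ad-invariance *)

Section AdjointAction.
Variables (R : realType) (n : nat) (G : lieGroupType R n).
Implicit Types (u v w a b : G) (x y : 'rV[R]_n).

Notation e := (1%g : G).
Notation c1 := (chart e e).

(** The frames of left- and right-invariant fields in the fixed chart [w]: unlike [Lmat] and [Rmat],
    these can be differentiated in [z]. The coordinate change cancels in their quotient, hence none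
    appears in [Adloc]. *)
Definition Lloc w z : 'M[R]_n := Lmat (chart_inv w z) *m coord_change w (chart_inv w z).
Definition Rloc w z : 'M[R]_n := Rmat (chart_inv w z) *m coord_change w (chart_inv w z).
Definition Adloc w z : 'M[R]_n := Ad (chart_inv w z).

Lemma mul_Lloc w z x : x *m Lloc w z = local_vfield w (left_inv_field x : vfield G) z.
Proof. by rewrite mulmxA. Qed.

Lemma mul_Rloc w z x : x *m Rloc w z = local_vfield w (right_inv_field x : vfield G) z.
Proof. by rewrite mulmxA. Qed.

Lemma local_left_diff w z x : (chart w @` chart_dom w) z ->
  differentiable (local_vfield w (left_inv_field x : vfield G)) z.
Proof.
have sL : smooth_vfield (left_inv_field x : vfield G) by exact: smooth_left.
exact: smooth_on_diff (sL w).
Qed.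

Lemma local_right_diff w z x : (chart w @` chart_dom w) z ->
  differentiable (local_vfield w (right_inv_field x : vfield G)) z.
Proof.
have sR : smooth_vfield (right_inv_field x : vfield G) by exact: smooth_right.
exact: smooth_on_diff (sR w).
Qed.

Lemma Lloc_diff w z : (chart w @` chart_dom w) z -> mxdiff (Lloc w) z.
Proof.
move=> wz i j; have := diff_coord 0 j (local_left_diff (delta_mx 0 i) wz).
congr (differentiable _ _); apply/funext => q.
by rewrite -mul_Lloc -rowE mxE.
Qed.

Lemma Rloc_diff w z : (chart w @` chart_dom w) z -> mxdiff (Rloc w) z.
Proof.
move=> wz i j; have := diff_coord 0 j (local_right_diff (delta_mx 0 i) wz).
congr (differentiable _ _); apply/funext => q.
by rewrite -mul_Rloc -rowE mxE.
Qed.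

Lemma Rloc_center w : Rloc w (chart w w) = Rmat w.
Proof. by rewrite /Rloc chart_inv_center coord_change_id mulmx1. Qed.

Lemma Adloc_center w : Adloc w (chart w w) = Ad w.
Proof. by rewrite /Adloc chart_inv_center. Qed.

Lemma Adloc_Rloc w z : Adloc w z *m Rloc w z = Lloc w z.
Proof. by rewrite /Adloc /Rloc /Lloc mulmxA AdK. Qed.

Lemma Rloc_unit w z : (chart w @` chart_dom w) z -> Rloc w z \in unitmx.
Proof.
move=> wz; rewrite /Rloc unitmx_mul; apply/andP; split; first exact: Rmat_unit.
exact/coord_change_unit/chart_inv_dom.
Qed.

Lemma Adloc_diff w z : (chart w @` chart_dom w) z -> mxdiff (Adloc w) z.
Proof.
move=> wz; apply: (@near_eq_mxdiff _ _ _ _ (fun z => Lloc w z *m invmx (Rloc w z))).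
  apply: filterS (near_chart_im wz) => q wq.
  by rewrite -Adloc_Rloc; exact: (mulmxK (Rloc_unit wq)).
apply: mxdiffM; first exact: Lloc_diff.
apply: mxdiff_invmx; first exact: Rloc_diff.
by apply: filterS (near_chart_im wz) => q; exact: Rloc_unit.
Qed.

Lemma mul_mxder_Lloc u x (v : 'rV[R]_n) : x *m mxder v (Lloc u) (chart u u) =
  'D_v (local_vfield u (left_inv_field x : vfield G)) (chart u u).
Proof.
have zu := chart_im_center u.
rewrite -(mxder_derive _ (local_left_diff x zu)).
have -> : local_vfield u (left_inv_field x : vfield G) = (fun z => x *m Lloc u z).
  by apply/funext => z; rewrite mul_Lloc.
rewrite (@mxderM _ _ _ _ _ (fun=> x) (Lloc u)); [|exact: mxdiff_cst|exact: Lloc_diff].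
by rewrite mxder_cst mul0mx add0r.
Qed.

Lemma mul_mxder_Rloc u x (v : 'rV[R]_n) : x *m mxder v (Rloc u) (chart u u) =
  'D_v (local_vfield u (right_inv_field x : vfield G)) (chart u u).
Proof.
have zu := chart_im_center u.
rewrite -(mxder_derive _ (local_right_diff x zu)).
have -> : local_vfield u (right_inv_field x : vfield G) = (fun z => x *m Rloc u z).
  by apply/funext => z; rewrite mul_Rloc.
rewrite (@mxderM _ _ _ _ _ (fun=> x) (Rloc u)); [|exact: mxdiff_cst|exact: Rloc_diff].
by rewrite mxder_cst mul0mx add0r.
Qed.

(* Since [y_L] commutes with right-invariant fields, [y_L, x_L] is obtained by
   differentiating only the coefficients of [x_L] in the right-invariant frame. *)
Lemma bracket_left_left x y u :
  bracket (left_inv_field y : vfield G) (left_inv_field x) u =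
  x *m mxder (left_inv_field y u) (Adloc u) (chart u u) *m Rmat u.
Proof.
have zu := chart_im_center u; set v := left_inv_field y u.
have RL : right_inv_field (x *m Ad u) u = left_inv_field x u.
  by rewrite right_inv_fieldE left_inv_fieldE -mulmxA AdK.
have E : 'D_(left_inv_field x u) (local_vfield u (left_inv_field y : vfield G)) (chart u u) =
    'D_v (local_vfield u (right_inv_field (x *m Ad u) : vfield G)) (chart u u).
  apply/eqP; rewrite -subr_eq0; apply/eqP; rewrite -RL.
  exact: (bracket_right_left (x *m Ad u) y u).
transitivity (x *m mxder v (Lloc u) (chart u u) -
    (x *m Ad u) *m mxder v (Rloc u) (chart u u)).
  congr (_ - _); first exact: (esym (mul_mxder_Lloc u x v)).
  exact: (etrans E (esym (mul_mxder_Rloc u (x *m Ad u) v))).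
apply: mulmx_coef_diff.
have LE : Lloc u = (fun z => Adloc u z *m Rloc u z).
  by apply/funext => z; rewrite Adloc_Rloc.
have AR := mxderM v (Adloc_diff zu) (Rloc_diff zu).
rewrite Rloc_center Adloc_center in AR.
by rewrite -AR LE.
Qed.

(** Taken as a derivative of [Ad], the form in which [tpush_der] uses it. That it is the matrix of
    [y, .] is [lie_bracketE], which rests on the commutation of left- and right-invariant fields. *)
Definition adm y : 'M[R]_n := mxder y (Adloc e) c1.

Lemma left_inv_field1 x : left_inv_field x e = x.
Proof. by rewrite left_inv_fieldE Lmat1 mulmx1. Qed.

Lemma lie_bracketE x y : lie_bracket G y x = x *m adm y.
Proof. by rewrite /lie_bracket bracket_left_left left_inv_field1 Rmat1 mulmx1. Qed.

Lemma near_Adloc u : \forall q \near c1, Adloc u (ltr_chart u q) = Adloc e q *m Ad u.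
Proof.
apply: filterS (near_ltr_chart u) => q [_ uq].
by rewrite /Adloc /ltr_chart /= chartK // AdM.
Qed.

(** Since Ad(u q) is Ad(q) followed by Ad(u) and the second factor is constant in q, the derivative
    at [u] is carried back to the identity. *)
Lemma mxder_Adloc u y :
  mxder (left_inv_field y u) (Adloc u) (chart u u) = adm y *m Ad u.
Proof.
have := mxder_comp (f := ltr_chart u) (B := Adloc u) y (ltr_chart_diff u).
rewrite ltr_chart_center derive_ltr_chart => <-; last exact/Adloc_diff/chart_im_center.
apply: (etrans (near_eq_mxder y (near_Adloc u))).
exact: mxderMr (Adloc_diff (chart_im_center e)).
Qed.

Lemma bracket_left_inv x y u :
  bracket (left_inv_field y : vfield G) (left_inv_field x) u =
  left_inv_field (lie_bracket G y x) u.
Proof.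
rewrite bracket_left_left mxder_Adloc left_inv_fieldE lie_bracketE.
by rewrite mulmxA -[LHS]mulmxA AdK.
Qed.

Section Invariance.
Variables (T : tens R n) (w : seq 'I_n).
Hypothesis T_inv : forall y, tder (adm y) T = (fun=> 0).

Let f u : R^o := tpush (Ad u) T w.

Let f_diff u : differentiable (f \o chart_inv u) (chart u u).
Proof. exact: (tpush_diff T w (Adloc_diff (chart_im_center u))). Qed.

(** Near [u], the tensor Ad(u q) T is the image under the fixed Ad(u) of Ad(q) T, whose derivative
    at q = 1 is the action of ad y on T, that is, zero. *)
Let f_left u y : 'D_(left_inv_field y u) (f \o chart_inv u) (chart u u) = 0.
Proof.
have du : differentiable (f \o chart_inv u) (ltr_chart u c1).
  by rewrite ltr_chart_center; exact: f_diff.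
have := derive_comp y (ltr_chart_diff u) du.
rewrite derive_ltr_chart ltr_chart_center => <-.
have dA : mxdiff (Adloc e) c1 by exact/Adloc_diff/chart_im_center.
(* The outer [tpush] is unfolded into a linear combination with coefficients constant in [q], so
   that only the inner components are differentiated. *)
pose h q : R^o := \sum_(t : (size w).-tuple 'I_n)
  tpush (Adloc e q) T t * \prod_(k < size w) Ad u (tnth t k) (tnth (in_tuple w) k).
transitivity ('D_y h c1).
  apply: near_eq_derive; apply: filterS (near_Adloc u) => q E.
  rewrite /h -[RHS]/(tpush (Ad u) (tpush (Adloc e q) T) w) -tpush_comp -E.
  by rewrite /f /Adloc.
rewrite /h; apply: derive_sum_zero => t; first exact: tpush_diff.
rewrite (tpush_der _ _ _ dA); last by rewrite Adloc_center Ad1.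
by rewrite -/(adm y) T_inv.
Qed.

Let f_center u (v : 'rV[R]_n) : 'D_v (f \o chart_inv u) (chart u u) = 0.
Proof.
have -> : v = left_inv_field (v *m invmx (Lmat u)) u.
  by rewrite left_inv_fieldE; exact: (esym (mulmxKV (Lmat_unit u) v)).
exact: f_left.
Qed.

(** [f_center] gives derivatives only at the centre of each point's own chart. To integrate over a
    ball of the chart at [u], every point of the ball is passed to its own chart by a transition
    map, which preserves a zero derivative. *)
Let f_near u : \forall q \near u, f q = f u.
Proof.
have zu := chart_im_center u.
have /nbhs_ballP[r /= r0 ru] := near_chart_im zu.
have f0 z : ball (chart u u) r z -> differentiable (f \o chart_inv u) z /\
    forall v : 'rV[R]_n, 'D_v (f \o chart_inv u) z = 0.
  move=> /ru uz; set q := chart_inv u z.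
  have uq : chart_dom u q := chart_inv_dom uz.
  have qq := chart_dom_center q.
  have Fc := chart_inv_cont uz.
  have tr : differentiable (chart q \o chart_inv u) z.
    by rewrite -(chart_invK uz); exact: transition_diff.
  have fE : {near z, (f \o chart_inv q) \o (chart q \o chart_inv u) =1 f \o chart_inv u}.
    near=> z' => /=; rewrite chartK //; near: z'; apply: Fc.
    exact: near_chart_dom.
  split; first exact: near_eq_differentiable fE (differentiable_comp tr (f_diff q)).
  move=> v; rewrite -(near_eq_derive v fE) (derive_comp v tr (f_diff q)).
  exact: f_center.
have N : \forall q \near u, ball (chart u u) r (chart u q).
  have := @chart_continuous _ _ G u u (chart_dom_center u).
  by apply; exact: nbhsx_ballx.
apply: filterS2 (near_chart_dom (chart_dom_center u)) N => q uq rq.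
have E := zero_derivative_ball f0 rq.
have e1 : f (chart_inv u (chart u q)) = f q := congr1 f (chartK _ _ uq).
have e2 : f (chart_inv u (chart u u)) = f u := congr1 f (chart_inv_center u).
rewrite -e1 -e2; exact: E.
Unshelve. all: by end_near. Qed.

(** The component is a locally constant function of [u], so its level set through 1 is open and
    closed; at 1 the adjoint action is the identity. *)
Lemma tpush_Ad_inv u : connected [set: G] -> tpush (Ad u) T w = T w.
Proof.
move=> conn.
have op (A : set R) : open [set q | A (f q)].
  rewrite openE => q Aq; apply: filterS (f_near q) => q' fq'.
  by rewrite /= fq'.
have E : [set q | f q = f e] = [set: G].
  apply: conn; first by exists e.
    exists [set q | f q = f e]; last by rewrite setTI.
    exact: (op [set c | c = f e]).
  exists [set q | f q = f e]; last by rewrite setTI.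
  rewrite -openC; exact: (op [set c | c <> f e]).
have : [set q | f q = f e] u by rewrite E.
by rewrite /= /f Ad1 tpush1.
Qed.

End Invariance.

End AdjointAction.

(** * The Levi-Civita connection *)

Section TensorProducts.
Variables (R : realType) (n : nat).
Implicit Types (S T : tens R n).

Lemma tmul_nil S T : tmul S T [::] = S [::] * T [::].
Proof. by rewrite /tmul big_ord1. Qed.

Lemma tmul_cons S T i w :
  tmul S T (i :: w) = S [::] * T (i :: w) + tmul (tcontr i S) T w.
Proof. by rewrite /tmul /= big_ord_recl. Qed.

Lemma tmul_suml (I : finType) (c : I -> R) (S : I -> tens R n) T w :
  tmul (fun w => \sum_i c i * S i w) T w = \sum_i c i * tmul (S i) T w.
Proof.
rewrite /tmul; under eq_bigr do rewrite mulr_suml.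
rewrite exchange_big /=; apply: eq_bigr => i _; rewrite mulr_sumr.
by apply: eq_bigr => k _; rewrite mulrA.
Qed.

End TensorProducts.

Section TensorProductPush.
Variables (R : realType) (n : nat).
Implicit Types (S T : tens R n).

Lemma tpushD m (A : 'M[R]_(n, m)) S T w :
  tpush A (fun w => S w + T w) w = tpush A S w + tpush A T w.
Proof. by rewrite /tpush -big_split /=; apply: eq_bigr => t _; rewrite mulrDl. Qed.

Lemma tpushZ m (A : 'M[R]_(n, m)) c T w :
  tpush A (fun w => c * T w) w = c * tpush A T w.
Proof. by rewrite /tpush mulr_sumr; apply: eq_bigr => t _; rewrite mulrA. Qed.

Lemma tpush_tmul m (A : 'M[R]_(n, m)) S T :
  tpush A (tmul S T) = tmul (tpush A S) (tpush A T).
Proof.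
apply/funext => w; elim: w S T => [|u w IH] S T.
  by rewrite tpush_nil !tmul_nil !tpush_nil.
rewrite tpush_cons tmul_cons tpush_nil tpush_cons mulr_sumr.
have E : tcontr u (tpush A S) = (fun w => \sum_i A i u * tpush A (tcontr i S) w).
  by apply/funext => w'; rewrite /tcontr tpush_cons.
rewrite E tmul_suml -big_split /=; apply: eq_bigr => i _.
have -> : tcontr i (tmul S T) = (fun w => S [::] * tcontr i T w + tmul (tcontr i S) T w).
  by apply/funext => w'; rewrite /tcontr tmul_cons.
by rewrite tpushD tpushZ IH mulrDr mulrCA.
Qed.

Lemma tpush_scal m (A : 'M[R]_(n, m)) c : tpush A (tscal c) = tscal c.
Proof.
apply/funext => -[|u w]; first by rewrite tpush_nil.
rewrite tpush_cons big1 //= => i _.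
by rewrite (_ : tcontr i (tscal c) = fun=> 0) // tpush_zero mulr0.
Qed.

Lemma tpush_vec m (A : 'M[R]_(n, m)) v : tpush A (tvec v) = tvec (v *m A).
Proof.
apply/funext => -[|u w]; first by rewrite tpush_nil.
have E i : tcontr i (tvec v) = tscal (v 0 i) by apply/funext => -[|j w'].
rewrite tpush_cons; under eq_bigr do rewrite E tpush_scal.
case: w => [|j w] /=; last by rewrite big1 // => i _; rewrite mulr0.
by rewrite mxE; apply: eq_bigr => i _; rewrite mulrC.
Qed.

Lemma tvec_sym (v : 'rV[R]_n) : symmetric_tens (tvec v).
Proof.
move=> w w' ww'; have := perm_size ww'.
case: w w' ww' => [|i [|j w]] [|k [|l w']] //= /perm_consP.
move=> [[|[|a]] [u [/= + /perm_nilP]]] //; rewrite ?rot0 => + uE; rewrite uE => -[] // -> //.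
Qed.

End TensorProductPush.

Section SymmetricProducts.
Variables (R : realType) (n : nat).
Implicit Types (S T : tens R n).

Lemma tscal_sym c : symmetric_tens (tscal c : tens R n).
Proof.
move=> w w' ww'; have := perm_size ww'.
by case: w w' ww' => [|i w] [|j w'].
Qed.

Lemma tcontr_vec i (v : 'rV[R]_n) : tcontr i (tvec v) = tscal (v 0 i).
Proof. by apply/funext => -[|j w]. Qed.

Lemma tcontr_scal i (c : R) : tcontr i (tscal c : tens R n) = (fun=> 0).
Proof. by apply/funext => w. Qed.

Lemma sprod0l T : sprod (fun=> 0) T = (fun=> 0).
Proof.
apply/funext => w; rewrite /sprod big1 // => k _.
by rewrite big1 ?mulr0 // => s _; rewrite mul0r.
Qed.

Lemma sprod0r S : sprod S (fun=> 0) = (fun=> 0).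
Proof.
apply/funext => w; rewrite /sprod big1 // => k _.
by rewrite big1 ?mulr0 // => s _; rewrite mulr0.
Qed.

Lemma sprod_scall c T w : symmetric_tens T -> sprod (tscal c) T w = c * T w.
Proof.
elim: w T => [|i w IH] T sT; first by rewrite sprod_nil.
rewrite sprod_cons // ?tcontr_scal ?sprod0l ?add0r; last exact: tscal_sym.
by rewrite IH //; exact: tcontr_sym.
Qed.

Lemma sprod_scalr c T w : symmetric_tens T -> sprod T (tscal c) w = T w * c.
Proof.
elim: w T => [|i w IH] T sT; first by rewrite sprod_nil.
rewrite sprod_cons // ?tcontr_scal ?sprod0r ?addr0; last exact: tscal_sym.
by rewrite IH //; exact: tcontr_sym.
Qed.

Lemma sprod_vec (x y : 'rV[R]_n) w : sprod (tvec x) (tvec y) w =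
  if w is [:: i; j] then x 0 i * y 0 j + x 0 j * y 0 i else 0.
Proof.
case: w => [|i w]; first by rewrite sprod_nil /= mulr0.
rewrite sprod_cons; [|exact: tvec_sym..].
rewrite !tcontr_vec sprod_scall ?sprod_scalr; [|exact: tvec_sym..].
case: w => [|j [|k w]] /=; rewrite ?mulr0 ?mul0r ?addr0 //.
Qed.

End SymmetricProducts.

(** * Smooth tensor fields and rules for the connection *)

Section SmoothTensors.
Variables (R : realType) (n : nat) (M : manifoldType R n).
Implicit Types (K L : tfield M) (X : vfield M).

Lemma smooth_tfield_tscal (c : R) : smooth_tfield ((fun=> tscal c) : tfield M).
Proof.
move=> u w; have -> : (fun z => local_tfield u ((fun=> tscal c) : tfield M) z w) =
    (fun=> tscal c w : R^o).
  by apply/funext => z; rewrite /local_tfield tpush_scal.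
exact: smooth_on_cst.
Qed.

Lemma smooth_fun_cst (c : R) : smooth_fun ((fun=> c) : M -> R).
Proof. by move=> u; exact: smooth_on_cst. Qed.

Lemma smooth_tvfield X : smooth_vfield X -> smooth_tfield (tvfield X).
Proof.
move=> sX u w; have E z : local_tfield u (tvfield X) z w = tvec (local_vfield u X z) w.
  by rewrite /local_tfield /tvfield tpush_vec.
have -> : (fun z => local_tfield u (tvfield X) z w) =
    (fun z => tvec (local_vfield u X z) w) by apply/funext => z; rewrite E.
case: w {E} => [|i [|j w]]; rewrite /tvec; [exact: smooth_on_cst | | exact: smooth_on_cst].
exact: smooth_on_coord (chart_im_open u) (sX u).
Qed.

Lemma smooth_tfieldD K L : smooth_tfield K -> smooth_tfield L ->
  smooth_tfield (fun u => K u + L u).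
Proof.
move=> sK sL u w; have -> : (fun z => local_tfield u (fun u => K u + L u) z w) =
    (fun z => local_tfield u K z w : R^o) \+ (fun z => local_tfield u L z w : R^o).
  by apply/funext => z; exact: tpushD.
exact: smooth_on_add (chart_im_open u) (sK u w) (sL u w).
Qed.

Lemma smooth_tmul K L : smooth_tfield K -> smooth_tfield L ->
  smooth_tfield (fun u => tmul (K u) (L u)).
Proof.
move=> sK sL u w.
have E z : local_tfield u (fun u => tmul (K u) (L u)) z =
    tmul (local_tfield u K z) (local_tfield u L z) by exact: tpush_tmul.
have -> : (fun z => local_tfield u (fun u => tmul (K u) (L u)) z w) =
    (fun z => \sum_(k < (size w).+1) ((fun z => local_tfield u K z (take k w) : R^o) \*
      (fun z => local_tfield u L z (drop k w) : R^o)) z : R^o).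
  by apply/funext => z; rewrite E.
apply: smooth_on_sum (chart_im_open u) _ => k.
exact: smooth_on_mul (chart_im_open u) (sK u _) (sL u _).
Qed.

Lemma smooth_tfield_sum (I : Type) (r : seq I) (K : I -> tfield M) :
  (forall i, smooth_tfield (K i)) -> smooth_tfield (fun u => \sum_(i <- r) K i u).
Proof.
move=> sK; elim: r => [|i r IH].
  have -> : (fun u => \sum_(i <- [::]) K i u) = (fun=> tscal 0) :> tfield M.
    by apply/funext => u; rewrite big_nil; apply/funext => -[|j w].
  exact: smooth_tfield_tscal.
have -> : (fun u => \sum_(j <- i :: r) K j u) = (fun u => K i u + \sum_(j <- r) K j u).
  by apply/funext => u; rewrite big_cons.
exact: smooth_tfieldD.
Qed.

End SmoothTensors.

Section LeviCivitaRules.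
Variables (R : realType) (n : nat) (M : manifoldType R n) (g : M -> 'M[R]_n).
Variables (nabla : connection M) (hnabla : levi_civita g nabla).
Implicit Types (K L : tfield M) (X : vfield M).

Lemma nabla_tscal (c : R) u v : nabla u v ((fun=> tscal c) : tfield M) = (fun=> 0).
Proof.
have -> := lc_function hnabla (@smooth_fun_cst _ _ M c) u v.
rewrite /differential (_ : 'D_v _ _ = 0); last exact: derive_cst.
by apply/funext => -[|i w].
Qed.

Lemma nabla_sum (I : Type) (r : seq I) (K : I -> tfield M) u v :
  (forall i, smooth_tfield (K i)) ->
  nabla u v (fun u => \sum_(i <- r) K i u) = \sum_(i <- r) nabla u v (K i).
Proof.
move=> sK; elim: r => [|i r IH].
  (* The zero field is the constant function 0 seen in degree 0, which [lc_function]
     differentiates. *)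
  have -> : (fun u => \sum_(i <- [::]) K i u) = (fun=> tscal 0) :> tfield M.
    by apply/funext => q; rewrite big_nil; apply/funext => -[|j w].
  by rewrite nabla_tscal big_nil.
have -> : (fun u => \sum_(j <- i :: r) K j u) = (fun u => K i u + \sum_(j <- r) K j u).
  by apply/funext => q; rewrite big_cons.
rewrite (lc_additive hnabla) ?IH ?big_cons //; exact: smooth_tfield_sum.
Qed.

Lemma nabla_vec X u v : smooth_vfield X ->
  nabla u v (tvfield X) = tvec (vec_part (nabla u v (tvfield X))).
Proof.
move=> sX; have hom : homogeneous 1 (nabla u v (tvfield X)).
  apply: (lc_degree hnabla); first exact: smooth_tvfield.
  by move=> q [|i [|j w]].
by apply/funext => -[|i [|j w]]; rewrite /= ?mxE // hom.
Qed.

End LeviCivitaRules.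

(** * Metrics and orthonormal bases *)

Section Gform.
Variables (R : realType) (n : nat).
Implicit Types (g : 'M[R]_n) (x y : 'rV[R]_n).

Lemma gformDl g x x' y : gform g (x + x') y = gform g x y + gform g x' y.
Proof. by rewrite /gform !mulmxDl mxE. Qed.

Lemma gformDr g x y y' : gform g x (y + y') = gform g x y + gform g x y'.
Proof. by rewrite /gform linearD mulmxDr mxE. Qed.

Lemma gformZl g c x y : gform g (c *: x) y = c * gform g x y.
Proof. by rewrite /gform -!scalemxAl mxE. Qed.

Lemma gformZr g c x y : gform g x (c *: y) = c * gform g x y.
Proof. by rewrite /gform linearZ -scalemxAr mxE. Qed.

Lemma gform0l g y : gform g 0 y = 0.
Proof. by rewrite /gform !mul0mx mxE. Qed.

Lemma gform_sym g x y : g^T = g -> gform g x y = gform g y x.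
Proof.
move=> gT; rewrite /gform -[in LHS](trmxK (x *m g *m y^T)) mxE.
by rewrite !trmx_mul trmxK gT mulmxA.
Qed.

Lemma orthonormal_mx g (e : 'I_n -> 'rV[R]_n) : Defs.orthonormal g e ->
  (\matrix_i e i) *m g *m (\matrix_i e i)^T = 1%:M.
Proof.
move=> eo; apply/matrixP => i j; rewrite [RHS]mxE -eo /gform.
rewrite -[in RHS](rowK e i) -[in RHS](rowK e j) -row_mul.
by rewrite [RHS]mxE [LHS]mxE; apply: eq_bigr => k _; rewrite !mxE.
Qed.

(* So [E^T *m E] is the inverse metric, whichever orthonormal basis is used. *)
Lemma orthonormal_inv g (e : 'I_n -> 'rV[R]_n) : Defs.orthonormal g e ->
  (\matrix_i e i)^T *m (\matrix_i e i) *m g = 1%:M.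
Proof. by move/orthonormal_mx/mulmx1C; rewrite mulmxA. Qed.

Lemma sum_outer m (e f : 'I_m -> 'rV[R]_n) i j :
  \sum_k e k 0 i * f k 0 j = ((\matrix_k e k)^T *m (\matrix_k f k)) i j.
Proof. by rewrite mxE; apply: eq_bigr => k _; rewrite !mxE. Qed.

(** With [E] the matrix of the basis, the components of the sum are those of [E^T *m E *m N] plus
    its transpose. As [E^T *m E] is the inverse of [g], this vanishes exactly when [N] is skew for
    [g]. *)
Lemma skew_endo_killing g (e : 'I_n -> 'rV[R]_n) (N : 'M[R]_n) : g^T = g ->
  Defs.orthonormal g e -> (forall x, gform g (x *m N) x = 0) ->
  \sum_k sprod (tvec (e k)) (tvec (e k *m N)) = 0.
Proof.
move=> gT eo Nskew; set E := \matrix_k e k.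
have gi := orthonormal_inv eo; rewrite -/E in gi.
have [Eg gu] := mulmx1_unit gi.
(* Polarization of the quadratic hypothesis. *)
have Nsk x y : gform g (x *m N) y + gform g x (y *m N) = 0.
  rewrite [X in _ + X]gform_sym //; have := Nskew (x + y).
  by rewrite mulmxDl gformDl !gformDr !Nskew add0r addr0.
have NS : N *m g + g *m N^T = 0.
  apply/matrixP => i j; have := Nsk (delta_mx 0 i) (delta_mx 0 j).
  rewrite /gform trmx_mul !mulmxA -[_ *m N *m g]mulmxA -[_ *m g *m N^T]mulmxA.
  by rewrite -!rowE trmx_delta -!colE !mxE.
have S0 : E^T *m E *m N + (E^T *m E *m N)^T = 0.
  apply: (can_inj (mulmxK gu)); rewrite mul0mx mulmxDl.
  apply: (can_inj (mulKmx gu)); rewrite mulmx0 mulmxDr.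
  have gE : g *m (E^T *m E) = 1%:M by exact: mulmx1C.
  rewrite !trmx_mul trmxK !mulmxA -[g *m E^T *m E]mulmxA gE mul1mx.
  by rewrite -[_ *m E^T *m E *m g]mulmxA -[_ *m E^T *m (E *m g)]mulmxA [E^T *m _]mulmxA gi mulmx1.
apply/funext => w; rewrite fct_sumE; under eq_bigr do rewrite sprod_vec.
case: w => [|i [|j [|k w]]]; try by rewrite big1.
rewrite big_split /= (sum_outer e (fun k => e k *m N)) (sum_outer e (fun k => e k *m N) j i).
have -> : \matrix_k (e k *m N) = E *m N by apply/row_matrixP => k; rewrite rowK row_mul rowK.
have := congr1 (fun A : 'M[R]_n => A i j) S0; rewrite mxE [X in _ + X]mxE [RHS]mxE.
by rewrite -mulmxA.
Qed.

End Gform.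

(** * Left-invariant tensors and invariant Killing fields *)

Section LeftInvariantTensors.
Variables (R : realType) (n : nat) (G : lieGroupType R n) (g : G -> 'M[R]_n).
Variables (nabla : connection G).
Hypothesis hnabla : levi_civita g nabla.
Implicit Types (T : tens R n) (x y v : 'rV[R]_n).

Notation e := (1%g : G).

(* The connection on left-invariant fields: [nabla_v x = x *m Gam v] at the identity. *)
Definition Gam (v : 'rV[R]_n) : 'M[R]_n :=
  \matrix_i vec_part (nabla e v (tvfield (left_inv_field (delta_mx 0 i)))).

Lemma tder_zero (C : 'M[R]_n) : tder C (fun=> 0) = (fun=> 0).
Proof.
apply/funext => w; elim: w => //= i w IH.
by rewrite -[X in tder C X]/(fun=> 0) IH addr0 big1 // => j _; rewrite mulr0.
Qed.

Lemma tder_scal (C : 'M[R]_n) c : tder C (tscal c) = (fun=> 0).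
Proof.
apply/funext => -[|i w] //=.
by rewrite tcontr_scal tder_zero addr0 big1 // => j _; rewrite mulr0.
Qed.

Lemma tpush_decomp m (A : 'M[R]_(n, m)) T : T [::] = 0 ->
  tpush A T = \sum_i tmul (tvec (delta_mx 0 i *m A)) (tpush A (tcontr i T)).
Proof.
move=> T0; apply/funext => w; rewrite fct_sumE; case: w => [|u w].
  by rewrite tpush_nil T0 big1 // => i _; rewrite tmul_vec_nil.
rewrite tpush_cons; apply: eq_bigr => i _.
by rewrite tmul_vec_cons -rowE mxE.
Qed.

(** The axioms reach higher degrees only through [tmul], so the first tensor factor is split off as
    a left-invariant vector field and the Leibniz rule is applied by induction on the degree.
    Smoothness is proved along with the formula because the Leibniz axiom asks it of both
    factors. *)
Lemma nabla_left_inv p T v : homogeneous p T ->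
  smooth_tfield ((fun u => tpush (Lmat u) T) : tfield G) /\
  nabla e v (fun u => tpush (Lmat u) T) = tder (Gam v) T.
Proof.
elim: p T => [|p IH] T hT.
  have -> : T = tscal (T [::]) by apply/funext => -[|i w] //; rewrite hT.
  have -> : (fun u : G => tpush (Lmat u) (tscal (T [::]))) = (fun=> tscal (T [::])).
    by apply/funext => u; rewrite tpush_scal.
  rewrite tder_scal; split; first exact: smooth_tfield_tscal.
  exact: (nabla_tscal hnabla).
pose X i : vfield G := left_inv_field (delta_mx 0 i).
pose L i : tfield G := fun u => tpush (Lmat u) (tcontr i T).
have hc i : homogeneous p (tcontr i T) by move=> w wp; apply: hT.
have sL i : smooth_tfield (L i) by case: (IH _ (hc i)).
have nL i : nabla e v (L i) = tder (Gam v) (tcontr i T) by case: (IH _ (hc i)).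
have sX i : smooth_vfield (X i) by exact: smooth_left.
have KE : (fun u => tpush (Lmat u) T) = (fun u => \sum_i tmul (tvfield (X i) u) (L i u)).
  by apply/funext => u; rewrite tpush_decomp // hT.
have sXL i : smooth_tfield (fun u => tmul (tvfield (X i) u) (L i u)).
  exact: smooth_tmul (smooth_tvfield (sX i)) (sL i).
rewrite KE; split; first exact: smooth_tfield_sum.
rewrite (nabla_sum hnabla) //; apply/funext => w; rewrite fct_sumE.
under eq_bigr => i _.
  rewrite (lc_leibniz hnabla (smooth_tvfield (sX i)) (sL i)) nL.
  rewrite (nabla_vec hnabla _ _ (sX i)) /L Lmat1 tpush1.
  rewrite /tvfield /X left_inv_field1; over.
case: w => [|j w].
  by rewrite /= big1 // => i _; rewrite fctE /= !tmul_vec_nil addr0.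
transitivity (\sum_i (Gam v i j * T (i :: w) +
    (delta_mx 0 i : 'rV[R]_n) 0 j * tder (Gam v) (tcontr i T) w)).
  by apply: eq_bigr => i _; rewrite fctE /= !tmul_vec_cons [Gam v i j]mxE.
rewrite big_split /=; congr (_ + _).
rewrite (bigD1 j) //= mxE !eqxx mul1r big1 ?addr0 // => i ij.
by rewrite mxE eqxx /= eq_sym (negbTE ij) mul0r.
Qed.

Lemma nabla_left_field x v :
  nabla e v (tvfield (left_inv_field x)) = tvec (x *m Gam v).
Proof.
have h : homogeneous 1 (tvec x) by move=> [|i [|j w]].
have [_] := nabla_left_inv v h.
have -> : (fun u : G => tpush (Lmat u) (tvec x)) = tvfield (left_inv_field x).
  by apply/funext => u; rewrite tpush_vec.
move=> ->; apply/funext => -[|i [|j w]] //=.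
- by rewrite addr0 mxE; apply: eq_bigr => j _; rewrite mulrC.
- rewrite tcontr_vec /= tcontr_scal tder_zero addr0 !big1 ?addr0 // => k _; exact: mulr0.
Qed.

Lemma Gam_torsion x y : y *m Gam x - x *m Gam y = lie_bracket G x y.
Proof.
have sx : smooth_vfield (left_inv_field x : vfield G) by exact: smooth_left.
have sy : smooth_vfield (left_inv_field y : vfield G) by exact: smooth_left.
have := lc_torsion_free hnabla sx sy e.
rewrite !left_inv_field1 !nabla_left_field => E; apply/rowP => i.
rewrite mxE [X in _ + X]mxE.
exact: (congr1 (fun T : tens R n => T [:: i]) E).
Qed.

Hypothesis hg : riemannian_metric g.
Hypothesis hginv : left_invariant_metric g.

Lemma metric_sym u : (g u)^T = g u.
Proof. by case: hg. Qed.

Lemma gform_left u x y :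
  gform (g u) (left_inv_field x u) (left_inv_field y u) = gform (g e) x y.
Proof.
rewrite -(hginv u e x y); congr (gform (g _) _ _).
by rewrite /Defs.left_trans mulg1.
Qed.

Lemma left_inv_field_surj (u : G) v : exists x, v = left_inv_field x u.
Proof.
exists (v *m invmx (Lmat u)); rewrite left_inv_fieldE.
exact: (esym (mulmxKV (Lmat_unit u) v)).
Qed.

(** Left-invariant fields have constant scalar products, so the left-hand side of [lc_metric] is the
    derivative of a constant. *)
Lemma nabla_left_metric u v x y :
  gform (g u) (vec_part (nabla u v (tvfield (left_inv_field x)))) (left_inv_field y u) +
  gform (g u) (left_inv_field x u) (vec_part (nabla u v (tvfield (left_inv_field y)))) = 0.
Proof.
have sx : smooth_vfield (left_inv_field x : vfield G) by exact: smooth_left.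
have sy : smooth_vfield (left_inv_field y : vfield G) by exact: smooth_left.
rewrite -(lc_metric hnabla sx sy u v).
have -> : (fun q => gform (g q) (left_inv_field x q) (left_inv_field y q)) =
    (fun=> gform (g e) x y) by apply/funext => q; rewrite gform_left.
exact: derive_cst.
Qed.

Lemma vec_part_vec (v : 'rV[R]_n) : vec_part (tvec v) = v.
Proof. by apply/rowP => i; rewrite mxE. Qed.

Lemma Gam_metric v x y : gform (g e) (x *m Gam v) y + gform (g e) x (y *m Gam v) = 0.
Proof.
have := nabla_left_metric e v x y.
by rewrite !nabla_left_field !vec_part_vec !left_inv_field1.
Qed.

(* [<nabla_y X, y> = <nabla_X y, y> + <[y, X], y>] and [nabla_X y] is
   orthogonal to the left-invariant field [y], which has constant length. *)
Lemma killing_from_bracket (X : vfield G) : smooth_vfield X ->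
  (forall u y, gform (g u) (bracket (left_inv_field y) X u) (left_inv_field y u) = 0) ->
  killing g nabla (tvfield X).
Proof.
move=> sX bX u f fo.
pose N : 'M[R]_n := \matrix_i vec_part (nabla u (delta_mx 0 i) (tvfield X)).
have stX := smooth_tvfield sX.
have nl v : nabla u v (tvfield X) = tvec (v *m N).
  rewrite (nabla_vec hnabla _ _ sX); congr tvec.
  have lin c w w' : vec_part (nabla u (c *: w + w') (tvfield X)) =
      c *: vec_part (nabla u w (tvfield X)) + vec_part (nabla u w' (tvfield X)).
    by rewrite (lc_linear hnabla stX); apply/rowP => i; rewrite !mxE.
  have lin0 : vec_part (nabla u 0 (tvfield X)) = 0.
    by have := lin (-1) 0 0; rewrite scaler0 addr0 scaleN1r addNr.
  rewrite mulmx_sum_row [in LHS](row_sum_delta v).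
  have : forall r : seq 'I_n,
    vec_part (nabla u (\sum_(j <- r) v 0 j *: delta_mx 0 j) (tvfield X)) =
    \sum_(j <- r) v 0 j *: row j N.
    elim=> [|j r IHr]; first by rewrite !big_nil.
    by rewrite !big_cons lin IHr rowK.
  exact.
rewrite /killing_operator.
transitivity (\sum_k sprod (tvec (f k)) (tvec (f k *m N))).
  by apply: eq_bigr => k _; rewrite nl.
apply: (skew_endo_killing (metric_sym u) fo) => v.
have [y ->] := left_inv_field_surj u v.
have sy : smooth_vfield (left_inv_field y : vfield G) by exact: smooth_left.
have tor := lc_torsion_free hnabla sy sX u.
have nE : left_inv_field y u *m N = vec_part (nabla u (X u) (tvfield (left_inv_field y))) +
    bracket (left_inv_field y) X u.
  rewrite -(vec_part_vec (_ *m N)) -nl -(vec_part_vec (bracket _ _ _)) -tor.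
  apply/rowP => i; rewrite !mxE.
  by rewrite addrC -[X in X + _]/(nabla u (left_inv_field y u) (tvfield X) [:: i] -
     nabla u (X u) (tvfield (left_inv_field y)) [:: i]) subrK.
rewrite nE gformDl bX addr0.
have := nabla_left_metric u (X u) y y.
rewrite [X in _ + X]gform_sym; last exact: metric_sym.
by rewrite -mulr2n => /eqP; rewrite mulrn_eq0 => /eqP.
Qed.

Lemma killing_right x : killing g nabla (tvfield (right_inv_field x : vfield G)).
Proof.
apply: killing_from_bracket; first exact: smooth_right.
move=> u y.
have -> : bracket (left_inv_field y) (right_inv_field x : vfield G) u = 0.
  apply/eqP; rewrite -oppr_eq0 opprB; apply/eqP; exact: bracket_right_left.
exact: gform0l.
Qed.

Lemma killing_left b :
  (forall y, gform (g e) (lie_bracket G y b) y = 0) ->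
  killing g nabla (tvfield (left_inv_field b : vfield G)).
Proof.
move=> hb; apply: killing_from_bracket; first exact: smooth_left.
by move=> u y; rewrite bracket_left_inv gform_left.
Qed.

Lemma left_inv_field_left b : left_invariant (tvfield (left_inv_field b : vfield G)).
Proof.
move=> a u.
have E : left_inv_field b (a * u)%g = left_inv_field b u *m tangent_map (Defs.left_trans a) u.
  transitivity (b *m (Lmat u *m tangent_map (Defs.left_trans a) u)); last exact: mulmxA.
  exact: (congr1 (mulmx b) (LmatM a u)).
have P := tpush_vec (tangent_map (Defs.left_trans a) u) (left_inv_field b u).
exact: (etrans (congr1 (@tvec R n) E) (esym P)).
Qed.

Lemma left_invariantE (K : tfield G) : left_invariant K ->
  K = (fun u => tpush (Lmat u) (K e)).
Proof.
move=> hK; apply/funext => u; rewrite -(hK u e); congr K.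
by rewrite /Defs.left_trans mulg1.
Qed.

(** [is_metric_tensor] must be checked against every orthonormal basis at [u]. The components of the
    sum depend on the basis only through [E^T *m E], which [orthonormal_inv] identifies with the
    inverse metric. *)
Lemma metric_left_frame (f : 'I_n -> 'rV[R]_n) : Defs.orthonormal (g e) f ->
  is_metric_tensor g (fun u => 2^-1 *:
    \sum_i sprod (tvec (left_inv_field (f i) u)) (tvec (left_inv_field (f i) u))).
Proof.
move=> fo u h ho; congr (_ *: _).
have fo' : Defs.orthonormal (g u) (fun i => left_inv_field (f i) u).
  by move=> i j; rewrite gform_left.
have i1 := orthonormal_inv fo'; have i2 := orthonormal_inv ho.
have [_ gu] := mulmx1_unit i1.
apply/funext => w; rewrite !fct_sumE.
under eq_bigr do rewrite sprod_vec; under [RHS]eq_bigr do rewrite sprod_vec.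
case: w => [|i [|j [|k w]]] //.
have E : (\matrix_k left_inv_field (f k) u)^T *m (\matrix_k left_inv_field (f k) u) =
    (\matrix_k h k)^T *m \matrix_k h k.
  by apply: (can_inj (mulmxK gu)); rewrite i1 i2.
rewrite !big_split /= (sum_outer (fun k => left_inv_field (f k) u) (fun k => left_inv_field (f k) u)).
rewrite (sum_outer (fun k => left_inv_field (f k) u) (fun k => left_inv_field (f k) u) j i).
by rewrite (sum_outer h h) (sum_outer h h j i) E.
Qed.

End LeftInvariantTensors.

(** * Almost abelian groups *)

Section GramSchmidt.
Variables (R : realType) (n : nat) (g : 'M[R]_n).
Hypothesis gT : g^T = g.
Hypothesis gpos : forall x : 'rV[R]_n, x != 0 -> 0 < gform g x x.

Definition orthofam k (f : 'I_k -> 'rV[R]_n) :=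
  forall i j, gform g (f i) (f j) = (i == j)%:R.

Lemma gform_suml (I : Type) (r : seq I) (F : I -> 'rV[R]_n) y :
  gform g (\sum_(i <- r) F i) y = \sum_(i <- r) gform g (F i) y.
Proof.
elim: r => [|i r IH]; first by rewrite !big_nil gform0l.
by rewrite !big_cons gformDl IH.
Qed.

(** The new vector takes the index [ord_max], which is the index of the polynomial variable ['X]. *)
Definition extend k (f : 'I_k -> 'rV[R]_n) (v : 'rV[R]_n) (i : 'I_k.+1) :=
  if unlift ord_max i is Some j then f j else v.

Lemma extend_lift k f v (i : 'I_k) : extend f v (lift ord_max i) = f i.
Proof. by rewrite /extend liftK. Qed.

Lemma extend_max k (f : 'I_k -> 'rV[R]_n) v : extend f v ord_max = v.
Proof. by rewrite /extend unlift_none. Qed.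

Lemma orthofam_extend k (U : {vspace 'rV[R]_n}) (f : 'I_k -> 'rV[R]_n) :
  (k < \dim U)%N -> (forall i, f i \in U) -> orthofam f ->
  exists2 v, v \in U & orthofam (extend f v).
Proof.
move=> kU fU fo; set W := <<[seq f i | i <- enum 'I_k]>>%VS.
have /subvPn[u uU uW] : ~~ (U <= W)%VS.
  apply: contraTN kU => /dimvS UW; rewrite -leqNgt (leq_trans UW) //.
  by rewrite (leq_trans (dim_span _)) // size_map size_enum_ord.
pose w := u - \sum_i gform g u (f i) *: f i.
have w0 : w != 0.
  apply: contraNneq uW => /subr0_eq ->; apply: memv_suml => i _.
  by apply/memvZ/memv_span/map_f; rewrite mem_enum.
have wU : w \in U by rewrite memvB // memv_suml // => i _; rewrite memvZ.
have wf i : gform g w (f i) = 0.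
  rewrite /w -scaleN1r gformDl gformZl gform_suml (bigD1 i) //= gformZl fo eqxx mulr1.
  rewrite big1 ?addr0 ?mulN1r ?subrr // => j ji.
  by rewrite gformZl fo (negbTE ji) mulr0.
pose c := (Num.sqrt (gform g w w))^-1.
exists (c *: w); first exact: memvZ.
have ww := gpos w0.
move=> i j; case: (unliftP ord_max i) => [i'|] ->; case: (unliftP ord_max j) => [j'|] ->.
- by rewrite !extend_lift fo (inj_eq (@lift_inj _ _)).
- rewrite extend_lift extend_max gformZr gform_sym // wf mulr0.
  by rewrite eq_sym (negbTE (neq_lift _ _)).
- by rewrite extend_lift extend_max gformZl wf mulr0 (negbTE (neq_lift _ _)).
- rewrite extend_max gformZl gformZr mulrA -expr2 exprVn sqr_sqrtr ?(ltW ww) // eqxx.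
  by rewrite mulVf // gt_eqF.
Qed.

Lemma orthofam_exists (U : {vspace 'rV[R]_n}) k : (k <= \dim U)%N ->
  exists2 f : 'I_k -> 'rV[R]_n, (forall i, f i \in U) & orthofam f.
Proof.
elim: k => [|k IH] kU; first by exists (fun=> 0) => [] [].
have [f fU fo] := IH (ltnW kU).
have [v vU vo] := orthofam_extend kU fU fo; exists (extend f v) => // i.
by case: (unliftP ord_max i) => [j|] ->; rewrite ?extend_lift ?extend_max.
Qed.

End GramSchmidt.

Lemma vprod_homogeneous (R : realType) n p (v : 'I_p -> 'rV[R]_n) : homogeneous p (vprod v).
Proof.
move=> w; elim: w p v => [|i w IH] [|p] v // wp; rewrite ?vprod0 ?vprod_nil //.
by rewrite vprod_cons big1 // => j _; rewrite IH ?mulr0.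
Qed.

Lemma Sym_homogeneous (R : realType) n p (T : tens R n) : Defs.Sym p T -> homogeneous p T.
Proof.
move=> [N [c [v ->]]] w wp; rewrite fct_sumE big1 // => i _.
by transitivity (c i * vprod (v i) w); rewrite // (vprod_homogeneous _ wp) mulr0.
Qed.

Lemma big_ord_lift_max (V : nmodType) m (F : 'I_m.+1 -> V) :
  \sum_i F i = \sum_(i < m) F (lift ord_max i) + F ord_max.
Proof.
rewrite big_ord_recr /=; congr (_ + _).
by apply: eq_bigr => i _; rewrite widen_ord_lift_max.
Qed.

(** * Structure constants and connection coefficients in an adapted frame *)

Section StructureConstants.
Variables (R : realType) (m : nat).
Notation B := {poly (mpoly m R)}.
Variable s : 'I_m.+1 -> 'I_m.+1 -> 'I_m.+1 -> R.
Hypothesis s_hh : forall i a j, s (lift ord_max i) (lift ord_max a) j = 0.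
Hypothesis s_max : forall i a, s i (lift ord_max a) ord_max = 0.
Hypothesis sC : forall i a j, s i a j = - s a i j.

Definition ad_lin (a : 'I_m) : mpoly m R :=
  \sum_c mpolyC m (s ord_max (lift ord_max a) (lift ord_max c)) * mpolyX R (mnm1 c).

Lemma s_diag i j : s i i j = 0.
Proof. by have := sC i i j; set t := s i i j => ?; lra. Qed.

Lemma pvar_max : pvar R (ord_max : 'I_m.+1) = 'X :> B.
Proof. by rewrite /pvar unlift_none. Qed.

Lemma pvar_lift (i : 'I_m) : pvar R (lift ord_max i) = (mpolyX R (mnm1 i))%:P :> B.
Proof. by rewrite /pvar liftK. Qed.

Lemma plin_s a : plin (s ord_max (lift ord_max a)) = (ad_lin a)%:P :> B.
Proof.
rewrite /plin big_ord_lift_max s_max rmorph0 mul0r addr0 rmorph_sum /=.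
by apply: eq_bigr => c _; rewrite pvar_lift rmorphM.
Qed.

(** For [a] in the ideal, abelianness leaves only the term [i = ord_max], which is ['X] times a
    linear form. For [a = ord_max], antisymmetry of the bracket produces the sign in front of the
    quadratic form. *)
Lemma sum_s a : \sum_i pvar R i * plin (s i a) = killing_field_der ad_lin a :> B.
Proof.
rewrite big_ord_lift_max /killing_field_der.
case: (unliftP ord_max a) => [a'|] ->.
  rewrite plin_s pvar_max big1 ?add0r // => i _.
  rewrite /plin big1 ?mulr0 // => j _.
  by rewrite s_hh rmorph0 mul0r.
rewrite /hquad [X in _ + X](_ : _ = 0) ?addr0; last first.
  by rewrite /plin big1 ?mulr0 // => j _; rewrite s_diag rmorph0 mul0r.
rewrite rmorph_sum -sumrN; apply: eq_bigr => i _.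
rewrite rmorphM /= -plin_s -pvar_lift -mulrN; congr (_ * _).
rewrite /plin -sumrN; apply: eq_bigr => j _.
by rewrite sC rmorphN mulNr.
Qed.

Variable c : 'I_m.+1 -> 'I_m.+1 -> 'I_m.+1 -> R.
Hypothesis c_skew : forall i a j, c i a j = - c i j a.
Hypothesis c_torsion : forall i a j, c i a j = c a i j + s i a j.

Lemma sum_skew (d : 'I_m.+1 -> 'I_m.+1 -> R) : (forall i j, d i j = - d j i) ->
  \sum_i \sum_j pcst m (d i j) * (pvar R i * pvar R j) = 0 :> B.
Proof.
move=> dC; set S := LHS.
have S2 : S = - S.
  rewrite {1}/S exchange_big -sumrN; apply: eq_bigr => j _; rewrite -sumrN.
  by apply: eq_bigr => i _; rewrite dC rmorphN mulNr [pvar R i * _]mulrC.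
have : pcst m 2 * S = 0 by rewrite rmorphMn rmorph1 mulr_natl mulr2n {1}S2 addNr.
move/(congr1 (fun Q => pcst m 2^-1 * Q)); rewrite mulr0 mulrA -rmorphM.
by rewrite mulVf ?pnatr_eq0 // rmorph1 mul1r.
Qed.

Lemma mul_plin (Q : B) d : Q * plin d = \sum_j Q * (pcst m (d j) * pvar R j).
Proof. exact: mulr_sumr. Qed.

(** Torsion-freeness replaces [c i a j] by [c a i j + s i a j]. By metric compatibility [c a i j] is
    skew in [i] and [j], so it disappears against the symmetric product of the variables, and only
    structure constants remain. *)
Lemma sum_c a : \sum_i pvar R i * plin (c i a) = killing_field_der ad_lin a :> B.
Proof.
have Z := sum_skew (c_skew a).
transitivity (\sum_i \sum_j pcst m (c a i j) * (pvar R i * pvar R j) +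
    \sum_i pvar R i * plin (s i a)); last by rewrite Z add0r sum_s.
rewrite -big_split /=.
apply: eq_bigr => i _; apply: (etrans (mul_plin (pvar R i) (c i a))).
apply: (etrans _ (congr1 (fun z => \sum_j pcst m (c a i j) * (pvar R i * pvar R j) + z)
  (esym (mul_plin (pvar R i) (s i a))))).
transitivity (\sum_j (pcst m (c a i j) * (pvar R i * pvar R j) +
    pvar R i * (pcst m (s i a j) * pvar R j))); last exact: big_split.
apply: eq_bigr => j _; rewrite c_torsion rmorphD mulrDl mulrDr; congr (_ + _).
exact: mulrCA.
Qed.

End StructureConstants.

(** * Left-invariant Killing tensors on an almost abelian group *)

Section AlmostAbelian.
Variables (R : realType) (m : nat) (G : lieGroupType R m.+1).
Variables (g : G -> 'M[R]_m.+1) (nabla : connection G).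
Hypothesis hconn : connected [set: G].
Hypothesis hg : riemannian_metric g.
Hypothesis hginv : left_invariant_metric g.
Hypothesis hnabla : levi_civita g nabla.
Variable h : {vspace 'rV[R]_m.+1}.
Hypothesis hdim : \dim h = m.
Hypothesis habel : forall x y, x \in h -> y \in h -> lie_bracket G x y = 0.
Hypothesis hideal : forall x y, y \in h -> lie_bracket G x y \in h.

Notation e := (1%g : G).
Notation ge := (g e).
Notation B := {poly (mpoly m R)}.

Variable f : 'I_m.+1 -> 'rV[R]_m.+1.
Hypothesis fo : Defs.orthonormal ge f.
Hypothesis fh : forall i, f (lift ord_max i) \in h.

Let E : 'M[R]_m.+1 := \matrix_i f i.
Let E' : 'M[R]_m.+1 := ge *m E^T.
Let b := f ord_max.

Let geT : ge^T = ge. Proof. by case: hg. Qed.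

Let EE' : E *m E' = 1%:M.
Proof. by rewrite mulmxA; exact: orthonormal_mx. Qed.

Let E'E : E' *m E = 1%:M.
Proof. exact: mulmx1C. Qed.

Let expand x : x = \sum_a gform ge x (f a) *: f a.
Proof.
rewrite -[LHS]mulmx1 -E'E mulmxA mulmx_sum_row; apply: eq_bigr => a _.
by rewrite rowK; congr (_ *: _); rewrite mulmxA /gform !mxE; apply: eq_bigr => k _; rewrite !mxE.
Qed.

Let coefE (A : 'M[R]_m.+1) a j : (E *m A *m E') a j = gform ge (f a *m A) (f j).
Proof.
rewrite /E' mulmxA /gform -[f a](rowK f) -/E -!row_mul.
by rewrite [LHS]mxE [RHS]mxE [RHS]mxE; apply: eq_bigr => k _; rewrite !mxE.
Qed.

(** If some vector of [h] had a component along [b], then [b] would lie in [h] together with the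
    other basis vectors, against [\dim h = m]. *)
Let h_perp x : x \in h -> gform ge x b = 0.
Proof.
move=> xh; apply/eqP; apply: contraTT isT => xb0.
have bh : b \in h.
  have := expand x; rewrite big_ord_lift_max -/b => /eqP; rewrite addrC -subr_eq => /eqP xE.
  have : gform ge x b *: b \in h.
    by rewrite -xE memvB // memv_suml // => i _; rewrite memvZ.
  by move/(memvZ (gform ge x b)^-1); rewrite scalerA mulVf // scale1r.
have : (fullv <= h)%VS.
  apply/subvP => y _; rewrite (expand y); apply: memv_suml => a _; apply: memvZ.
  by case: (unliftP ord_max a) => [a'|] ->.
by move=> /dimvS; rewrite dimvf /dim /= mul1n hdim ltnn.
Qed.

Let bracketC x y : lie_bracket G x y = - lie_bracket G y x.
Proof. by rewrite -!(Gam_torsion hnabla) opprB. Qed.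

Let bracket_suml (I : Type) (r : seq I) (c : I -> R) (F : I -> 'rV[R]_m.+1) y :
  lie_bracket G (\sum_(i <- r) c i *: F i) y = \sum_(i <- r) c i *: lie_bracket G (F i) y.
Proof.
rewrite bracketC lie_bracketE mulmx_suml -sumrN; apply: eq_bigr => i _.
by rewrite [in RHS]bracketC lie_bracketE -scalemxAl scalerN.
Qed.

Let s i a j := gform ge (lie_bracket G (f i) (f a)) (f j).
Let l := ad_lin s.

Let s_hh i a j : s (lift ord_max i) (lift ord_max a) j = 0.
Proof. by rewrite /s habel // gform0l. Qed.

Let s_max i a : s i (lift ord_max a) ord_max = 0.
Proof. by rewrite /s h_perp // hideal. Qed.

Let sC i a j : s i a j = - s a i j.
Proof. by rewrite /s bracketC -scaleN1r gformZl mulN1r. Qed.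

Let c i a j := gform ge (f a *m Gam nabla (f i)) (f j).

Let c_skew i a j : c i a j = - c i j a.
Proof.
apply/eqP; rewrite -addr_eq0 /c [X in _ + X]gform_sym //.
by rewrite (Gam_metric hnabla hginv).
Qed.

Let c_torsion i a j : c i a j = c a i j + s i a j.
Proof.
by rewrite /c /s -(Gam_torsion hnabla) -gformDl addrC subrK.
Qed.

(** A left-invariant tensor field is determined by its value at 1, which is the jet of a polynomial
    in the frame [f]; the covariant derivatives of the field at 1 then act on that polynomial as
    derivations. *)
Lemma killing_polynomial p (K : tfield G) :
  sym_tensor_field p K -> left_invariant K -> killing g nabla K ->
  exists2 P : B, K = (fun u => jet (E *m Lmat u) P) & pder (killing_field_der l) P = 0.
Proof.
move=> [_ Ksym] Kinv Kkill.
have [P PE] := Sym_jet E'E (Ksym e); have KE := left_invariantE Kinv.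
exists P.
  by apply: (etrans KE); apply/funext => u; rewrite PE; exact: tpush_jet.
have hom := Sym_homogeneous (Ksym e).
(* The Killing equation is used at the identity and in the frame [f] alone; injectivity of [jet E]
   makes it an equation between polynomials. *)
apply: (jet_inj EE'); rewrite -(Kkill e f fo) /killing_operator.
have nK i : nabla e (f i) K = jet E (pder (fun a => plin (c i a)) P).
  rewrite KE; have [_ nL] := nabla_left_inv hnabla (f i) hom; apply: (etrans nL).
  rewrite PE; have Cf : E *m Gam nabla (f i) = E *m Gam nabla (f i) *m E' *m E.
    by rewrite -[RHS]mulmxA E'E mulmx1.
  apply: (etrans (tder_jet P Cf)).
  have CE : (fun a => plin ((E *m Gam nabla (f i) *m E') a)) = (fun a => plin (c i a)).
    by apply/funext => a; apply: (congr1 (@plin R m)); apply/funext => j; exact: coefE.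
  exact: (congr1 (fun Y => jet E (pder Y P)) CE).
transitivity (jet E (\sum_i pvar R i * pder (fun a => plin (c i a)) P)).
  congr (jet _ _); rewrite /pder; under [RHS]eq_bigr do rewrite mulr_sumr.
  rewrite exchange_big /=; apply: eq_bigr => a _.
  rewrite -(sum_c s_hh s_max sC c_skew c_torsion) mulr_suml.
  by apply: eq_bigr => i _; rewrite mulrA.
rewrite raddf_sum; apply: eq_bigr => i _ /=; rewrite jetM nK jet_var.
by rewrite rowK.
Qed.

Local Notation PI K := (polynomial_in (generator g nabla) (K : tfield G)).

Lemma row_mulE (A : 'M[R]_m.+1) a : row a (E *m A) = f a *m A.
Proof. by rewrite row_mul rowK. Qed.

(** Under [jet] the variables become right-invariant fields, which are Killing for any
    left-invariant metric, so no condition on [Q] is needed. *)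
Lemma right_polynomial (Q : B) : PI (fun u => jet (E *m Rmat u) Q).
Proof.
elim/gen_ind: Q => [r|a|P Q HP HQ|P Q HP HQ].
- by under eq_fun do rewrite jet_cst; exact: poly_const.
- have -> : (fun u : G => jet (E *m Rmat u) (pvar R a)) =
      tvfield (right_inv_field (f a) : vfield G).
    apply/funext => u; apply: (etrans (jet_var _ _)); apply: (congr1 (@tvec R m.+1)).
    by apply: (etrans (row_mulE _ _)); rewrite right_inv_fieldE.
  apply: poly_gen; right; exists (right_inv_field (f a)); last by [].
  split; last by left; exists (f a).
  split; first exact: smooth_right.
  exact: killing_right.
- by under eq_fun do rewrite raddfD; exact: (poly_add HP HQ).
- by under eq_fun do rewrite jetM; exact: (poly_mul HP HQ).
Qed.

(* On tensors over the abelian ideal, [y] acts as its component along [b]. *)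
Lemma tder_ad_invariant (q : mpoly m R) y : hder l q = 0 ->
  tder (adm G y) (jet E q%:P) = (fun=> 0).
Proof.
move=> lq.
have AE : E *m adm G y = E *m adm G y *m E' *m E.
  by rewrite -[RHS]mulmxA E'E mulmx1.
apply: (etrans (tder_jet _ AE)).
suff -> : pder (fun a => plin ((E *m adm G y *m E') a)) q%:P = 0 by rewrite raddf0.
rewrite /pder big_ord_lift_max [X in _ + X](_ : _ = 0) ?addr0; last first.
  by rewrite /pderiv unlift_none derivC mulr0.
transitivity (pcst m (gform ge y b) * (hder l q)%:P); last by rewrite lq mulr0.
rewrite /hder rmorph_sum mulr_sumr; apply: eq_bigr => a _ /=.
rewrite /pderiv liftK map_polyC /= rmorphM mulrA; congr (_ * _).
apply: (etrans _ (congr1 (fun z => pcst m (gform ge y b) * z) (plin_s s_max a))).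
rewrite /plin mulr_sumr; apply: eq_bigr => j _.
rewrite mulrA -rmorphM; congr (pcst m _ * _).
rewrite coefE -lie_bracketE {1}(expand y) bracket_suml big_ord_lift_max big1 ?add0r.
  by rewrite gformZl.
by move=> i _; rewrite habel // scaler0.
Qed.

(* The left translate by [u] is the right translate of the image under [Ad u]. *)
Lemma invariant_polynomial (q : mpoly m R) : hder l q = 0 ->
  PI (fun u => jet (E *m Lmat u) q%:P).
Proof.
move=> lq; have -> : (fun u : G => jet (E *m Lmat u) q%:P) =
    (fun u => jet (E *m Rmat u) q%:P); last exact: right_polynomial.
apply/funext => u.
transitivity (tpush (Rmat u) (tpush (Ad u) (jet E q%:P))).
  apply: (etrans _ (tpush_comp _ _ _)); rewrite AdK.
  exact: (esym (tpush_jet _ _ _)).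
transitivity (tpush (Rmat u) (jet E q%:P)); last exact: tpush_jet.
apply: congr1; apply/funext => w.
apply: tpush_Ad_inv hconn => y; exact: tder_ad_invariant.
Qed.

Local Notation PL P := (PI (fun u => jet (E *m Lmat u) P)).

Lemma left_polynomial_cst r : PL (pcst m r).
Proof. by under eq_fun do rewrite jet_cst; exact: poly_const. Qed.

Lemma left_polynomialD (P Q : B) : PL P -> PL Q -> PL (P + Q).
Proof. by move=> HP HQ; under eq_fun do rewrite raddfD; exact: (poly_add HP HQ). Qed.

Lemma left_polynomialM (P Q : B) : PL P -> PL Q -> PL (P * Q).
Proof. by move=> HP HQ; under eq_fun do rewrite jetM; exact: (poly_mul HP HQ). Qed.

Lemma left_polynomialX (P : B) k : PL P -> PL (P ^+ k).
Proof.
move=> HP; elim: k => [|k IH]; last by rewrite exprS; exact: left_polynomialM.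
by rewrite expr0 -(rmorph1 (pcst m)); exact: left_polynomial_cst.
Qed.

(** This serves both cases of the final argument: [P] is [H] when the quadratic form is nonzero, and
    ['X] when it vanishes. *)
Lemma left_polynomial_comp (C P : B) : (forall i, hder l C`_i = 0) -> PL P -> PL (C \Po P).
Proof.
move=> lC HP; rewrite comp_polyE.
elim/big_ind: _ => [|P1 P2|i _].
- by rewrite -(rmorph0 (pcst m)); exact: left_polynomial_cst.
- exact: left_polynomialD.
- rewrite -mul_polyC; apply: left_polynomialM; last exact: left_polynomialX.
  exact: invariant_polynomial.
Qed.

Lemma left_frame_row a (u : G) : tvec (row a (E *m Lmat u)) = tvec (left_inv_field (f a) u).
Proof. by apply: congr1; rewrite row_mulE left_inv_fieldE. Qed.

Lemma metric_polynomial : PL ('X^2 + (hnorm R m)%:P).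
Proof.
set H : B := _ + _.
have HE : H = \sum_a pvar R a * pvar R a.
  rewrite big_ord_lift_max pvar_max -expr2 addrC; congr (_ + _).
  by rewrite /hnorm rmorph_sum; apply: eq_bigr => i _; rewrite pvar_lift /= expr2 rmorphM.
(* The generator carries the factor 1/2 of the metric tensor, so the 2 is split off as a constant
   polynomial. *)
have -> : H = pcst m 2 * (pcst m 2^-1 * H).
  by rewrite mulrA -rmorphM mulfV ?pnatr_eq0 // rmorph1 mul1r.
apply: left_polynomialM; first exact: left_polynomial_cst.
have -> : (fun u : G => jet (E *m Lmat u) (pcst m 2^-1 * H)) =
  (fun u => 2^-1 *: \sum_i sprod (tvec (left_inv_field (f i) u)) (tvec (left_inv_field (f i) u))).
  apply/funext => u; apply: (etrans (jetZ _ _ _)); congr (_ *: _).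
  rewrite HE raddf_sum; apply: eq_bigr => i _ /=.
  by rewrite jetM jet_var left_frame_row.
by apply: poly_gen; left; exact: (metric_left_frame hginv fo).
Qed.

(** The number <[y, b], y> is minus the value of the quadratic form at the coordinates of [y] along
    the ideal: [y, b] is the combination of the -[b, f_a] with these coordinates, and it has no
    component along [b]. *)
Lemma skew_killing_left : hquad l = 0 ->
  killing g nabla (tvfield (left_inv_field b : vfield G)).
Proof.
move=> lq0; apply: killing_left => // y.
have eq0 : \sum_a gform ge y (f (lift ord_max a)) *
    \sum_c s ord_max (lift ord_max a) (lift ord_max c) * gform ge y (f (lift ord_max c)) = 0.
  (* The hypothesis is an identity of polynomials; [meval] at the coordinates of [y] makes it one of
     numbers. *)
  apply: (etrans _ (etrans (congr1 (meval (fun a => gform ge y (f (lift ord_max a)))) lq0)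
    (raddf0 _))).
  rewrite /hquad raddf_sum; apply: eq_bigr => a _ /=.
  rewrite mevalM mevalXU; congr (_ * _); rewrite /l /ad_lin raddf_sum; apply: eq_bigr => k _ /=.
  by rewrite mevalM mevalC mevalXU.
rewrite gform_sym // {1}(expand y) gform_suml big_ord_lift_max.
have yb k : gform ge (lie_bracket G y b) (f k) =
    - \sum_(a < m) gform ge y (f (lift ord_max a)) * s ord_max (lift ord_max a) k.
  apply: (etrans (congr1 (fun z => gform ge (lie_bracket G z b) (f k)) (expand y))).
  apply: (etrans (congr1 (fun z => gform ge z (f k)) (bracket_suml _ _ _ _))).
  rewrite gform_suml big_ord_lift_max.
  transitivity (\sum_(a < m) - (gform ge y (f (lift ord_max a)) * s ord_max (lift ord_max a) k) +
      gform ge y b * s ord_max ord_max k); last by rewrite (s_diag sC) mulr0 addr0 sumrN.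
  apply: congr2; last exact: gformZl.
  by apply: eq_bigr => a _; rewrite -mulrN -sC; exact: gformZl.
have yb' k : gform ge (f k) (lie_bracket G y b) =
    - \sum_(a < m) gform ge y (f (lift ord_max a)) * s ord_max (lift ord_max a) k.
  by apply: etrans (yb k); exact: gform_sym.
have yb0 : gform ge (f ord_max) (lie_bracket G y b) = 0.
  by apply: (etrans (yb' _)); rewrite big1 ?oppr0 // => a _; rewrite s_max mulr0.
transitivity (- \sum_a gform ge y (f (lift ord_max a)) *
    \sum_k s ord_max (lift ord_max a) (lift ord_max k) * gform ge y (f (lift ord_max k)));
  last by rewrite eq0 oppr0.
rewrite [X in _ + X]gformZl yb0 mulr0 addr0.
transitivity (\sum_k gform ge y (f (lift ord_max k)) *
   (- \sum_(a < m) gform ge y (f (lift ord_max a)) *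
      s ord_max (lift ord_max a) (lift ord_max k))).
  by apply: eq_bigr => k _; apply: (etrans (gformZl _ _ _ _)); rewrite yb'.
under eq_bigr => k _ do rewrite mulrN mulr_sumr.
rewrite sumrN; congr (- _); rewrite exchange_big; apply: eq_bigr => a _ /=.
rewrite mulr_sumr; apply: eq_bigr => k _; rewrite mulrCA; congr (_ * _); exact: mulrC.
Qed.

Lemma killing_polynomial_in p (K : tfield G) :
  sym_tensor_field p K -> left_invariant K -> killing g nabla K -> PI K.
Proof.
move=> Ksym Kinv Kkill; have [P -> lP] := killing_polynomial Ksym Kinv Kkill.
have [lq|lq] := eqVneq (hquad l) 0; last first.
  have [C lC ->] := killing_kernel_nonskew lq lP.
  exact/left_polynomial_comp/metric_polynomial.
(* Here [P] is its own composition with ['X], and the Killing field of [b] takes over the role of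
   the metric. *)
rewrite -[P]comp_polyXr; apply: left_polynomial_comp.
  by move=> i; exact: killing_kernel_skew lq lP.
rewrite -pvar_max.
have -> : (fun u : G => jet (E *m Lmat u) (pvar R ord_max)) =
    tvfield (left_inv_field b : vfield G).
  by apply/funext => u; apply: (etrans (jet_var _ _)); exact: left_frame_row.
apply: poly_gen; right; exists (left_inv_field b); last by [].
split; last by right; exact: left_inv_field_left.
by split; [exact: smooth_left | exact: skew_killing_left].
Qed.

End AlmostAbelian.

Theorem theorem5p2 (R : realType) (n : nat) (G : lieGroupType R n)
    (g : G -> 'M[R]_n) (nabla : connection G)
    (hconn : connected [set: G]%classic)
    (hab : almost_abelian G)
    (hg : riemannian_metric g)
    (hginv : left_invariant_metric g)
    (hnabla : levi_civita g nabla)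
    (p : nat) (K : tfield G)
    (hK : sym_tensor_field p K)
    (hKinv : left_invariant K)
    (hKkill : killing g nabla K) :
  polynomial_in (generator g nabla) K.
Proof.
have [h [hdim habel hideal]] := hab.
(* Codimension 1 excludes [n = 0]; with [n = m.+1] there are [m] variables for the ideal and one for
   its complement. *)
case: n G g nabla hconn hab hg hginv hnabla K hK hKinv hKkill h hdim habel hideal => [//|m] G g
  nabla hconn _ hg hginv hnabla K hK hKinv hKkill h [hdim] habel hideal.
have [_ gT gpos] := hg.
have [f0 f0h f0o] : exists2 f0 : 'I_m -> 'rV[R]_m.+1, (forall i, f0 i \in h) &
    orthofam (g 1%g) f0.
  by apply: (orthofam_exists (gT _) (gpos _)); rewrite hdim.
have [v _ fo] : exists2 v, v \in fullv & orthofam (g 1%g) (extend f0 v).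
  apply: (orthofam_extend (gT _) (gpos _)) => // [|i]; last exact: memvf.
  by rewrite dimvf /dim /= mul1n.
apply: (killing_polynomial_in hconn hg hginv hnabla hdim habel hideal fo _ hK hKinv hKkill).
by move=> i; rewrite extend_lift.
Qed.
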